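(* Let $K=\mathbb F_q(\theta)$ and let $(E_1,\varphi_1)$, $(E_2,\varphi_2)$ be the Drinfeld modules over $K$ given by $\varphi_1(t)=\theta+a\tau-\tau^2$ and $\varphi_2(t)=\theta+b\tau-\tau^2$ with $a,b\in K$ such that the following conditions hold: (i) there is a (non-zero) prime ideal $\ell\subseteq\mathbb F_q[\theta]$, $\ell\ne(\theta)$, such that $v_\ell(a)\ge0$, $v_\ell(b)<0$ and $\gcd(q,v_\ell(b))=1$; (ii) $\mathrm{Gal}(K(\varphi_2[t])/K)\supseteq\mathrm{SL}_2(\mathbb F_q)$. For $i=1,2$ let $K_i=\bigcup_{k\ge1}K(\varphi_i[t^k])$, and let $K_C=\bigcup_{k\ge1}K(C[t^k])$, where $C$ is the Carlitz module. Then for the $t$-adic Galois representation $\varrho_{E_2,t}$ one has $$\varrho_{E_2,t}\bigl(\mathrm{Gal}(K_2/K_C)\bigr)=\mathrm{SL}_2(\mathbb F_q[[t]]),$$ and $K_1$ and $K_2$ are linearly disjoint over $K_C$. In particular, for $L=K$ and $\mathfrak p=(t)$: both $\varphi_i$ have top coefficient $(-1)^{2-1}=-1$ and $K_1\cap K_2=K_C$.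
   Context: $q$ is a power of a prime, $v_\ell$ is the $\ell$-adic valuation on $K$. $K\{\tau\}$ is the twisted polynomial ring with $\tau c=c^q\tau$; a Drinfeld module $\varphi:\mathbb F_q[t]\to K\{\tau\}$ of rank $r$ has $\varphi(t)=\theta+b_1\tau+\dots+b_r\tau^r$, $b_r\ne0$, where $\tau$ acts as the $q$-Frobenius $x\mapsto x^q$. The Carlitz module is $C(t)=\theta+\tau$. For $a\in\mathbb F_q[t]$, $\varphi[a]=\ker\varphi(a)\subseteq K^{\mathrm{sep}}$, a free $\mathbb F_q[t]/(a)$-module of rank $r$. For rank $2$, $\mathrm{Gal}(K(\varphi[t])/K)$ is viewed in $\mathrm{GL}_2(\mathbb F_q)$ via its action on $\varphi[t]\cong\mathbb F_q^2$, and $\varrho_{E_2,t}:\mathrm{Gal}(K^{\mathrm{sep}}/K)\to\mathrm{GL}_2(\mathbb F_q[[t]])$ is the action on the $t$-adic Tate module $\varprojlim_k\varphi_2[t^k]\cong\mathbb F_q[[t]]^2$ (with respect to some basis); it factors through $\mathrm{Gal}(K_2/K)$. Because the top coefficient of $\varphi_i(t)$ is $-1$, one has $K_C\subseteq K_i$ and the determinant of $\varrho_{E_i,t}$ is the $t$-adic representation of the Carlitz module. *)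

(* Defs.v *)
From HB Require Import structures.
From mathcomp Require Import all_boot all_order all_algebra all_field.
From mathcomp Require Import all_classical constructive_ereal.

Set Implicit Arguments.
Unset Strict Implicit.
Unset Printing Implicit Defensive.

Import Order.TTheory GRing.Theory Num.Theory.

Local Open Scope ring_scope.
Local Open Scope classical_set_scope.

(* [conv] is the product of R[[t]] when every [s j] is the identity, and that of
   K{tau} when [s j] is the j-th power of the q-Frobenius. *)

Section Conv.

Variables (R : nzRingType) (s : nat -> R -> R).
Hypothesis s_add : forall j, {morph s j : x y / x + y}.
Hypothesis s_mul : forall j, {morph s j : x y / x * y}.
Hypothesis s_one : forall j, s j 1 = 1.
Hypothesis s_0 : forall x, s 0 x = x.
Hypothesis s_comp : forall i j x, s i (s j x) = s (i + j)%N x.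

Definition conv (f g : nat -> R) (n : nat) : R :=
  \sum_(j < n.+1) f j * s j (g (n - j)%N).

Let s_zero j : s j 0 = 0.
Proof. by apply: (addrI (s j 0)); rewrite -s_add !addr0. Qed.

Let s_sum j I (r : seq I) (P : pred I) (E : I -> R) :
  s j (\sum_(i <- r | P i) E i) = \sum_(i <- r | P i) s j (E i).
Proof. exact: (big_morph (s j) (@s_add j) (s_zero j)). Qed.

Lemma conv_rev f g n :
  conv f g n = \sum_(j < n.+1) f (n - j)%N * s (n - j)%N (g j).
Proof.
rewrite /conv (reindex_inj rev_ord_inj) /=; apply: eq_bigr => j _.
by rewrite subSS subKn // -ltnS.
Qed.

Lemma convA f g h n : conv f (conv g h) n = conv (conv f g) h n.
Proof.
rewrite {1}/conv [RHS]conv_rev.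
pose coef3 j k := f j * (s j (g (n - j - k)%N) * s (n - k)%N (h k)).
transitivity (\sum_(j < n.+1) \sum_(k < n.+1 | (k <= n - j)%N) coef3 j k).
  apply: eq_bigr => /= j _; rewrite conv_rev s_sum big_distrr /=.
  rewrite (big_ord_narrow_leq (leq_subr _ _)) /=.
  apply: eq_bigr => k _; rewrite /coef3 s_mul s_comp /=; congr (_ * (_ * s _ _)).
  have := ltn_ord k; rewrite ltnS => kn; rewrite addnBA // subnKC //.
  by rewrite -ltnS.
rewrite (exchange_big_dep predT) //=; apply: eq_bigr => k _.
transitivity (\sum_(j < n.+1 | (j <= n - k)%N) coef3 j k).
  apply: eq_bigl => j; rewrite -ltnS -(ltnS j) -!subSn ?leq_ord //.
  by rewrite -subn_gt0 -(subn_gt0 j) -!subnDA addnC.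
rewrite (big_ord_narrow_leq (leq_subr _ _)) /conv big_distrl /=.
by apply: eq_bigr => j _; rewrite /coef3 -!subnDA addnC mulrA.
Qed.

Lemma convDl f g h n :
  conv (fun i => f i + g i) h n = conv f h n + conv g h n.
Proof. by rewrite -big_split; apply: eq_bigr => j _; rewrite mulrDl. Qed.

Lemma convDr f g h n :
  conv f (fun i => g i + h i) n = conv f g n + conv f h n.
Proof. by rewrite -big_split; apply: eq_bigr => j _; rewrite s_add mulrDr. Qed.

Lemma conv1l f n : conv (fun i => (i == 0%N)%:R) f n = f n.
Proof.
rewrite /conv big_ord_recl /= mul1r s_0 subn0 big1 ?addr0 // => j _.
by rewrite mul0r.
Qed.

Lemma conv1r f n : conv f (fun i => (i == 0%N)%:R) n = f n.
Proof.
rewrite conv_rev big_ord_recl /= s_one mulr1 subn0 big1 ?addr0 // => j _.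
by rewrite s_zero mulr0.
Qed.

End Conv.

(* [Fps f] stands for \sum_i (f i) t^i in R[[t]] *)

Record fps (R : Type) := Fps { fps_coef : nat -> R }.

HB.instance Definition _ (R : Type) := gen_eqMixin (fps R).
HB.instance Definition _ (R : Type) := gen_choiceMixin (fps R).

Section PowerSeries.

Variable R : comNzRingType.
Implicit Types f g h : fps R.

Lemma fpsP f g : fps_coef f =1 fps_coef g <-> f = g.
Proof. by split=> [|-> //]; case: f g => [f] [g] /= /funext ->. Qed.

Definition fps_zero : fps R := Fps (fun=> 0).
Definition fps_one : fps R := Fps (fun i => (i == 0%N)%:R).
Definition fps_opp f : fps R := Fps (fun i => - fps_coef f i).
Definition fps_add f g : fps R := Fps (fun i => fps_coef f i + fps_coef g i).
Definition fps_mul f g : fps R :=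
  Fps (conv (fun _ x => x) (fps_coef f) (fps_coef g)).

Fact fps_addA : associative fps_add.
Proof. by move=> f g h; apply/fpsP => i /=; rewrite addrA. Qed.
Fact fps_addC : commutative fps_add.
Proof. by move=> f g; apply/fpsP => i /=; rewrite addrC. Qed.
Fact fps_add0 : left_id fps_zero fps_add.
Proof. by move=> f; apply/fpsP => i /=; rewrite add0r. Qed.
Fact fps_addN : left_inverse fps_zero fps_opp fps_add.
Proof. by move=> f; apply/fpsP => i /=; rewrite addNr. Qed.

HB.instance Definition _ :=
  GRing.isZmodule.Build (fps R) fps_addA fps_addC fps_add0 fps_addN.

Fact fps_mulA : associative fps_mul.
Proof. by move=> f g h; apply/fpsP => i /=; apply: convA. Qed.
Fact fps_mulC : commutative fps_mul.
Proof.
move=> f g; apply/fpsP => i /=; rewrite conv_rev.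
by apply: eq_bigr => j _; rewrite mulrC.
Qed.
Fact fps_mul1 : left_id fps_one fps_mul.
Proof. by move=> f; apply/fpsP => i /=; apply: conv1l. Qed.
Fact fps_mulDl : left_distributive fps_mul +%R.
Proof. by move=> f g h; apply/fpsP => i /=; apply: convDl. Qed.
Fact fps_one_neq0 : fps_one != 0.
Proof. by apply/eqP => /fpsP /(_ 0%N) /eqP; rewrite /= oner_eq0. Qed.

HB.instance Definition _ := GRing.Zmodule_isComNzRing.Build (fps R)
  fps_mulA fps_mulC fps_mul1 fps_mulDl fps_one_neq0.

End PowerSeries.

(* F_q(theta), with q = #|F| *)

Definition ratfun (F : finFieldType) := {fraction {poly F}}.
HB.instance Definition _ (F : finFieldType) := GRing.Field.on (ratfun F).

Section RationalFunctions.

Variable F : finFieldType.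
Local Notation K := (ratfun F).
Local Notation q := #|F|.

Definition ratfun_of : {poly F} -> K := @FracField.tofrac {poly F}.
HB.instance Definition _ := GRing.RMorphism.on ratfun_of.

Definition theta : K := ratfun_of 'X.

(* multiplicity of l in p; meaningful for p != 0 and l non-constant, where
   l ^+ n %| p forces n < size p *)
Definition polymult (l p : {poly F}) : nat :=
  \max_(n < size p | l ^+ n %| p) n.

(* l-adic valuation, for the prime ideal generated by the irreducible l *)
Definition vadic (l : {poly F}) (x : K) : \bar int :=
  if x == 0 then +oo%E
  else ((polymult l (repr x : {ratio {poly F}}).1)%:Z
        - (polymult l (repr x : {ratio {poly F}}).2)%:Z)%:E.

Definition frob (j : nat) (x : K) : K := x ^+ (q ^ j).

Lemma frob_add j : {morph frob j : x y / x + y}.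
Proof.
move=> x y; apply: exprDn_pchar.
have [p p_pr pF] := finPcharP F.
have pK : p \in [pchar K].
  by apply: (rmorph_pchar ratfun_of); apply: (rmorph_pchar polyC).
rewrite (card_pprimeChar pF) -expnM pnatX; apply/orP; left.
by rewrite pnatE.
Qed.

Lemma frob_mul j : {morph frob j : x y / x * y}.
Proof. by move=> x y; rewrite /frob exprMn. Qed.

Lemma frob1 j : frob j 1 = 1. Proof. exact: expr1n. Qed.

Lemma frob0 x : frob 0 x = x. Proof. by rewrite /frob expr1. Qed.

Lemma frob_comp i j x : frob i (frob j x) = frob (i + j) x.
Proof. by rewrite /frob -exprM -expnD addnC. Qed.

Lemma frob_const j (c : F) : frob j (ratfun_of c%:P) = ratfun_of c%:P.
Proof.
rewrite /frob -!rmorphXn /=; congr (ratfun_of _%:P).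
by elim: j => [|j IHj]; rewrite ?expr1 // expnSr exprM IHj expf_card.
Qed.

End RationalFunctions.

(* [Twisted u] stands for \sum_i u`_i tau^i in K{tau}; see [tau_twC] below *)
Record twisted (F : finFieldType) := Twisted { twpoly : {poly ratfun F} }.

HB.instance Definition _ (F : finFieldType) := [isNew for @twpoly F].
HB.instance Definition _ (F : finFieldType) := [Choice of twisted F by <:].

Section TwistedPolynomials.

Variable F : finFieldType.
Local Notation K := (ratfun F).
Implicit Types u v w : twisted F.

Definition tw_coef u (i : nat) : K := (twpoly u)`_i.

Lemma twP u v : tw_coef u =1 tw_coef v <-> u = v.
Proof. by split=> [|-> //]; case: u v => [u] [v] /polyP /= ->. Qed.

Definition tw_zero : twisted F := Twisted 0.
Definition tw_one : twisted F := Twisted 1.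
Definition tw_opp u : twisted F := Twisted (- twpoly u).
Definition tw_add u v : twisted F := Twisted (twpoly u + twpoly v).
Definition tw_mul u v : twisted F :=
  Twisted (\poly_(n < size (twpoly u) + size (twpoly v))
             conv (@frob F) (tw_coef u) (tw_coef v) n).
Definition tw_scale (c : F) u : twisted F :=
  Twisted (ratfun_of c%:P *: twpoly u).

Fact tw_addA : associative tw_add.
Proof. by move=> u v w; rewrite /tw_add addrA. Qed.
Fact tw_addC : commutative tw_add.
Proof. by move=> u v; rewrite /tw_add addrC. Qed.
Fact tw_add0 : left_id tw_zero tw_add.
Proof. by case=> u; rewrite /tw_add add0r. Qed.
Fact tw_addN : left_inverse tw_zero tw_opp tw_add.
Proof. by move=> u; rewrite /tw_add addNr. Qed.

HB.instance Definition _ :=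
  GRing.isZmodule.Build (twisted F) tw_addA tw_addC tw_add0 tw_addN.

Lemma tw_coefD u v i : tw_coef (u + v) i = tw_coef u i + tw_coef v i.
Proof. exact: coefD. Qed.

Lemma tw_coefM u v n :
  tw_coef (tw_mul u v) n = \sum_(j < n.+1) tw_coef u j * frob j (tw_coef v (n - j)).
Proof.
rewrite {1}/tw_coef coef_poly; case: ltnP => // le_n; symmetry.
apply: big1 => j _; have [lt_j|le_j] := ltnP j (size (twpoly u)); last first.
  by rewrite /tw_coef nth_default ?mul0r.
suff -> : tw_coef v (n - j) = 0 by rewrite /frob expr0n expn_eq0 -leqn0 leqNgt
  (ltnW (finNzRing_gt1 F)) mulr0.
rewrite /tw_coef nth_default // leq_subRL; first exact: leq_trans (leq_add (ltnW lt_j) (leqnn _)) le_n.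
by rewrite -ltnS.
Qed.

Lemma tw_coef1 n : tw_coef tw_one n = (n == 0%N)%:R.
Proof. exact: coef1. Qed.

Lemma tw_coefZ c u n : tw_coef (tw_scale c u) n = ratfun_of c%:P * tw_coef u n.
Proof. exact: coefZ. Qed.

Let convE u v : conv (@frob F) (tw_coef u) (tw_coef v) = tw_coef (tw_mul u v).
Proof. by apply/funext => n; rewrite tw_coefM. Qed.

Fact tw_mulA : associative tw_mul.
Proof.
move=> u v w; apply/twP => n; rewrite -!convE.
apply: convA; [exact: frob_add | exact: frob_mul | exact: frob_comp].
Qed.
Fact tw_mul1l : left_id tw_one tw_mul.
Proof.
move=> u; apply/twP => n; rewrite -convE (funext tw_coef1).
by apply: conv1l; exact: frob0.
Qed.
Fact tw_mul1r : right_id tw_one tw_mul.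
Proof.
move=> u; apply/twP => n; rewrite -convE (funext tw_coef1).
by apply: conv1r; [exact: frob_add | exact: frob1].
Qed.
Fact tw_mulDl : left_distributive tw_mul +%R.
Proof.
move=> u v w; apply/twP => n; rewrite tw_coefD -!convE (funext (tw_coefD u v)).
exact: convDl.
Qed.
Fact tw_mulDr : right_distributive tw_mul +%R.
Proof.
move=> u v w; apply/twP => n; rewrite tw_coefD -!convE (funext (tw_coefD v w)).
by apply: convDr; exact: frob_add.
Qed.
Lemma tw_coef0 n : tw_coef (0 : twisted F) n = 0.
Proof. exact: coef0. Qed.
Fact tw_one_neq0 : tw_one != 0.
Proof.
apply/eqP => /twP /(_ 0%N) h; apply/negP: (oner_neq0 K); rewrite negbK.
exact/eqP/(etrans (esym (tw_coef1 0)) (etrans h (tw_coef0 0))).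
Qed.

HB.instance Definition _ := GRing.Zmodule_isNzRing.Build (twisted F)
  tw_mulA tw_mul1l tw_mul1r tw_mulDl tw_mulDr tw_one_neq0.

Fact tw_scaleA c d u : tw_scale c (tw_scale d u) = tw_scale (c * d) u.
Proof. by rewrite /tw_scale /= scalerA -rmorphM /= -polyCM. Qed.
Fact tw_scale1 : left_id 1 tw_scale.
Proof. by case=> u; rewrite /tw_scale polyC1 rmorph1 scale1r. Qed.
Fact tw_scaleDr : right_distributive tw_scale +%R.
Proof. by move=> c u v; apply/twP => n; rewrite !(tw_coefZ, tw_coefD) mulrDr. Qed.
Fact tw_scaleDl u : {morph tw_scale^~ u : c d / c + d}.
Proof.
by move=> c d; apply/twP => n; rewrite !(tw_coefZ, tw_coefD) !rmorphD mulrDl.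
Qed.

HB.instance Definition _ := GRing.Zmodule_isLmodule.Build F (twisted F)
  tw_scaleA tw_scale1 tw_scaleDr tw_scaleDl.

Fact tw_scaleAl (c : F) u v : c *: (u * v) = (c *: u) * v.
Proof.
apply/twP => n; rewrite tw_coefZ !tw_coefM mulr_sumr.
by apply: eq_bigr => j _; rewrite tw_coefZ mulrA.
Qed.
HB.instance Definition _ :=
  GRing.Lmodule_isLalgebra.Build F (twisted F) tw_scaleAl.

Fact tw_scaleAr (c : F) u v : c *: (u * v) = u * (c *: v).
Proof.
apply/twP => n; rewrite tw_coefZ !tw_coefM mulr_sumr.
apply: eq_bigr => j _; rewrite tw_coefZ frob_mul frob_const.
by rewrite mulrA [_ * tw_coef u j]mulrC -mulrA.
Qed.
HB.instance Definition _ :=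
  GRing.Lalgebra_isAlgebra.Build F (twisted F) tw_scaleAr.

Definition tau : twisted F := Twisted 'X.
Definition twC (c : K) : twisted F := Twisted c%:P.

Lemma tw_coef_tau n : tw_coef tau n = (n == 1%N)%:R.
Proof. exact: coefX. Qed.

Lemma tw_coefC c n : tw_coef (twC c) n = if n == 0%N then c else 0.
Proof. exact: coefC. Qed.

Lemma frob0r j : frob j (0 : K) = 0.
Proof.
by rewrite /frob expr0n expn_eq0 -leqn0 leqNgt (ltnW (finNzRing_gt1 F)).
Qed.

Lemma tau_twC (c : K) : tau * twC c = twC (c ^+ #|F|) * tau.
Proof.
apply/twP => n; rewrite !tw_coefM [RHS]big_ord_recl tw_coefC tw_coef_tau subn0.
rewrite frob0 [X in _ = _ + X]big1 => [|j _]; last first.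
  by rewrite tw_coefC mul0r.
rewrite addr0; case: n => [|n].
  by rewrite big_ord1 tw_coef_tau mul0r mulr0.
rewrite big_ord_recl tw_coef_tau mul0r add0r big_ord_recl tw_coef_tau mul1r.
rewrite big1 ?addr0 => [|j _]; last by rewrite tw_coef_tau mul0r.
rewrite tw_coefC subSS subn0 eqSS; case: eqP => _.
  by rewrite mulr1 /frob expn1.
by rewrite mulr0 frob0r.
Qed.

End TwistedPolynomials.

(* Both F_q[t] and F_q[theta] are [{poly F}]: the former is the domain of a
   Drinfeld module, the latter the ring whose fraction field is K. *)

Record drinfeld_module (F : finFieldType) (r : nat) := DrinfeldModule {
  drinfeld :> {lrmorphism {poly F} -> twisted F};
  drinfeld_const : tw_coef (drinfeld 'X) 0 = theta F;
  drinfeld_rank_gt0 : (0 < r)%N;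
  drinfeld_rank : size (twpoly (drinfeld 'X)) = r.+1 }.

Section Carlitz.

Variable F : finFieldType.

Definition carlitz_map : {poly F} -> twisted F :=
  horner_alg (twC (theta F) + tau F).
HB.instance Definition _ := GRing.RMorphism.on carlitz_map.

Fact carlitz_scalable : scalable carlitz_map.
Proof.
move=> c f; rewrite -mul_polyC rmorphM /=.
by rewrite [carlitz_map c%:P]horner_algC mulr_algl.
Qed.
HB.instance Definition _ := GRing.isScalable.Build F {poly F} (twisted F) *:%R
  carlitz_map carlitz_scalable.

Lemma carlitz_mapX : carlitz_map 'X = twC (theta F) + tau F.
Proof. exact: horner_algX. Qed.

Fact carlitz_const : tw_coef (carlitz_map 'X) 0 = theta F.
Proof. by rewrite carlitz_mapX tw_coefD /tw_coef /= coefC coefX addr0. Qed.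

Fact carlitz_rank : size (twpoly (carlitz_map 'X)) = 2.
Proof. by rewrite carlitz_mapX /= addrC size_XaddC. Qed.

Definition carlitz : drinfeld_module F 1 :=
  @DrinfeldModule F 1 carlitz_map carlitz_const (ltn0Sn 0) carlitz_rank.

End Carlitz.

Definition separable_closure (K L : fieldType) (iota : {rmorphism K -> L}) :=
  (forall x : L, exists2 p : {poly K},
     separable_poly p & root (map_poly iota p) x) /\
  (forall p : {poly L}, separable_poly p -> (1 < size p)%N ->
     exists x, root p x).

Section Subfields.

Variable L : fieldType.
Implicit Types (A B E : set L) (s : L -> L).

Definition is_subfield E : Prop := GRing.divring_closed (mem E).

Definition adjoin E A : set L := smallest is_subfield (E `|` A).

(* [galois_group E B] is Gal(B/E). An automorphism of B is represented by any
   function on L extending it: its values outside B are irrelevant. *)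
Definition galois_group E B : set (L -> L) := [set s |
  [/\ set_bij B B s,
      {in B &, {morph s : x y / x + y}},
      {in B &, {morph s : x y / x * y}} &
      {in E, forall x, s x = x}]].

Definition lin_independent E n (x : 'I_n -> L) : Prop :=
  forall c : 'I_n -> L, (forall i, E (c i)) ->
    \sum_(i < n) c i * x i = 0 -> forall i, c i = 0.

Definition linearly_disjoint E A B : Prop :=
  [/\ E `<=` A, E `<=` B &
      forall n (x : 'I_n -> L), (forall i, A (x i)) ->
        lin_independent E x -> lin_independent B x].

End Subfields.

Section Torsion.

Variables (F : finFieldType) (L : fieldType) (iota : {rmorphism ratfun F -> L}).
Variables (r : nat) (phi : drinfeld_module F r).

Definition tw_eval (u : twisted F) (x : L) : L :=
  \sum_(i < size (twpoly u)) iota (tw_coef u i) * x ^+ (#|F| ^ i).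

Definition drin_act (f : {poly F}) (x : L) : L := tw_eval (phi f) x.

Definition torsion (f : {poly F}) : set L := [set x | drin_act f x = 0].

Definition torsion_field (f : {poly F}) : set L :=
  adjoin (range iota) (torsion f).

Definition torsion_tower : set L :=
  \bigcup_(k in [set k : nat | (1 <= k)%N]) torsion_field 'X^k.

(* on phi[t], c in F_q = F_q[t]/(t) acts as phi(c) *)
Definition torsion_comb (u : 'I_r -> L) (c : 'cV[F]_r) : L :=
  \sum_(i < r) drin_act (c i 0)%:P (u i).

Definition torsion_basis (u : 'I_r -> L) : Prop :=
  (forall i, torsion 'X (u i)) /\
  (forall x, torsion 'X x -> exists! c, x = torsion_comb u c).

(* M is the matrix of s on phi[t] in the basis u, i.e. the j-th column of M is
   the coordinate vector of s (u j); same convention for [tate_matrix] *)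
Definition torsion_matrix (u : 'I_r -> L) (s : L -> L) (M : 'M[F]_r) : Prop :=
  forall j, s (u j) = torsion_comb u (col j M).

Definition torsion_image (u : 'I_r -> L) (G : set (L -> L)) : set 'M[F]_r :=
  [set M | exists2 s, G s & torsion_matrix u s M].

(* The t-adic Tate module lim_k phi[t^k] (transition maps x |-> phi(t)(x)), as
   the set of compatible sequences; the term k = 0 is always 0. *)
Definition tate : set (nat -> L) := [set x |
  (forall k, torsion 'X^k (x k)) /\ (forall k, drin_act 'X (x k.+1) = x k)].

(* F_q[[t]] acts on phi[t^k] through F_q[[t]]/(t^k) = F_q[t]/(t^k) *)
Definition tate_scale (f : fps F) (x : nat -> L) : nat -> L :=
  fun k => drin_act (\poly_(i < k) fps_coef f i) (x k).

Definition tate_comb (e : 'I_r -> nat -> L) (c : 'cV[fps F]_r) : nat -> L :=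
  fun k => \sum_(i < r) tate_scale (c i 0) (e i) k.

Definition tate_basis (e : 'I_r -> nat -> L) : Prop :=
  (forall i, tate (e i)) /\
  (forall x, tate x -> exists! c, x = tate_comb e c).

Definition tate_matrix (e : 'I_r -> nat -> L) (s : L -> L) (M : 'M[fps F]_r)
    : Prop :=
  forall j, s \o e j = tate_comb e (col j M).

Definition tate_image (e : 'I_r -> nat -> L) (G : set (L -> L)) :
    set 'M[fps F]_r :=
  [set M | exists2 s, G s & tate_matrix e s M].

End Torsion.

Definition SL (R : comNzRingType) (n : nat) : set 'M[R]_n :=
  [set M | \det M = 1].
Arguments SL R n : clear implicits.

(* Main.v *)
Require Import Defs.
From HB Require Import structures.
From mathcomp Require Import all_fingroup all_solvable.
From mathcomp Require Import all_boot all_order all_algebra all_field.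
From mathcomp Require Import all_classical constructive_ereal.
From mathcomp Require Import zify ring.

Set Implicit Arguments.
Unset Strict Implicit.
Unset Printing Implicit Defensive.

Import Order.TTheory GRing.Theory Num.Theory.

Local Open Scope ring_scope.
Local Open Scope classical_set_scope.

(** Let [L] be a separable closure of [K = F_q(theta)], and write [f'] for the
    series [f] in [L[[t]]] with all coefficients raised to the power [q].

    A compatible sequence [x_1, x_2, ...] of t-power torsion points of
    [theta + c tau - tau^2] is encoded by [w = x_1 + x_2 t + x_3 t^2 + ...];
    compatibility then reads [theta w + c w' - w'' = t w] ([tate_eq]), and
    [F_q[[t]]] acts by multiplication of series.  The Wronskian
    [w1 w2' - w1' w2] of two solutions solves [theta W + W' = t W], the equation
    of the Carlitz module ([wronskian_carlitz]).  When its constant term is not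
    zero, Cramer's rule shows that [w1, w2] is a basis of the Tate module
    ([rank2_coordinates]).  Hence [K_C] lies in [K_1] and [K_2], and an
    automorphism acts on the Wronskian through the determinant of its matrix
    ([acts_by_det]): automorphisms over [K_C] have determinant 1.

    The prime [l] gives the converse.  Let [k] be an algebraic closure of [F_q],
    [alpha] a root of [l] in [k], and [m = - v_l(b)].  Embed [K] in [k((s))] by
    [theta = alpha + s^(q-1)].  As [phi_1] has good reduction at [l] and [alpha]
    is not 0, all solutions for [phi_1] have coefficients in [k[[s]]]
    ([local_integral_basis]).  Conjugating [phi_2] by [s^m] makes it integral, with a
    reduction of rank 1, so it has a solution [w] with coefficients in [k((s))],
    equal to [s^m] times an invertible series over [k[[s]]]
    ([local_degenerate_solution]).  Let [E] be a maximal subfield of [L] that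
    embeds in [k((s))] over [K].  The group of automorphisms of [L] over [E]
    does the work of an inertia group: it fixes all solutions for [phi_1] and
    the solution [w] ([inertia_field]).

    Order reduction completes [w] to a basis [w, w xi] with
    [xi' - xi = W / (w w')], so that the coefficients of [xi] are Artin-Schreier
    roots over [E].  A combination with coefficients in [F_q], not all zero, of
    the right-hand sides has a pole of order exactly [m (q + 1)], because the
    leading coefficients satisfy a difference equation of their own
    ([reduced_coef_free]); this order is prime to [p], so the combination is not
    of the form [eta^p - eta] ([no_artin_schreier_root]).  By trace duality
    ([trace_dual]) the automorphisms over [E] therefore realize every upper
    unipotent matrix modulo [t^k] ([many_unipotents]).  As the Galois group of
    [K(phi_2[t])] contains [SL_2(F_q)], some automorphism of [L] over [K] moves the
    line spanned by [w] modulo [t] ([moving_automorphism]); conjugating by it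
    gives the opposite unipotent matrices, and the two families generate
    [SL_2(F_q[[t]])] ([SL2_generated]).  Hence the automorphisms of [L] that fix
    [K_1] map onto a dense subset of [SL_2(F_q[[t]])] ([SL2_dense]).

    Density is enough.  Automorphisms of the fields [K(phi_2[t^k])] with
    congruent matrices glue to one of [K_2] ([glue_automorphisms]), which gives
    the image.  On a given element of [K_2], every automorphism over [K_C] agrees
    with one that fixes [K_1]; so elements of [K_2] invariant under the latter
    lie in [K_C] ([invariant_in_KC]), and the usual argument with a shortest
    linear relation shows that [K_1] and [K_2] are linearly disjoint. *)

(** * Partial isomorphisms between two fields *)

Section SubfieldType.
Variables (L : fieldType) (S : set L) (hS : is_subfield S).

Definition subfield_pred : {pred L} := fun x => x \in S.
HB.instance Definition _ := GRing.isDivringClosed.Build L subfield_pred hS.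

(** The carrier of a subfield given as a set, as a field in its own right: the
    constructions of polynomials and embeddings below need a type of coefficients. *)
Record subfield_type := SubfieldType
  { subfield_val : L; _ : subfield_val \in subfield_pred }.

HB.instance Definition _ := [isSub for subfield_val].
HB.instance Definition _ := [Choice of subfield_type by <:].
HB.instance Definition _ := [SubChoice_isSubIntegralDomain of subfield_type by <:].
HB.instance Definition _ := [SubIntegralDomain_isSubField of subfield_type by <:].

Lemma subfield_as_type :
  exists (E : fieldType) (j : {rmorphism E -> L}), range j = S.
Proof.
exists subfield_type, (val : {rmorphism subfield_type -> L}).
apply/seteqP; split=> [_ [x _ <-]|x xS].
  by have := valP x; rewrite unfold_in in_setE.
have xP : x \in subfield_pred by rewrite unfold_in inE.
by exists (SubfieldType xP).
Qed.

End SubfieldType.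

Lemma rmorphism_of_morphs (R S : nzRingType) (f : R -> S) :
  {morph f : x y / x - y} -> {morph f : x y / x * y} -> f 1 = 1 ->
  exists g : {rmorphism R -> S}, g =1 f.
Proof.
move=> fB fM f1.
pose Z := GRing.isZmodMorphism.Build R S f fB.
pose M := GRing.isMonoidMorphism.Build R S f (f1, fM).
pose g : {rmorphism R -> S} := HB.pack f Z M.
by exists g.
Qed.

Lemma root_irreducible (E L : fieldType) (j : {rmorphism E -> L})
    (mu f : {poly E}) z :
  irreducible_poly mu -> root (map_poly j mu) z ->
  root (map_poly j f) z = (mu %| f).
Proof.
move=> mu_irr muz; apply/idP/idP => [fz|/dvdpP [h ->]]; last first.
  by rewrite rmorphM rootM muz orbT.
apply/negPn/negP => nmu.
have : coprimep mu f by rewrite irreducible_poly_coprime.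
rewrite -(coprimep_map j) => /coprimep_root /(_ muz).
by rewrite (eqP fz) eqxx.
Qed.

Section FieldGraph.
Variables (L M : fieldType).
Implicit Types (G : set (L * M)).

(** An isomorphism between a subfield of [L] and a subfield of [M] is encoded by
    its graph, a subset of [L * M].  Both fields then play symmetric roles, and
    partial isomorphisms are ordered by inclusion. *)
Definition field_graph G : Prop :=
  [/\ G (1, 1),
      forall p q, G p -> G q -> G (p.1 - q.1, p.2 - q.2),
      forall p q, G p -> G q -> G (p.1 / q.1, p.2 / q.2) &
      forall p, G p -> p.1 = 0 <-> p.2 = 0].

Lemma field_graph_range (E : fieldType) (j : {rmorphism E -> L})
    (eps : {rmorphism E -> M}) :
  field_graph (range (fun e => (j e, eps e))).
Proof.
split.
- by exists 1; rewrite ?rmorph1.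
- by move=> _ _ [x _ <-] [y _ <-] /=; exists (x - y); rewrite ?rmorphB.
- by move=> _ _ [x _ <-] [y _ <-] /=; exists (x / y); rewrite ?fmorph_div.
- by move=> _ [x _ <-] /=; split=> /eqP; rewrite fmorph_eq0 => /eqP ->;
    rewrite rmorph0.
Qed.

Lemma field_graph_field G : field_graph G ->
  exists (E : fieldType) (j : {rmorphism E -> L}) (eps : {rmorphism E -> M}),
    G = range (fun e => (j e, eps e)).
Proof.
move=> [G1 GB Gdiv G0].
have Ginj x y y' : G (x, y) -> G (x, y') -> y = y'.
  move=> Gy Gy'; have := GB _ _ Gy Gy' => /= /G0 /= [+ _].
  by rewrite subrr => /(_ erefl) /eqP; rewrite subr_eq0 => /eqP.
have S_sub : is_subfield [set p.1 | p in G].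
  split=> [|x y|x y]; rewrite !inE.
  - by exists (1, 1).
  - by move=> [p Gp <-] [q Gq <-]; exists (p.1 - q.1, p.2 - q.2) => //; apply: GB.
  - by move=> [p Gp <-] [q Gq <-]; exists (p.1 / q.1, p.2 / q.2) => //; apply: Gdiv.
have [E [j jS]] := subfield_as_type S_sub.
have /choice [f fP] (e : E) : exists y, G (j e, y).
  have : range j (j e) by exists e.
  by rewrite jS => -[[x y] Gp /= <-]; exists y.
have f1 : f 1 = 1 by apply: (Ginj 1); rewrite // -(rmorph1 j).
have fB : {morph f : x y / x - y}.
  move=> x y; apply: (Ginj (j (x - y))); first exact: fP.
  by rewrite rmorphB; apply: (GB _ _ (fP x) (fP y)).
have fdiv x y : f (x / y) = f x / f y.
  apply: (Ginj (j (x / y))); first exact: fP.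
  by rewrite fmorph_div; apply: (Gdiv _ _ (fP x) (fP y)).
have fM : {morph f : x y / x * y}.
  move=> x y; have fV z : f (z^-1) = (f z)^-1 by rewrite -div1r fdiv f1 div1r.
  by rewrite -[y in LHS]invrK fdiv fV invrK.
have [eps epsE] := rmorphism_of_morphs fB fM f1.
exists E, j, eps; apply/seteqP; split=> [[x y] Gxy|_ [e _ <-]]; last first.
  by rewrite epsE; apply: fP.
have : range j x by rewrite jS; exists (x, y).
move=> [e _ ex]; exists e => //; rewrite epsE ex.
by congr (_, _); apply: (Ginj x) => //; rewrite -ex.
Qed.

(** A common irreducible polynomial has the same remainders on both sides, so
    [z |-> y] extends the isomorphism to the fields generated by [z] and [y]. *)
Lemma field_graph_adjoin (E : fieldType) (j : {rmorphism E -> L})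
    (eps : {rmorphism E -> M}) (mu : {poly E}) z y :
  irreducible_poly mu -> root (map_poly j mu) z -> root (map_poly eps mu) y ->
  field_graph (range (fun f : {poly E} =>
                 ((map_poly j f).[z], (map_poly eps f).[y]))).
Proof.
move=> mu_irr muz muy; split.
- by exists 1; rewrite // !rmorph1 !hornerC.
- move=> _ _ [f _ <-] [g _ <-] /=; exists (f - g) => //.
  by rewrite !rmorphB !hornerE.
- move=> _ _ [f _ <-] [g _ <-] /=.
  have [mug|nmug] := boolP (mu %| g).
    exists 0 => //; rewrite !rmorph0 !horner0.
    have := mug; rewrite -(root_irreducible g mu_irr muz) => /rootP ->.
    have := mug; rewrite -(root_irreducible g mu_irr muy) => /rootP ->.
    by rewrite !invr0 !mulr0.
  have : coprimep mu g by rewrite irreducible_poly_coprime.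
  move=> /Bezout_eq1_coprimepP [[u v] /= uv].
  exists (f * v) => //; congr (_, _).
    rewrite rmorphM hornerM; congr (_ * _); apply: (mulIf (x := (map_poly j g).[z])).
      by move: nmug; rewrite -(root_irreducible g mu_irr muz).
    rewrite mulVf; last by move: nmug; rewrite -(root_irreducible g mu_irr muz).
    rewrite -hornerM -rmorphM (_ : v * g = 1 - u * mu); last by rewrite -uv addrC addKr.
    by rewrite rmorphB rmorph1 rmorphM !hornerE (eqP muz) mulr0 subr0.
  rewrite rmorphM hornerM; congr (_ * _); apply: (mulIf (x := (map_poly eps g).[y])).
    by move: nmug; rewrite -(root_irreducible g mu_irr muy).
  rewrite mulVf; last by move: nmug; rewrite -(root_irreducible g mu_irr muy).
  rewrite -hornerM -rmorphM (_ : v * g = 1 - u * mu); last by rewrite -uv addrC addKr.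
  by rewrite rmorphB rmorph1 rmorphM !hornerE (eqP muy) mulr0 subr0.
- move=> _ [f _ <-] /=; have := root_irreducible f mu_irr muz.
  have := root_irreducible f mu_irr muy; rewrite /root => <- e.
  by split=> /eqP; [rewrite e|rewrite -e] => /eqP.
Qed.

Lemma field_graph_max G0 : field_graph G0 ->
  exists G, [/\ field_graph G, G0 `<=` G &
     forall G', field_graph G' -> G `<=` G' -> G' `<=` G].
Proof.
move=> fG0; pose P := [set G | field_graph (G0 `|` G)].
have [F FP Ftot|A [PA maxA]] := @Zorn_bigcup _ P.
  have [F0|/set0P[X0 FX0]] := eqVneq F set0.
    by rewrite F0 bigcup_set0 /P /= setU0.
  rewrite /P /=; have FU p : (G0 `|` \bigcup_(X in F) X) p ->
      exists2 X, F X & (G0 `|` X) p.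
    by move=> [G0p|[X FX Xp]]; [exists X0|exists X] => //; [left|right].
  have FU2 p q : (G0 `|` \bigcup_(X in F) X) p -> (G0 `|` \bigcup_(X in F) X) q ->
      exists X, [/\ F X, (G0 `|` X) p & (G0 `|` X) q].
    move=> /FU [X FX Xp] /FU [Y FY Yq]; have [XY|YX] := Ftot X Y FX FY.
      by exists Y; split=> //; case: Xp => [|/XY]; [left|right].
    by exists X; split=> //; case: Yq => [|/YX]; [left|right].
  have sub X : F X -> (G0 `|` X) `<=` (G0 `|` \bigcup_(X in F) X).
    by move=> FX p [|]; [left|right; exists X].
  split.
  - by left; case: fG0.
  - move=> p q Gp Gq; have [X [FX Xp Xq]] := FU2 p q Gp Gq.
    by apply: (sub X FX); have [_ h _ _] := FP _ FX; exact: h.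
  - move=> p q Gp Gq; have [X [FX Xp Xq]] := FU2 p q Gp Gq.
    by apply: (sub X FX); have [_ _ h _] := FP _ FX; exact: h.
  - by move=> p /FU [X FX Xp]; have [_ _ _ h] := FP _ FX; exact: h.
exists (G0 `|` A); split=> //.
move=> G' fG' AG' p G'p; right; apply: contrapT => nAp.
apply: (maxA G'); last first.
  by rewrite /P /= (_ : _ `|` _ = G') //; apply/setUidPr => x G0x; apply: AG'; left.
by split=> [|/(_ _ G'p)] // x Ax; apply: AG'; right.
Qed.

(** Zorn's lemma yields a maximal isomorphism.  Maximality is used only in this
    form: roots of the same irreducible polynomial already correspond. *)
Lemma maximal_common_field G0 : field_graph G0 ->
  exists (E : fieldType) (j : {rmorphism E -> L}) (eps : {rmorphism E -> M}),
    (forall p, G0 p -> exists2 e, j e = p.1 & eps e = p.2) /\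
    (forall (mu : {poly E}) z y, irreducible_poly mu ->
        root (map_poly j mu) z -> root (map_poly eps mu) y ->
        exists2 e, j e = z & eps e = y).
Proof.
move=> fG0; have [G [fG G0G maxG]] := field_graph_max fG0.
have [E [j [eps GE]]] := field_graph_field fG.
exists E, j, eps; split=> [p /G0G|mu z y mu_irr muz muy].
  by rewrite GE => -[e _ <-]; exists e.
have fG' := field_graph_adjoin mu_irr muz muy.
have : G (z, y).
  apply: (maxG _ fG'); last by exists 'X; rewrite // !map_polyX !hornerX.
  rewrite GE => _ [e _ <-]; exists e%:P => //.
  by rewrite !map_polyC !hornerC.
by rewrite GE => -[e _ [ej ee]]; exists e.
Qed.

End FieldGraph.

Lemma rmorphism_factor (K E L : fieldType) (j : {rmorphism E -> L})
    (f : {rmorphism K -> L}) :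
  (forall x, exists e, j e = f x) -> exists i : {rmorphism K -> E}, j \o i =1 f.
Proof.
move=> /choice [g gP].
have [|||i iE] := @rmorphism_of_morphs _ _ g.
- by move=> x y; apply: (fmorph_inj j); rewrite rmorphB !gP rmorphB.
- by move=> x y; apply: (fmorph_inj j); rewrite rmorphM !gP rmorphM.
- by apply: (fmorph_inj j); rewrite gP !rmorph1.
by exists i => x /=; rewrite iE.
Qed.

(** * Galois theory inside a separable closure *)

Lemma min_poly_exists (E L : fieldType) (j : {rmorphism E -> L}) (p : {poly E}) z :
  p != 0 -> root (map_poly j p) z ->
  exists mu : {poly E}, [/\ irreducible_poly mu, mu %| p & root (map_poly j mu) z].
Proof.
move=> p0 pz; pose P n :=
  `[< exists f : {poly E}, [/\ f != 0, size f = n & root (map_poly j f) z] >].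
have exP : exists n, P n by exists (size p); apply/asboolP; exists p.
case: (ex_minnP exP) => n /asboolP [f [f0 szf fz]] min_n.
have minf g : g != 0 -> root (map_poly j g) z -> (size f <= size g)%N.
  by move=> g0 gz; rewrite szf; apply: min_n; apply/asboolP; exists g.
have f_irr : irreducible_poly f.
  split=> [|g sg /dvdpP [h fE]].
    have := root_size_gt1 _ fz; rewrite map_poly_eq0 size_map_poly; exact.
  have [g0 h0] : g != 0 /\ h != 0.
    by apply/andP; move: f0; rewrite fE mulf_eq0 negb_or andbC.
  have szE : size f = (size h + size g).-1 by rewrite fE size_mul.
  have := g0; have := h0; rewrite -!size_poly_gt0 => h0' g0'.
  have := fz; rewrite fE rmorphM rootM => /orP [/(minf _ h0)|/(minf _ g0)] le_f.
    by move: sg szE h0' g0' le_f; move: (size f) (size g) (size h); lia.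
  have gf : g %| f by rewrite fE dvdp_mull.
  rewrite -fE -(dvdp_size_eqp gf).
  by move: szE h0' g0' le_f; move: (size f) (size g) (size h); lia.
by exists f; split=> //; rewrite -(root_irreducible _ f_irr fz).
Qed.

Section SeparableClosure.
Variables (K L : fieldType) (iota : {rmorphism K -> L}).
Hypothesis hL : separable_closure iota.

Lemma separable_min_poly (E : fieldType) (j : {rmorphism E -> L})
    (i : {rmorphism K -> E}) : j \o i =1 iota -> forall z,
  exists2 mu : {poly E}, irreducible_poly mu /\ separable_poly mu
    & root (map_poly j mu) z.
Proof.
move=> ji z; have [p p_sep pz] := hL.1 z.
have pE : map_poly iota p = map_poly j (map_poly i p).
  by rewrite -map_poly_comp; apply: eq_map_poly => x; rewrite -ji.
have p0 : map_poly i p != 0 by rewrite map_poly_eq0 separable_poly_neq0.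
have [|mu [mu_irr mup muz]] := min_poly_exists (j := j) p0 (z := z); first by rewrite -pE.
exists mu => //; split=> //; apply: dvdp_separable mup _.
by rewrite separable_map.
Qed.

Lemma separable_has_root (E : fieldType) (j : {rmorphism E -> L}) (f : {poly E}) :
  separable_poly f -> (1 < size f)%N -> exists y, root (map_poly j f) y.
Proof. by move=> f_sep szf; apply: hL.2; rewrite ?separable_map ?size_map_poly. Qed.

(** In a maximal partial isomorphism of [L] with itself every element of [L] is in
    the domain, because its minimal polynomial, being separable, has a root to send
    it to. *)
Lemma field_graph_aut (G : set (L * L)) : field_graph G ->
  (forall x, exists y, G (iota x, y)) ->
  exists s : {rmorphism L -> L}, forall p, G p -> s p.1 = p.2.
Proof.
move=> fG GK; have [E [j [eps [GE maxE]]]] := maximal_common_field fG.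
have [x|i ji] := rmorphism_factor (j := j) (f := iota).
  by have [y /GE [e ej _]] := GK x; exists e.
have /(rmorphism_factor (f := idfun)) [i' ji'] : forall z, exists e, j e = z.
  move=> z; have [mu [mu_irr mu_sep] muz] := separable_min_poly ji z.
  have [y muy] := separable_has_root eps mu_sep (mu_irr.1).
  by have [e] := maxE _ _ _ mu_irr muz muy; exists e.
exists (eps \o i') => p /GE [e <- <-] /=; congr (eps _).
by apply: (fmorph_inj j); apply: ji'.
Qed.

Lemma extend_aut (E : fieldType) (j eps : {rmorphism E -> L})
    (i : {rmorphism K -> E}) : j \o i =1 iota ->
  exists s : {rmorphism L -> L}, s \o j =1 eps.
Proof.
move=> ji; have [x|s sP] := field_graph_aut (field_graph_range j eps).
  by exists (eps (i x)), (i x); rewrite // -ji.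
by exists s => x /=; apply: (sP (j x, eps x)); exists x.
Qed.

(** The identity, viewed as a map defined on the image of [s], extends to [L]. *)
Lemma aut_inv (s : {rmorphism L -> L}) : s \o iota =1 iota ->
  exists s' : {rmorphism L -> L}, cancel s s' /\ cancel s' s.
Proof.
move=> si; have [s' s's] := extend_aut (j := s) idfun si.
exists s'; split=> // x; apply: (fmorph_inj s').
exact: (s's (s' x)).
Qed.

(** If [c] is not in [E], its minimal polynomial over [E] has a second root, and an
    automorphism over [E] takes [c] to it. *)
Lemma fixed_by_auts (E : fieldType) (j : {rmorphism E -> L})
    (i : {rmorphism K -> E}) (c : L) : j \o i =1 iota ->
  (forall s : {rmorphism L -> L}, s \o j =1 j -> s c = c) ->
  exists e, j e = c.
Proof.
move=> ji fixc; have [mu [mu_irr mu_sep] muc] := separable_min_poly ji c.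
have [sz2|sz2] := eqVneq (size mu) 2.
  have mu1 : mu`_1 != 0.
    by have := lead_coef_eq0 mu; rewrite /lead_coef sz2 /= => ->;
      rewrite -size_poly_eq0 sz2.
  exists (- mu`_0 / mu`_1); apply/eqP.
  have jm : j mu`_1 != 0 by rewrite fmorph_eq0.
  have := muc; rewrite /root horner_coef size_map_poly sz2 big_ord_recl big_ord1 /=.
  rewrite !coef_map /= expr0 mulr1 expr1 fmorph_div rmorphN => e.
  by rewrite -subr_eq0 -(inj_eq (mulfI jm)) mulr0 mulrBr mulrC divfK // -opprD oppr_eq0.
have [q muE] := factor_theorem _ _ muc.
have := mu_sep; rewrite -(separable_map j) muE separable_root => /andP [q_sep nqc].
have szmu := mu_irr.1.
have mu0 : map_poly j mu != 0 by rewrite map_poly_eq0 -size_poly_gt0 ltnW.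
have q0 : q != 0 by apply: contraNneq mu0 => q0; rewrite muE q0 mul0r.
have szq : (1 < size q)%N.
  have : size (map_poly j mu) = (size q).+1.
    by rewrite muE size_Mmonic ?monicXsubC // size_XsubC addn2.
  rewrite size_map_poly => e; move: sz2 szmu; rewrite e.
  by case: (size q) => [|[|n]].
have [c' qc'] := hL.2 _ q_sep szq.
have muc' : root (map_poly j mu) c' by rewrite muE rootM qc'.
have [x|s sP] := field_graph_aut (field_graph_adjoin mu_irr muc muc').
  exists (iota x), (i x)%:P => //; rewrite !map_polyC !hornerC /=.
  by have /= -> := ji x.
have sj : s \o j =1 j.
  move=> x /=; apply: (sP (j x, j x)); exists x%:P => //.
  by rewrite !map_polyC !hornerC.
have : s c = c'.
  by apply: (sP (c, c')); exists 'X; rewrite // !map_polyX !hornerX.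
by rewrite fixc // => cc'; move: nqc; rewrite cc' qc'.
Qed.

End SeparableClosure.

(** * Rings of formal power series *)

Notation "f $_ n" := (fps_coef f n) 
  (at level 3, n at level 2, left associativity, format "f $_ n").

(** Sequences defined by course-of-values recursion through a relation: the n-th
    condition may depend on the earlier terms only. *)
Lemma strong_choice (T : Type) (x0 : T) (P : nat -> (nat -> T) -> T -> Prop) :
  (forall n g h x, (forall i, (i < n)%N -> g i = h i) -> P n g x -> P n h x) ->
  (forall n g, exists x, P n g x) -> exists g, forall n, P n g (g n).
Proof.
move=> Pext Pex; have /choice [s sP] (ng : nat * (nat -> T)) : exists x, P ng.1 ng.2 x.
  exact: Pex.
pose fix tab n := if n is m.+1 then
  rcons (tab m) (s (m, nth x0 (tab m))) else [::].
have size_tab n : size (tab n) = n by elim: n => //= n IHn; rewrite size_rcons IHn.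
have nth_tab n m i : (i < n)%N -> (n <= m)%N -> nth x0 (tab m) i = nth x0 (tab n) i.
  move=> lt_in; elim: m => [|m IHm]; first by rewrite leqn0 => /eqP ->.
  rewrite leq_eqVlt => /orP [/eqP -> //|]; rewrite ltnS => le_nm.
  by rewrite /= nth_rcons size_tab (leq_trans lt_in le_nm) IHm.
exists (fun n => nth x0 (tab n.+1) n) => n.
apply: (Pext n (nth x0 (tab n))) => [i lt_in|].
  by rewrite (@nth_tab i.+1).
by rewrite /= nth_rcons size_tab ltnn eqxx; apply: (sP (n, _)).
Qed.

Section FpsCoef.
Variable R : comNzRingType.
Implicit Types f g : fps R.

Lemma fps_coefD f g n : (f + g)$_n = f$_n + g$_n. Proof. by []. Qed.
Lemma fps_coefN f n : (- f)$_n = - f$_n. Proof. by []. Qed.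
Lemma fps_coefB f g n : (f - g)$_n = f$_n - g$_n. Proof. by []. Qed.
Lemma fps_coef0 n : (0 : fps R)$_n = 0. Proof. by []. Qed.
Lemma fps_coef1 n : (1 : fps R)$_n = (n == 0%N)%:R. Proof. by []. Qed.
Lemma fps_coefM f g n : (f * g)$_n = \sum_(j < n.+1) f$_j * g$_(n - j).
Proof. by []. Qed.
Lemma fps_coef0M f g : (f * g)$_0 = f$_0 * g$_0.
Proof. by rewrite fps_coefM big_ord1. Qed.
Lemma fps_coef0X f n : (f ^+ n)$_0 = f$_0 ^+ n.
Proof. by elim: n => [|n IHn]; rewrite ?fps_coef1 // !exprS fps_coef0M IHn. Qed.
Lemma fps_coef_sum I (r : seq I) (P : pred I) (E : I -> fps R) n :
  (\sum_(i <- r | P i) E i)$_n = \sum_(i <- r | P i) (E i)$_n.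
Proof. exact: (big_morph (fun f => f$_n) (fun _ _ => erefl) erefl). Qed.

Definition fpsC (c : R) : fps R := Fps (fun n => if n == 0%N then c else 0).
Definition fpsX : fps R := Fps (fun n => (n == 1%N)%:R).

Lemma fps_coefCM c f n : (fpsC c * f)$_n = c * f$_n.
Proof.
by rewrite fps_coefM big_ord_recl /= subn0 big1 ?addr0 // => i _; rewrite mul0r.
Qed.

Lemma fps_coefXM f n : (fpsX * f)$_n = if n is m.+1 then f$_m else 0.
Proof.
rewrite fps_coefM big_ord_recl /= mul0r add0r; case: n => [|n]; first by rewrite big_ord0.
rewrite big_ord_recl /= mul1r subSS subn0 big1 ?addr0 // => i _.
by rewrite /= mul0r.
Qed.

Fact fpsC_zmod : zmod_morphism fpsC.
Proof. by move=> x y; apply/fpsP => -[|n] /=; rewrite ?subrr. Qed.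
Fact fpsC_monoid : monoid_morphism fpsC.
Proof.
split=> [|x y]; apply/fpsP => n; first by case: n.
by rewrite fps_coefCM /=; case: eqP => // _; rewrite mulr0.
Qed.
HB.instance Definition _ := GRing.isZmodMorphism.Build R (fps R) fpsC fpsC_zmod.
HB.instance Definition _ := GRing.isMonoidMorphism.Build R (fps R) fpsC fpsC_monoid.

Definition fps_low0 n f := forall i, (i < n)%N -> f$_i = 0.

Lemma fps_low0M n f g : fps_low0 n f -> g$_0 = 0 -> fps_low0 n.+1 (f * g).
Proof.
move=> f0 g0 i lt_in; rewrite fps_coefM big1 // => j _.
have [lt_jn|le_nj] := ltnP j n; first by rewrite f0 ?mul0r.
by rewrite (_ : (i - j)%N = 0%N) ?g0 ?mulr0 //; lia.
Qed.

Lemma fps_low0_Mr n f g : fps_low0 n f -> fps_low0 n (f * g).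
Proof.
move=> f0 i lt_in; rewrite fps_coefM big1 // => j _.
by rewrite f0 ?mul0r // (leq_ltn_trans _ lt_in) // -ltnS.
Qed.

(** Raising to a power [m > 1] improves the order of vanishing: this is what makes
    the successive coefficients of a root of an additive polynomial computable. *)
Lemma fps_low0X n f m : (0 < n)%N -> (1 < m)%N -> fps_low0 n f -> fps_low0 n.+1 (f ^+ m).
Proof.
move=> n_gt0; case: m => [|[|m]] // _ f0; rewrite exprS; apply: fps_low0M => //.
by rewrite fps_coef0X f0 // expr0n.
Qed.

End FpsCoef.

Section MapFps.
Variables (R S : comNzRingType) (f : {rmorphism R -> S}).

Definition map_fps (g : fps R) : fps S := Fps (fun n => f g$_n).

Fact map_fps_zmod : zmod_morphism map_fps.
Proof. by move=> g h; apply/fpsP => n /=; rewrite rmorphB. Qed.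
Fact map_fps_monoid : monoid_morphism map_fps.
Proof.
split=> [|g h]; apply/fpsP => n /=; first by rewrite rmorph_nat.
by rewrite rmorph_sum; apply: eq_bigr => i _; rewrite rmorphM.
Qed.
HB.instance Definition _ := GRing.isZmodMorphism.Build (fps R) (fps S) map_fps map_fps_zmod.
HB.instance Definition _ := GRing.isMonoidMorphism.Build (fps R) (fps S) map_fps map_fps_monoid.

Lemma map_fpsC c : map_fps (fpsC c) = fpsC (f c).
Proof. by apply/fpsP => n /=; case: eqP => // _; rewrite rmorph0. Qed.
Lemma map_fpsX : map_fps (fpsX R) = fpsX S.
Proof. by apply/fpsP => n /=; rewrite rmorph_nat. Qed.

End MapFps.

Section FpsUnit.
Variable R : comUnitRingType.
Implicit Types f g : fps R.

Lemma fps_inverse_exists f : f$_0 \is a GRing.unit -> exists g, g * f = 1.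
Proof.
move=> f0; pose P n (g : nat -> R) x :=
  \sum_(i < n) g i * f$_(n - i) + x * f$_0 = (n == 0%N)%:R.
have [|n g|g gP] := @strong_choice R 0 P.
- move=> n g h x gh; rewrite /P => <-; congr (_ + _).
  by apply: eq_bigr => i _; rewrite gh.
- exists (((n == 0%N)%:R - \sum_(i < n) g i * f$_(n - i)) / f$_0).
  by rewrite /P divrK // addrC subrK.
exists (Fps g); apply/fpsP => n.
by rewrite fps_coefM big_ord_recr /= subnn gP.
Qed.

(** When [f$_0] is a unit, recursion on the coefficients produces an inverse, which
    [fps_inv] picks by choice. *)
Definition fps_unit : pred (fps R) := fun f => f$_0 \is a GRing.unit.
Definition fps_inv f : fps R := xget f [set g | g * f = 1].

Fact fps_unitPl f g : g * f = 1 -> fps_unit f.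
Proof.
move=> /(congr1 (fun h => h$_0)); rewrite fps_coef0M fps_coef1 => gf.
by apply/unitrPr; exists (g$_0); rewrite mulrC.
Qed.
Fact fps_mulVf : {in fps_unit, left_inverse 1 fps_inv *%R}.
Proof.
by move=> f /fps_inverse_exists [g gf]; apply: (@xgetPex _ f [set g | g * f = 1]); exists g.
Qed.
Fact fps_inv_out : {in [predC fps_unit], fps_inv =1 id}.
Proof.
move=> f nf; apply: xgetPN => g /= /fps_unitPl fU.
by move: nf; rewrite inE /= /in_mem /= fU.
Qed.

HB.instance Definition _ := GRing.ComNzRing_hasMulInverse.Build (fps R)
  fps_mulVf fps_unitPl fps_inv_out.

Lemma fps_unitE f : (f \is a GRing.unit) = (f$_0 \is a GRing.unit).
Proof. by []. Qed.

End FpsUnit.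

Section FpsDomain.
Variable R : idomainType.
Implicit Types f g : fps R.

Lemma fps_order f : f != 0 -> exists n, f$_n != 0 /\ fps_low0 n f.
Proof.
move=> f0; have exn : exists n, f$_n != 0.
  apply: contrapT => nex; case/negP: f0; apply/eqP/fpsP => n.
  by apply/eqP; apply: contra_notT nex => fn; exists n.
case: (ex_minnP exn) => n fn min_n; exists n; split=> // i lt_in.
by apply/eqP; apply: contraTT lt_in => /min_n; rewrite -leqNgt.
Qed.

Lemma fps_coefM_order f g m n : fps_low0 m f -> fps_low0 n g ->
  fps_low0 (m + n) (f * g) /\ (f * g)$_(m + n) = f$_m * g$_n.
Proof.
move=> f0 g0; split=> [i lt_i|].
  rewrite fps_coefM big1 // => j _; have [lt_jm|le_mj] := ltnP j m.
    by rewrite f0 ?mul0r.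
  by rewrite g0 ?mulr0 //; have := ltn_ord j; lia.
have lt_m : (m < (m + n).+1)%N by rewrite ltnS leq_addr.
rewrite fps_coefM (bigD1 (Ordinal lt_m)) //= addKn big1 ?addr0 // => j jm.
have [lt_jm|le_mj] := ltnP j m; first by rewrite f0 ?mul0r.
rewrite g0 ?mulr0 //; have : (j != m :> nat) by apply: contraNneq jm => e; apply/eqP/val_inj.
by have := ltn_ord j; lia.
Qed.

Fact fps_integral : GRing.integral_domain_axiom (fps R).
Proof.
move=> f g fg; apply/negPn; rewrite negb_or; apply/negP => /andP [/fps_order [m [fm fl]]].
move=> /fps_order [n [gn gl]].
have [_ /eqP] := fps_coefM_order fl gl.
by rewrite fg fps_coef0 eq_sym mulf_eq0 (negPf fm) (negPf gn).
Qed.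

HB.instance Definition _ := GRing.ComUnitRing_isIntegral.Build (fps R) fps_integral.

End FpsDomain.

(** * The Frobenius difference equation of a Tate module *)

Section TateEquation.
Variables (A : comUnitRingType) (fr : {rmorphism A -> A}).
Local Notation tw := (map_fps fr).
Implicit Types (th be ga : A) (f g h W : fps A).

(** The equation [th f + be f' + ga f'' = t f] of the Tate module of
    [th + be tau + ga tau^2], where [f'] is the twist [map_fps fr f]. *)
Definition tate_eq th be ga f : Prop :=
  fpsC th * f + fpsC be * tw f + fpsC ga * tw (tw f) = fpsX A * f.

Lemma tate_eqP th be ga f : tate_eq th be ga f <->
  forall n, th * f$_n + be * fr f$_n + ga * fr (fr f$_n) =
            if n is m.+1 then f$_m else 0.
Proof.
rewrite /tate_eq -fpsP; split=> + n => /(_ n);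
  by rewrite !fps_coefD !fps_coefCM fps_coefXM.
Qed.

Definition wronskian f g := f * tw g - tw f * g.

Lemma carlitz_eqE th W : tate_eq th 1 0 W <-> tw W = (fpsX A - fpsC th) * W.
Proof.
rewrite /tate_eq !rmorph1 !rmorph0 mul0r addr0 mul1r mulrBl; split=> [<-|->].
  by rewrite addrAC subrr add0r.
by rewrite addrC subrK.
Qed.

Lemma tate_eq_rank2E th be f : tate_eq th be (- 1) f <->
  tw (tw f) = (fpsC th - fpsX A) * f + fpsC be * tw f.
Proof.
rewrite /tate_eq rmorphN1 mulN1r mulrBl; split=> [<-|->]; ring.
Qed.

(** Substituting the equation for [f''] and [g''] in the twist of the Wronskian,
    the terms in [be] cancel and [theta - t] factors out. *)
Lemma wronskian_carlitz th be f g :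
  tate_eq th be (- 1) f -> tate_eq th be (- 1) g -> tate_eq th 1 0 (wronskian f g).
Proof.
move=> /tate_eq_rank2E fE /tate_eq_rank2E gE; apply/carlitz_eqE.
rewrite /wronskian rmorphB !rmorphM /= fE gE; ring.
Qed.

Lemma fpsX_subC_unit th : th \is a GRing.unit -> fpsX A - fpsC th \is a GRing.unit.
Proof. by move=> thU; rewrite fps_unitE fps_coefB sub0r unitrN. Qed.

(** Both series are multiplied by [t - th] under the twist. *)
Lemma carlitz_ratio_fixed th W W' : th \is a GRing.unit -> W \is a GRing.unit ->
  tate_eq th 1 0 W -> tate_eq th 1 0 W' -> tw (W' / W) = W' / W.
Proof.
move=> thU WU /carlitz_eqE WE /carlitz_eqE W'E.
have TU := fpsX_subC_unit thU.
rewrite rmorph_div //= WE W'E invrM //.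
by rewrite [W^-1 * _]mulrC mulrACA divrr // mul1r.
Qed.

(** Cramer's rule: the coordinates are quotients of Wronskians, hence quotients of
    Carlitz solutions, hence invariant under the twist. *)
Lemma rank2_coordinates th be f g h : th \is a GRing.unit ->
  wronskian f g \is a GRing.unit ->
  tate_eq th be (- 1) f -> tate_eq th be (- 1) g -> tate_eq th be (- 1) h ->
  exists c d, [/\ tw c = c, tw d = d & h = f * c + g * d].
Proof.
move=> thU WU fE gE hE.
exists (wronskian h g / wronskian f g), (wronskian f h / wronskian f g).
split; try by apply: carlitz_ratio_fixed (thU) WU _ _; apply: wronskian_carlitz; eassumption.
apply: (mulIr WU); rewrite mulrDl -!mulrA !mulVr // !mulr1 /wronskian; ring.
Qed.

Lemma tate_eqM th be ga f c : tw c = c -> tate_eq th be ga f ->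
  tate_eq th be ga (f * c).
Proof.
move=> cE; rewrite /tate_eq !rmorphM /= !cE => fE; rewrite [RHS]mulrA -fE; ring.
Qed.

Lemma wronskian_comb f g c d c' d' : tw c = c -> tw d = d -> tw c' = c' -> tw d' = d' ->
  wronskian (f * c + g * d) (f * c' + g * d') = (c * d' - d * c') * wronskian f g.
Proof.
move=> cE dE cE' dE'; rewrite /wronskian !rmorphD !rmorphM /= cE dE cE' dE'; ring.
Qed.

(** D'Alembert's reduction of order: given a solution [f], the Wronskian determines
    the quotient of a second solution by [f] up to an Artin-Schreier equation. *)
Lemma reduction_of_order th be f W xi : f \is a GRing.unit ->
  tate_eq th be (- 1) f -> tate_eq th 1 0 W -> tw xi - xi = W / (f * tw f) ->
  tate_eq th be (- 1) (f * xi) /\ wronskian f (f * xi) = W.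
Proof.
move=> fU; have tfU : tw f \is a GRing.unit by apply: rmorph_unit.
move=> /tate_eq_rank2E fE /carlitz_eqE WE xiE.
have {}xiE : f * tw f * (tw xi - xi) = W by rewrite xiE mulrC divrK // unitrM fU.
have wE : wronskian f (f * xi) = W by rewrite -xiE /wronskian rmorphM; ring.
split=> //; apply/tate_eq_rank2E; move: WE; rewrite -wE /wronskian.
rewrite !rmorphB !rmorphM /= fE => WE; apply: (mulrI tfU).
set x := tw xi in WE *; set y := tw x in WE *.
have -> : tw f * (((fpsC th - fpsX A) * f + fpsC be * tw f) * y) =
  (tw f * (((fpsC th - fpsX A) * f + fpsC be * tw f) * y) -
   ((fpsC th - fpsX A) * f + fpsC be * tw f) * (tw f * x)) +
   ((fpsC th - fpsX A) * f + fpsC be * tw f) * (tw f * x) by rewrite subrK.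
rewrite WE; ring.
Qed.

Lemma companion_solution th be f W : (forall y, exists x, fr x - x = y) ->
  f \is a GRing.unit -> tate_eq th be (- 1) f -> tate_eq th 1 0 W ->
  exists xi, [/\ tw xi - xi = W / (f * tw f), tate_eq th be (- 1) (f * xi) &
     wronskian f (f * xi) = W].
Proof.
move=> /choice [as_root as_rootP] fU fE WE.
pose xi := Fps (fun n => as_root (W / (f * tw f))$_n).
have xiE : tw xi - xi = W / (f * tw f) by apply/fpsP => n; apply: as_rootP.
by exists xi; have [] := reduction_of_order fU fE WE xiE.
Qed.

(** Conjugation of the module by a scalar [la]. *)
Lemma tate_eq_scale th be ga be' ga' la f :
  be * fr la = la * be' -> ga * fr (fr la) = la * ga' ->
  tate_eq th be' ga' f -> tate_eq th be ga (fpsC la * f).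
Proof.
rewrite /tate_eq => beE gaE fE.
rewrite !rmorphM /= !map_fpsC [RHS]mulrCA -fE.
have -> : fpsC be * (fpsC (fr la) * tw f) = fpsC la * (fpsC be' * tw f).
  by rewrite !mulrA -!rmorphM beE.
have -> : fpsC ga * (fpsC (fr (fr la)) * tw (tw f)) = fpsC la * (fpsC ga' * tw (tw f)).
  by rewrite !mulrA -!rmorphM gaE.
ring.
Qed.

(** Solving the equation coefficient by coefficient, from a given torsion point
    [x0], only requires that the additive polynomial be surjective. *)
Lemma tate_eq_extend th be ga x0 :
  th * x0 + be * fr x0 + ga * fr (fr x0) = 0 ->
  (forall y, exists x, th * x + be * fr x + ga * fr (fr x) = y) ->
  exists2 f, tate_eq th be ga f & f$_0 = x0.
Proof.
move=> x0E sol; pose P n (g : nat -> A) x := if n is m.+1 then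
  th * x + be * fr x + ga * fr (fr x) = g m else x = x0.
have [|n g|g gP] := @strong_choice A 0 P.
- by move=> [|n] g h x gh //=; rewrite gh.
- by case: n => [|n]; [exists x0|apply: sol].
exists (Fps g); last exact: (gP 0%N).
apply/tate_eqP => -[|n] /=; last exact: (gP n.+1).
by have /= -> := gP 0%N.
Qed.

End TateEquation.

Lemma map_fps_comm (A B : comNzRingType) (frA : {rmorphism A -> A})
    (frB : {rmorphism B -> B}) (s : {rmorphism A -> B}) f :
  (forall x, s (frA x) = frB (s x)) ->
  map_fps s (map_fps frA f) = map_fps frB (map_fps s f).
Proof. by move=> sfr; apply/fpsP => n /=; rewrite sfr. Qed.

Lemma tate_eq_map (A B : comUnitRingType) (frA : {rmorphism A -> A})
    (frB : {rmorphism B -> B}) (s : {rmorphism A -> B}) th be ga f :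
  (forall x, s (frA x) = frB (s x)) -> tate_eq frA th be ga f ->
  tate_eq frB (s th) (s be) (s ga) (map_fps s f).
Proof.
move=> sfr /tate_eqP fE; apply/tate_eqP => n /=.
rewrite -!sfr -!rmorphM -!rmorphD fE; case: n => //=; exact: rmorph0.
Qed.

Section ReducedEquation.
Variables (k : fieldType) (fr : {rmorphism k -> k}) (F : fieldType) (jF : {rmorphism F -> k}).
Hypothesis frF : forall c, fr (jF c) = jF c.
Local Notation tw := (map_fps fr).

(** When [ga = 0] the equation of [w] has order one and determines [w'], so the
    quotient [W / (w w')] satisfies a first-order equation as well. *)
Lemma reduced_quotient_eq th be w W : w \is a GRing.unit ->
  tate_eq fr th be 0 w -> tate_eq fr th 1 0 W ->
  (fpsX k - fpsC (fr th)) * tw (W / (w * tw w)) = fpsC (be * fr be) * (W / (w * tw w)).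
Proof.
move=> wU wE /carlitz_eqE WE; have twU : tw w \is a GRing.unit by apply: rmorph_unit.
have {}wE : fpsC be * tw w = (fpsX k - fpsC th) * w.
  by move: wE; rewrite /tate_eq rmorph0 mul0r addr0 mulrBl => <-; ring.
have wE2 : fpsC (fr be) * tw (tw w) = (fpsX k - fpsC (fr th)) * tw w.
  by have := congr1 tw wE; rewrite !rmorphM rmorphB /= !map_fpsC map_fpsX.
have ttwU : tw (tw w) \is a GRing.unit by apply: rmorph_unit.
have U2 : w * tw w \is a GRing.unit by rewrite unitrM wU.
have U3 : tw w * tw (tw w) \is a GRing.unit by rewrite unitrM twU.
rewrite rmorph_div //= rmorphM WE.
apply: (mulIr U3); rewrite mulrA -[X in X = _]mulrA divrK //.
apply: (mulIr wU).
have -> : (fpsX k - fpsC (fr th)) * ((fpsX k - fpsC th) * W) * w =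
  (fpsX k - fpsC (fr th)) * W * (fpsC be * tw w) by rewrite wE; ring.
have -> : fpsC (be * fr be) * W / (w * tw w) * (tw w * tw (tw w)) * w =
  fpsC be * W / (w * tw w) * (w * tw w) * (fpsC (fr be) * tw (tw w)).
  by rewrite rmorphM; ring.
by rewrite divrK // wE2; ring.
Qed.

(** Comparing a linear relation with its q-th power and using the equation lowers
    the indices of the relation by one, until only the nonzero [g$_0] is left. *)
Lemma reduced_coef_free a ka g : ka != 0 -> g$_0 != 0 ->
  (fpsX k - fpsC a) * tw g = fpsC ka * g ->
  forall n (c : nat -> F), \sum_(i < n) jF (c i) * g$_i = 0 ->
  forall i, (i < n)%N -> c i = 0.
Proof.
move=> ka0 g0 gE; elim=> [|n IHn] c // cg.
have gn m : ka * g$_m = (if m is m'.+1 then fr g$_m' else 0) - a * fr g$_m.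
  by rewrite -fps_coefCM -gE mulrBl fps_coefB fps_coefXM fps_coefCM; case: m.
have : \sum_(i < n) jF (c i.+1) * g$_i = 0.
  apply: (fmorph_inj fr); rewrite rmorph0 rmorph_sum /=.
  transitivity (ka * (\sum_(i < n.+1) jF (c i) * g$_i) +
                a * fr (\sum_(i < n.+1) jF (c i) * g$_i)); last first.
    by rewrite cg rmorph0 !mulr0 addr0.
  rewrite rmorph_sum /= !mulr_sumr -big_split /= [RHS]big_ord_recl /=.
  rewrite mulrCA gn sub0r rmorphM frF mulrCA -mulrDr addNr mulr0 add0r.
  apply: eq_bigr => i _; rewrite !rmorphM /= !frF /bump /= add1n.
  by rewrite mulrCA gn mulrCA -mulrDr subrK.
move=> /(IHn (fun i => c i.+1)) c0 [|i] lt_i; last by apply: c0.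
move: cg; rewrite big_ord_recl big1 ?addr0 => [|j _]; last first.
  by rewrite /= /bump /= add1n c0 // rmorph0 mul0r.
by move/eqP; rewrite mulf_eq0 (negPf g0) orbF fmorph_eq0 => /eqP.
Qed.

End ReducedEquation.

(** * Absolute traces and duality over a finite field *)

Section Trace.
Variables (p n : nat) (R : comNzRingType).
Hypothesis pR : p \in [pchar R].

(** The polynomial function [x + x^p + ... + x^(p^(n-1))], which on a field with
    [p ^ n] elements is the absolute trace. *)
Definition frob_trace (x : R) : R := \sum_(j < n) x ^+ (p ^ j).

Lemma frob_powD j (x y : R) : (x + y) ^+ (p ^ j) = x ^+ (p ^ j) + y ^+ (p ^ j).
Proof. by apply: exprDn_pchar; rewrite pnatX pnatE ?pR // (pcharf_prime pR). Qed.

Lemma frob_pow_gt0 j : (0 < p ^ j)%N.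
Proof. by rewrite expn_gt0 prime_gt0 // (pcharf_prime pR). Qed.

Lemma frob_pow0 j : (0 : R) ^+ (p ^ j) = 0.
Proof. by rewrite expr0n -leqn0 leqNgt frob_pow_gt0. Qed.

Lemma frob_pow_sum j I (r : seq I) (P : pred I) (E : I -> R) :
  (\sum_(i <- r | P i) E i) ^+ (p ^ j) = \sum_(i <- r | P i) (E i) ^+ (p ^ j).
Proof. exact: (big_morph (fun x => x ^+ (p ^ j)) (@frob_powD j) (frob_pow0 j)). Qed.

Lemma frob_traceD x y : frob_trace (x + y) = frob_trace x + frob_trace y.
Proof. by rewrite -big_split; apply: eq_bigr => j _; rewrite frob_powD. Qed.

Lemma frob_traceB x y : frob_trace (x - y) = frob_trace x - frob_trace y.
Proof. by apply/eqP; rewrite eq_sym subr_eq -frob_traceD subrK. Qed.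

(** This telescoping identity turns an equation [y^q - y = r] into an
    Artin-Schreier equation of degree [p] for the trace of [y]. *)
Lemma frob_trace_pow x : frob_trace x ^+ p - frob_trace x = x ^+ (p ^ n) - x.
Proof.
rewrite /frob_trace -[X in _ ^+ X](expn1 p) frob_pow_sum.
under eq_bigr => j _ do rewrite -exprM expn1 -expnSr.
elim: n => [|m IHm]; first by rewrite !big_ord0 !subrr.
by rewrite !big_ord_recr /= opprD addrACA IHm addrC addrA subrK.
Qed.

End Trace.

Lemma frob_trace_map p n (R S : comNzRingType) (f : {rmorphism R -> S}) x :
  frob_trace p n (f x) = f (frob_trace p n x).
Proof. by rewrite /frob_trace rmorph_sum; apply: eq_bigr => j _; rewrite rmorphXn. Qed.

Section TraceDual.
Variables (F : finFieldType) (p n : nat).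
Hypotheses (pF : p \in [pchar F]) (cardF : #|F| = (p ^ n)%N).

(** By counting: [V] is elementary abelian, so it has [d] generators and [p ^ d]
    elements, while the values of the trace forms on these generators lie in the
    prime field.  If no nonzero [c] annihilated [V], there would be at most [p ^ d]
    choices for [c], and [V] would be everything. *)
Lemma trace_dual k (V : {set 'rV[F]_k}%type) :
  0 \in V -> {in V &, forall u v, u + v \in V} -> (exists u, u \notin V) ->
  exists2 c : 'rV[F]_k, c != 0 &
    {in V, forall u : 'rV[F]_k, frob_trace p n (\sum_i c 0 i * u 0 i) = 0}.
Proof.
move=> V0 VD [u0 u0V]; have p_pr := pcharf_prime pF.
have gV : group_set V by apply/group_setP; split.
pose G := fingroup.group gV.
have mulrp (u : 'rV[F]_k) : u *+ p = 0.
  by apply/rowP => i; rewrite mulmxnE mxE mulrn_pchar.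
have abG : (p.-abelem G)%g.
  rewrite abelemE //; apply/andP; split; last first.
    by apply/exponentP => u _; rewrite FinRing.zmodXgE mulrp.
  by apply/centsP => u _ v _; rewrite /commute !FinRing.zmodMgE addrC.
have [B defB cardB] := grank_witness G.
have cardG : #|G| = (p ^ #|B|)%N.
  rewrite cardB grank_abelian ?(abelem_abelian abG) // (rank_abelem abG).
  have /pgroupP := abelem_pgroup abG; have := abelem_pgroup abG.
  by move=> pG _; rewrite -(card_pgroup pG).
apply: contrapT => nc; case/negP: u0V.
have c0 (c : 'rV[F]_k) :
    {in V, forall u : 'rV[F]_k, frob_trace p n (\sum_i c 0 i * u 0 i) = 0} -> c = 0.
  by move=> cV; apply/eqP; apply: contrapT => /negP c0; apply: nc; exists c.
pose P := [pred x : F | x ^+ p == x].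
have cardP : (#|P| <= p)%N.
  pose f : {poly F} := 'X^p - 'X.
  have szf : size f = p.+1.
    by rewrite size_polyDl size_polyXn // size_polyN size_polyX ltnS prime_gt1.
  rewrite cardE -ltnS -szf; apply: max_poly_roots.
  - by rewrite -size_poly_gt0 szf.
  - by apply/allP => x; rewrite mem_enum inE /root !hornerE subr_eq0.
  - exact: enum_uniq.
pose Phi (c : 'rV[F]_k) : {ffun 'rV[F]_k -> F} :=
  [ffun u => if u \in B then frob_trace p n (\sum_i c 0 i * u 0 i) else 0].
have PhiP c : Phi c \in pffun_on 0 (mem B) (mem P).
  apply/pffun_onP; split=> [|_ /fintype.imageP [u uB ->]].
    apply/fintype.subsetP => u; rewrite /support /in_mem /= ffunE.
    by case: ifP => //; rewrite eqxx.
  by rewrite ffunE uB inE -subr_eq0 (frob_trace_pow n pF) subr_eq0 -cardF expf_card.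
have Phi_inj : injective Phi.
  move=> c d cd; apply/eqP; rewrite -subr_eq0; apply/eqP/c0 => u uV.
  pose H := finset.finset
    (fun u : 'rV[F]_k => frob_trace p n (\sum_i (c - d) 0 i * u 0 i) == 0).
  have gH : group_set H.
    apply/group_setP; split=> [|v w]; rewrite !inE.
      rewrite big1 => [|i _]; last by rewrite [X in _ * X]mxE mulr0.
      by rewrite /frob_trace big1 // => j _; apply: (frob_pow0 pF).
    move=> /eqP v0 /eqP w0; rewrite FinRing.zmodMgE.
    under eq_bigr => i _ do rewrite [X in _ * X]mxE mulrDr.
    by rewrite big_split /= (frob_traceD n pF) v0 w0 addr0.
  have : (<<B>> \subset fingroup.group gH)%g.
    rewrite gen_subG; apply/fintype.subsetP => v vB; rewrite inE.
    have /ffunP /(_ v) := cd; rewrite !ffunE vB => cdv.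
    under eq_bigr => i _ do rewrite !mxE mulrBl.
    by rewrite sumrB (frob_traceB n pF) cdv subrr.
  by rewrite defB => /fintype.subsetP /(_ u uV); rewrite inE => /eqP.
have card_le : (#|{: 'rV[F]_k}| <= #|V|)%N.
  rewrite -(card_codom Phi_inj) [X in (_ <= X)%N]cardG.
  apply: leq_trans (_ : #|P| ^ #|B| <= _)%N; last first.
    by have [->|B0] := posnP #|B|; rewrite ?expn0 // leq_exp2r.
  rewrite -(card_pffun_on (0 : F)); apply: subset_leq_card.
  apply/fintype.subsetP => _ /codomP [c ->].
  exact: PhiP.
have /subset_leqif_card [_ VE] : V \subset {: 'rV[F]_k} by apply/fintype.subsetP.
have : #|V| == #|{: 'rV[F]_k}| by rewrite eqn_leq card_le max_card.
by rewrite VE => /fintype.subsetP; apply.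
Qed.

End TraceDual.

(** * Fraction fields, Frobenius maps and additive polynomials *)

Lemma fraction_repr (R : idomainType) (x : {fraction R}) :
  x * FracField.tofrac (repr x : {ratio R}).2 = FracField.tofrac (repr x : {ratio R}).1.
Proof.
rewrite -{1}[x]reprK; set r := repr x.
rewrite /FracField.tofrac; unlock; rewrite -[LHS]FracField.pi_mul.
apply/eqmodP; rewrite /= /FracField.equivf /FracField.mulf /=.
have d0 := denom_ratioP r.
by rewrite !numden_Ratio ?mulr1 ?oner_neq0 //; apply/eqP; rewrite mulrC.
Qed.

Lemma fraction_div (R : idomainType) (x : {fraction R}) :
  exists n d, d != 0 /\ x = FracField.tofrac n / FracField.tofrac d.
Proof.
have d0 := denom_ratioP (repr x : {ratio R}).
exists (repr x : {ratio R}).1, (repr x : {ratio R}).2; split=> //.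
by rewrite -fraction_repr mulfK // tofrac_eq0.
Qed.

(** The universal property of the field of fractions. *)
Lemma fraction_lift (R : idomainType) (M : fieldType) (f : {rmorphism R -> M}) :
  injective f ->
  exists g : {rmorphism {fraction R} -> M}, forall r, g (FracField.tofrac r) = f r.
Proof.
move=> f_inj; have f0 r : r != 0 -> f r != 0.
  by apply: contra_neq => /eqP; rewrite -(rmorph0 f) => /eqP /f_inj.
pose nu (x : {fraction R}) := (repr x : {ratio R}).1.
pose de (x : {fraction R}) := (repr x : {ratio R}).2.
have de0 x : de x != 0 by apply: denom_ratioP.
have xE (x : {fraction R}) : x * FracField.tofrac (de x) = FracField.tofrac (nu x).
  exact: fraction_repr.
pose g x := f (nu x) / f (de x).
have gE x n d : d != 0 -> x * FracField.tofrac d = FracField.tofrac n -> g x = f n / f d.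
  move=> d0 xd; apply/eqP; rewrite eqr_div ?f0 // -!rmorphM; apply/eqP; congr (f _).
  apply/eqP; rewrite -tofrac_eq !rmorphM /= -xE -xd; apply/eqP; ring.
have [|||h hE] := @rmorphism_of_morphs _ _ g.
- move=> x y; rewrite (gE _ (nu x * de y - nu y * de x) (de x * de y)).
  + by rewrite rmorphB !rmorphM /= /g -[in RHS]mulNr addf_div ?f0 // mulNr.
  + by rewrite mulf_neq0.
  + by rewrite rmorphB !rmorphM /= -!xE; ring.
- move=> x y; rewrite (gE _ (nu x * nu y) (de x * de y)).
  + by rewrite !rmorphM /= /g mulf_div.
  + by rewrite mulf_neq0.
  + by rewrite !rmorphM /= -!xE; ring.
- by rewrite (gE _ 1 1) ?rmorph1 ?divr1 ?oner_neq0 // mulr1.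
exists h => r; rewrite hE (gE _ r 1) ?rmorph1 ?divr1 ?oner_neq0 //; exact: mulr1.
Qed.

Section FrobeniusRing.
Variables (F : finFieldType) (A : comNzRingType) (jF : {rmorphism F -> A}).
Local Notation q := #|F|.

Lemma card_prime_power : exists p n, [/\ prime p, p \in [pchar F], (0 < n)%N & q = (p ^ n)%N].
Proof.
have [p p_pr pF] := finPcharP F.
have [n qE] : exists n, q = (p ^ n)%N by eexists; apply: (card_pprimeChar pF).
exists p, n; split=> //; have := finNzRing_gt1 F; rewrite qE.
by case: n {qE}.
Qed.

Lemma frobenius_morphism : exists fr : {rmorphism A -> A}, forall x, fr x = x ^+ q.
Proof.
have [p [n [p_pr pF _ qE]]] := card_prime_power.
have pA : p \in [pchar A] by apply: rmorph_pchar jF _ pF.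
have pq : [pchar A].-nat q by rewrite qE pnatX pnatE // pA.
have [|||fr frE] := @rmorphism_of_morphs _ _ (fun x : A => x ^+ q).
- by move=> x y; rewrite exprDn_pchar // exprNn_pchar.
- by move=> x y; rewrite exprMn.
- exact: expr1n.
by exists fr.
Qed.

Lemma frobenius_const (c : F) : jF c ^+ q = jF c.
Proof. by rewrite -rmorphXn expf_card. Qed.

End FrobeniusRing.

(** All roots of [X^q - X] come from [F]. *)
Lemma frobenius_fixed (F : finFieldType) (M : fieldType) (jF : {rmorphism F -> M}) x :
  x ^+ #|F| = x -> exists c, x = jF c.
Proof.
move=> xq; have := congr1 (fun p => (map_poly jF p).[x]) (finField_genPoly F).
rewrite rmorphB /= map_polyXn map_polyX !hornerE xq subrr rmorph_prod horner_prod => /esym/eqP.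
rewrite prodf_seq_eq0 => /hasP [c _] /=.
by rewrite map_polyXsubC !hornerE subr_eq0 => /eqP; exists c.
Qed.

Lemma coprimep_const (k : fieldType) (p : {poly k}) c : c != 0 -> coprimep p c%:P.
Proof.
move=> c0; apply/Bezout_eq1_coprimepP; exists (0, c^-1%:P).
by rewrite mul0r add0r -polyCM mulVf.
Qed.

Definition separably_closed (k : fieldType) : Prop :=
  forall p : {poly k}, separable_poly p -> (1 < size p)%N -> exists x, root p x.

Section SeparablyClosed.
Variables (F : finFieldType) (k : fieldType) (jF : {rmorphism F -> k}).
Local Notation q := #|F|.

Let q_gt1 : (1 < q)%N := finNzRing_gt1 F.

Lemma card_nat_eq0 : q%:R = 0 :> k.
Proof.
have [p [n [p_pr pF n_gt0 ->]]] := card_prime_power F.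
have pk : p \in [pchar k] by apply: rmorph_pchar jF _ pF.
by case: n n_gt0 => // n _; rewrite natrX (pcharf0 pk) expr0n.
Qed.

Definition additive_poly (c be ga : k) : {poly k} :=
  c *: 'X + be *: 'X^q + ga *: 'X^(q * q).

Lemma additive_poly_deriv c be ga : (additive_poly c be ga)^`() = c%:P.
Proof.
rewrite /additive_poly !derivD !derivZ derivX !derivXn.
have q0 : (q%:R : {poly k}) = 0 by rewrite -(rmorph_nat (@polyC k)) card_nat_eq0.
rewrite -[_ *+ q]mulr_natr -[_ *+ (q * q)]mulr_natr natrM q0 !mulr0.
by rewrite !scaler0 !addr0 alg_polyC.
Qed.

(** The derivative is the constant [c], as [q = 0] in [k]. *)
Lemma additive_poly_separable c be ga y : c != 0 ->
  separable_poly (additive_poly c be ga - y%:P).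
Proof.
move=> c0; rewrite separable_poly.unlock derivB derivC subr0 additive_poly_deriv.
exact: coprimep_const.
Qed.

Lemma additive_poly_hornerE c be ga x :
  (additive_poly c be ga).[x] = c * x + be * x ^+ q + ga * (x ^+ q) ^+ q.
Proof. by rewrite /additive_poly !hornerE exprM. Qed.

Hypothesis kclosed : separably_closed k.

Lemma additive_solve (c be ga y : k) : c != 0 ->
  exists x, c * x + be * x ^+ q + ga * (x ^+ q) ^+ q = y.
Proof.
move=> c0; pose P := additive_poly c be ga - y%:P.
have P1 : P`_1 = c.
  rewrite coefB /additive_poly !coefD !coefZ coefX !coefXn coefC /=.
  by rewrite !(ltn_eqF _) ?mulr0 ?mulr1 ?addr0 ?subr0 // (leq_trans q_gt1) // leq_pmulr // ltnW.
have [||x /rootP] := kclosed (p := P).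
- exact: additive_poly_separable.
- by rewrite ltnNge; apply: contraNN c0 => sP; rewrite -P1 nth_default.
by rewrite hornerD additive_poly_hornerE hornerN hornerC => /subr0_eq; exists x.
Qed.

(** Dividing the additive polynomial by [X] leaves a separable polynomial of
    positive degree with nonzero constant term. *)
Lemma additive_nonzero_root (c be ga : k) : c != 0 -> (be != 0) || (ga != 0) ->
  exists2 x, x != 0 & c * x + be * x ^+ q + ga * (x ^+ q) ^+ q = 0.
Proof.
move=> c0 bg; pose Q := c%:P + be *: 'X^(q.-1) + ga *: 'X^((q * q)%N.-1) : {poly k}.
have QX : Q * 'X = additive_poly c be ga.
  rewrite /additive_poly !mulrDl mul_polyC -!scalerAl -!exprSr !prednK //; lia.
have Q0 : Q.[0] != 0.
  by rewrite /Q !hornerE !expr0n !(gtn_eqF _) ?mulr0 ?addr0 //; nia.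
have [||x Qx] := kclosed (p := Q).
- apply: (@dvdp_separable _ (additive_poly c be ga)); first by rewrite -QX dvdp_mulr.
  rewrite separable_poly.unlock additive_poly_deriv; exact: coprimep_const.
- have coefQ n : Q`_n = c * (n == 0%N)%:R + be * (n == q.-1)%:R + ga * (n == (q * q)%N.-1)%:R.
    by rewrite /Q !coefD !coefZ !coefXn coefC; case: (n == 0%N); rewrite ?mulr1 ?mulr0.
  rewrite ltnNge; apply/negP => sQ.
  have coefQ0 n : (0 < n)%N -> Q`_n = 0.
    by move=> n0; rewrite nth_default //; apply: leq_trans sQ n0.
  have ga0 : ga = 0.
    have := coefQ0 (q * q)%N.-1; rewrite coefQ eqxx !(gtn_eqF _) ?mulr0 ?mulr1 ?add0r.
    - by apply; nia.
    - by nia.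
    - by nia.
  have be0 : be = 0.
    have := coefQ0 q.-1; rewrite coefQ eqxx ga0 mul0r addr0 !(gtn_eqF _) ?mulr0 ?mulr1 ?add0r.
    - by apply; lia.
    - by lia.
  by move: bg; rewrite be0 ga0 eqxx.
have x0 : x != 0 by apply: contraTneq Qx => ->.
exists x => //; rewrite -additive_poly_hornerE -QX hornerM (rootP Qx) mul0r //.
Qed.

End SeparablyClosed.

(** * Complete local fields: lifting and Artin-Schreier equations *)

Section Residue.
Variable R : comNzRingType.
Definition fps_res (f : fps R) : R := f$_0.
Fact fps_res_zmod : zmod_morphism fps_res. Proof. by []. Qed.
Fact fps_res_monoid : monoid_morphism fps_res.
Proof. by split=> // f g; rewrite /fps_res fps_coef0M. Qed.
HB.instance Definition _ := GRing.isZmodMorphism.Build (fps R) R fps_res fps_res_zmod.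
HB.instance Definition _ := GRing.isMonoidMorphism.Build (fps R) R fps_res fps_res_monoid.
End Residue.

Section Lifting.
Variables (k : fieldType) (q : nat) (fr : {rmorphism fps k -> fps k}).
Hypotheses (q_gt1 : (1 < q)%N) (frE : forall x, fr x = x ^+ q).

(** Hensel's lemma for an additive polynomial whose linear coefficient is a unit.
    The terms of degree [q] and [q ^ 2] contribute to the n-th coefficient only
    through the earlier coefficients of the root, so it can be solved for. *)
Lemma additive_lift (c be ga y : fps k) x0 : c \is a GRing.unit ->
  c$_0 * x0 + be$_0 * x0 ^+ q + ga$_0 * (x0 ^+ q) ^+ q = y$_0 ->
  exists2 x, x$_0 = x0 & c * x + be * fr x + ga * fr (fr x) = y.
Proof.
rewrite fps_unitE unitfE => c0 x0E.
pose trunc n (g : nat -> k) := Fps (fun i => if (i < n)%N then g i else 0).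
pose P (n : nat) (g : nat -> k) x := if n == 0%N then x = x0 else
  \sum_(i < n) g i * c$_(n - i) + x * c$_0 +
  (be * fr (trunc n g) + ga * fr (fr (trunc n g)))$_n = y$_n.
have [|n g|g gP] := @strong_choice k 0 P.
- move=> n g h x gh; rewrite /P; case: eqP => // _ <-; congr (_ + _ + _).
    by apply: eq_bigr => i _; rewrite gh.
  suff -> : trunc n g = trunc n h by [].
  by apply/fpsP => i /=; case: ifP => // lt_in; rewrite gh.
- rewrite /P; case: eqP => _; first by exists x0.
  exists ((y$_n - (be * fr (trunc n g) + ga * fr (fr (trunc n g)))$_n -
           \sum_(i < n) g i * c$_(n - i)) / c$_0).
  by rewrite divfK //; ring.
exists (Fps g); first exact: (gP 0%N).
apply/fpsP => -[|n].
  rewrite !fps_coefD !fps_coef0M !frE !fps_coef0X -x0E.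
  by have /= -> := gP 0%N.
have <- : \sum_(i < n.+1) g i * c$_(n.+1 - i) + g n.+1 * c$_0 +
    (be * fr (trunc n.+1 g) + ga * fr (fr (trunc n.+1 g)))$_n.+1 = y$_n.+1 := gP n.+1.
rewrite -addrA fps_coefD; congr (_ + _).
  by rewrite mulrC fps_coefM big_ord_recr /= subnn.
set T := trunc n.+1 g; pose Z := Fps g - T.
have Z0 : fps_low0 n.+1 Z by move=> i lt_in; rewrite fps_coefB /= lt_in subrr.
have frZ : fps_low0 n.+2 (fr Z) by rewrite frE; apply: fps_low0X.
have frfrZ : fps_low0 n.+2 (fr (fr Z)).
  by rewrite [X in fps_low0 _ X]frE -(ltn_predK q_gt1) exprS; apply: fps_low0_Mr.
have -> : Fps g = T + Z by rewrite addrC subrK.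
rewrite [fr (T + Z)]rmorphD [fr (fr T + fr Z)]rmorphD !mulrDr !fps_coefD.
rewrite [be * fr Z]mulrC [ga * fr (fr Z)]mulrC.
by rewrite (fps_low0_Mr _ frZ) // (fps_low0_Mr _ frfrZ) // !addr0.
Qed.

End Lifting.

Lemma clear_denominators (M : fieldType) (f g G fp x : M) : g != 0 -> G != 0 ->
  (fp / (g * G) - f / g) * x * (g * G) = x * fp - x * (f * G).
Proof. by move=> g0 G0; field; rewrite g0 G0. Qed.

Section ArtinSchreier.
Variables (k : fieldType) (p : nat).
Hypothesis p_gt1 : (1 < p)%N.
Local Notation tf := (@FracField.tofrac (fps k)).

Lemma fps_monomial_order N (f : fps k) n : fps_low0 n f -> f$_n != 0 ->
  fps_low0 (N + n) (fpsX k ^+ N * f) /\ (fpsX k ^+ N * f)$_(N + n) != 0.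
Proof.
move=> f0 fn; elim: N => [|N [lo nz]]; first by rewrite expr0 mul1r.
by rewrite exprS -mulrA addSn; split=> [[|i]|]; rewrite ?ltnS fps_coefXM //; apply: lo.
Qed.

Lemma fps_order_pow (f : fps k) n m : fps_low0 n f -> f$_n != 0 ->
  fps_low0 (m * n) (f ^+ m) /\ (f ^+ m)$_(m * n) != 0.
Proof.
move=> f0 fn; elim: m => [|m [lo nz]].
  by rewrite expr0 mul0n; split=> //; rewrite fps_coef1 oner_eq0.
rewrite exprS mulSn; have [lo' ->] := fps_coefM_order f0 lo.
by rewrite mulf_neq0.
Qed.

(** An element with a pole of order prime to [p] is not of the form [eta^p - eta]:
    if [eta] has a pole, the pole of [eta^p - eta] has order divisible by [p]. *)
Lemma no_artin_schreier_root N (h : fps k) (eta : {fraction fps k}) :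
  ~~ (p %| N)%N -> h \is a GRing.unit ->
  (eta ^+ p - eta) * tf (fpsX k ^+ N) != tf h.
Proof.
move=> pN hU; apply/eqP; have [f [g [g0 ->]]] := fraction_div eta.
move=> e; have {}e : fpsX k ^+ N * f ^+ p - fpsX k ^+ N * (f * g ^+ p.-1) = h * g ^+ p.
  apply/eqP; rewrite -tofrac_eq rmorphB !rmorphM /= -e !rmorphXn /=; apply/eqP.
  have tg0 : tf g != 0 by rewrite tofrac_eq0.
  have tgp0 : tf g ^+ p.-1 != 0 by rewrite expf_neq0.
  have gp : tf g ^+ p = tf g * tf g ^+ p.-1 by rewrite -exprS (ltn_predK p_gt1).
  rewrite expr_div_n gp; move: tgp0; move: (tf g ^+ p.-1) (tf f ^+ p) => G1 fp G10.
  by rewrite clear_denominators.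
have [B [gB gl]] := fps_order g0.
have h0 : h$_0 != 0 by rewrite -unitfE -fps_unitE.
have hl : fps_low0 0 h by [].
have [pl pB] := fps_order_pow p gl gB.
have [rl] := fps_coefM_order hl pl; rewrite add0n => rB.
have {}rB : (h * g ^+ p)$_(p * B) != 0 by rewrite rB mulf_neq0.
rewrite add0n in rl.
have [f0|/fps_order [A [fA fl]]] := eqVneq f 0.
  have fp0 : (0 : fps k) ^+ p = 0 by rewrite expr0n gtn_eqF ?(ltnW p_gt1).
  by move: rB; rewrite -e f0 fp0 mul0r mulr0 subrr fps_coef0 eqxx.
have [pfl pfA] := fps_order_pow p fl fA.
have [l1 n1] := fps_monomial_order N pfl pfA.
have [l2' n2'] := fps_order_pow p.-1 gl gB.
have [l2 n2] := fps_coefM_order fl l2'.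
have {}n2 : (f * g ^+ p.-1)$_(A + p.-1 * B) != 0 by rewrite n2 mulf_neq0.
have [l3 n3] := fps_monomial_order N l2 n2.
have N0 : (0 < N)%N by case: (N) pN; rewrite ?dvdn0.
have pE m : (p * m = m + p.-1 * m)%N by rewrite -{1}(ltn_predK p_gt1) mulSn.
have coefE n : (h * g ^+ p)$_n = (fpsX k ^+ N * f ^+ p)$_n -
    (fpsX k ^+ N * (f * g ^+ p.-1))$_n by rewrite -fps_coefB e.
(* [A] and [B] are the orders of numerator and denominator of [eta]. *)
have [leBA|ltAB] := leqP B A.
  have lt1 : (p * B < N + p * A)%N.
    by rewrite -[X in (X < _)%N]add0n -addSn leq_add // leq_mul2l leBA orbT.
  have lt3 : (p * B < N + (A + p.-1 * B))%N.
    by rewrite pE -[X in (X < _)%N]add0n -addSn leq_add // leq_add2r.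
  by move: rB; rewrite coefE (l1 _ lt1) (l3 _ lt3) subrr eqxx.
have lt13 : (N + p * A < N + (A + p.-1 * B))%N.
  rewrite ltn_add2l pE ltn_add2l ltn_mul2l ltAB andbT.
  by rewrite -ltnS (ltn_predK p_gt1).
have {n1}n1 : (h * g ^+ p)$_(N + p * A) != 0.
  by rewrite coefE (l3 _ lt13) subr0.
have [lt_|lt_|eq_] := ltngtP (N + p * A) (p * B).
- by move: n1; rewrite (rl _ lt_) eqxx.
- by move: rB; rewrite coefE (l1 _ lt_) (l3 _ (ltn_trans lt_ lt13)) subrr eqxx.
- by case/negP: pN; rewrite -(dvdn_addl N (dvdn_mulr A (dvdnn p))) eq_ dvdn_mulr.
Qed.

End ArtinSchreier.

(** * The embedding of the rational function field at a prime *)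

(** The powers [al^(q^i)] are all roots of [l], so two of them coincide and [al] is
    a root of some [X^(q^d) - X], which is separable. *)
Lemma finField_irreducible_separable (F : finFieldType) (k : fieldType)
    (jF : {rmorphism F -> k}) (l : {poly F}) al :
  irreducible_poly l -> root (map_poly jF l) al -> separable_poly l.
Proof.
move=> l_irr lal; have [fr frE] := frobenius_morphism jF.
have root_fr x : root (map_poly jF l) x -> root (map_poly jF l) (fr x).
  move=> /rootP lx; apply/rootP; rewrite -[RHS](rmorph0 fr) -lx -horner_map; congr (_.[_]).
  by rewrite -map_poly_comp; apply: eq_map_poly => c /=; rewrite frE frobenius_const.
have root_iter i : root (map_poly jF l) (iter i fr al) by elim: i => //= i; apply: root_fr.
have l0 : map_poly jF l != 0 by rewrite map_poly_eq0 -size_poly_gt0 ltnW // l_irr.1.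
pose s := [seq iter i fr al | i <- iota 0 (size l)].
have : ~~ uniq s.
  apply/negP => us; have := max_poly_roots l0 _ us.
  rewrite size_map_poly size_map size_iota ltnn => /(_ _)/negP; case=> //.
  by apply/allP => _ /mapP [i _ ->]; apply: root_iter.
move=> /(uniqPn al) [i [j [lt_ij]]]; rewrite size_map size_iota => lt_j.
rewrite !(nth_map 0%N) ?size_iota ?(ltn_trans lt_ij) //.
rewrite !nth_iota ?(ltn_trans lt_ij) // !add0n => eij.
have {eij} iter_al : iter (j - i) fr al = al.
  have : iter i fr (iter (j - i) fr al) = iter i fr al by rewrite -iterD subnKC // ltnW.
  by move: (j - i)%N => d; elim: (i) => //= m IHm /fmorph_inj.
have iterE m : iter m fr al = al ^+ (#|F| ^ m).
  by elim: m => [|m IHm]; rewrite ?expr1 //= IHm frE -exprM expnSr.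
pose f : {poly F} := 'X^(#|F| ^ (j - i)) - 'X.
have : l %| f.
  rewrite -(root_irreducible f l_irr lal) rmorphB /= map_polyXn map_polyX.
  by rewrite /root !hornerE -iterE iter_al subrr.
move=> /dvdp_separable; apply; rewrite separable_poly.unlock derivB derivXn derivX.
have q0 : (#|F|)%:R = 0 :> F by apply: (card_nat_eq0 idfun).
have -> : ('X^((#|F| ^ (j - i)).-1) *+ (#|F| ^ (j - i)) : {poly F}) = 0.
  by rewrite -mulr_natr -(rmorph_nat (@polyC F)) natrX q0 expr0n gtn_eqF ?subn_gt0 // mulr0.
by rewrite sub0r -(rmorphN1 (@polyC F)); apply: coprimep_const; rewrite oppr_eq0 oner_eq0.
Qed.

Lemma polymultP (F : finFieldType) (l f : {poly F}) : (1 < size l)%N -> f != 0 ->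
  exists2 g, f = g * l ^+ polymult l f & ~~ (l %| g).
Proof.
move=> szl f0; have l0 : l != 0 by rewrite -size_poly_gt0 ltnW.
have size_lX n : (n < size (l ^+ n))%N.
  elim: n => [|n IHn]; first by rewrite expr0 size_poly1.
  rewrite exprS size_mul // ?expf_neq0 //.
  have : (0 < size (l ^+ n))%N by rewrite size_poly_gt0 expf_neq0.
  by move: IHn szl; move: (size (l ^+ n)) (size l); lia.
have exn : exists n, l ^+ n %| f by exists 0%N; rewrite expr0 dvd1p.
have dvd_lt n : l ^+ n %| f -> (n < size f)%N.
  by move=> /dvdp_leq -/(_ f0); apply: leq_trans.
have le_f n : l ^+ n %| f -> (n <= size f)%N by move=> /dvd_lt /ltnW.
case: (ex_maxnP exn le_f) => n ln max_n.
have -> : polymult l f = n.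
  apply/eqP; rewrite eqn_leq; apply/andP; split.
    by apply/bigmax_leqP => i /max_n.
  exact: (@leq_bigmax_cond _ (fun i : ordinal (size f) => l ^+ i %| f)
    (@nat_of_ord _) (Ordinal (dvd_lt n ln))).
have [g fE] := dvdpP _ _ ln; exists g => //; apply/negP => /dvdpP [h gE].
suff /max_n : l ^+ n.+1 %| f by rewrite ltnn.
by rewrite fE gE exprS -mulrA dvdp_mull.
Qed.

Lemma ratfun_of_eq0 (F : finFieldType) (f : {poly F}) : (ratfun_of f == 0) = (f == 0).
Proof. exact: tofrac_eq0. Qed.

Lemma ratfun_num_den (F : finFieldType) (l : {poly F}) (x : ratfun F) : x != 0 ->
  exists nu de, [/\ de != 0, x * ratfun_of de = ratfun_of nu &
    vadic l x = ((polymult l nu)%:Z - (polymult l de)%:Z)%:E].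
Proof.
move=> x0; exists (repr x : {ratio {poly F}}).1, (repr x : {ratio {poly F}}).2.
split; [exact: denom_ratioP|exact: fraction_repr|by rewrite /vadic (negPf x0)].
Qed.

Section Evaluation.
Variables (F : finFieldType) (k : fieldType) (jF : {rmorphism F -> k}) (al : k) (e : nat).
Hypothesis e_gt0 : (0 < e)%N.

(** The image of [theta] in [k[[s]]].  With [e = q - 1] the ramification is chosen
    so that the pole of [b] becomes a (q-1)-st power up to a unit. *)
Definition local_theta : fps k := fpsC al + fpsX k ^+ e.
Definition local_eval : {poly k} -> fps k := horner_eval local_theta \o map_poly (@fpsC k).
HB.instance Definition _ := GRing.RMorphism.on local_eval.

Lemma local_theta_res : local_theta$_0 = al.
Proof. by rewrite fps_coefD fps_coef0X /= expr0n gtn_eqF // addr0. Qed.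

Lemma local_evalXsubC : local_eval ('X - al%:P) = fpsX k ^+ e.
Proof.
by rewrite /local_eval /= map_polyXsubC /horner_eval !hornerE /local_theta addrC addKr.
Qed.

Lemma local_evalX : local_eval 'X = local_theta.
Proof. by rewrite /local_eval /= map_polyX /horner_eval hornerX. Qed.

Lemma local_eval_res g : (local_eval g)$_0 = g.[al].
Proof.
rewrite -[LHS]/(fps_res (local_eval g)) /local_eval /= /horner_eval.
rewrite -[LHS](horner_map (@fps_res k)) -[X in _.[X]]/(local_theta$_0) local_theta_res.
by congr _.[_]; rewrite -map_poly_comp map_poly_id.
Qed.

Variable l : {poly F}.
Hypotheses (l_irr : irreducible_poly l) (lal : root (map_poly jF l) al).

Lemma local_eval_prime :
  exists2 u, u \is a GRing.unit & local_eval (map_poly jF l) = fpsX k ^+ e * u.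
Proof.
have [l1 lE] := factor_theorem _ _ lal.
have := finField_irreducible_separable l_irr lal.
rewrite -(separable_map jF) lE separable_root => /andP [_ nl1].
exists (local_eval l1); first by rewrite fps_unitE local_eval_res unitfE.
by rewrite rmorphM /= local_evalXsubC mulrC.
Qed.

(** The exponent of [s] is [e] times the l-adic valuation, because [al] is a simple
    root of [l]. *)
Lemma local_eval_order f : f != 0 ->
  exists2 u, u \is a GRing.unit &
    local_eval (map_poly jF f) = fpsX k ^+ (e * polymult l f) * u.
Proof.
move=> f0; have [g fE ng] := polymultP l_irr.1 f0.
have [u uU lE] := local_eval_prime.
exists (local_eval (map_poly jF g) * u ^+ polymult l f).
  rewrite unitrM unitrX // andbT fps_unitE local_eval_res unitfE.
  by move: ng; rewrite -(root_irreducible g l_irr lal).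
by rewrite {1}fE !rmorphM !rmorphXn /= lE exprMn exprM; ring.
Qed.

Local Notation tf := (@FracField.tofrac (fps k)).

Lemma local_embedding :
  exists g : {rmorphism ratfun F -> {fraction fps k}},
    (forall f, g (ratfun_of f) = tf (local_eval (map_poly jF f))) /\
    (forall x, x != 0 -> exists u m n, [/\ u \is a GRing.unit,
       vadic l x = (m%:Z - n%:Z)%:E &
       g x * tf (fpsX k ^+ (e * n)) = tf (fpsX k ^+ (e * m) * u)]).
Proof.
have tf_inj : injective tf by move=> x y /eqP; rewrite tofrac_eq => /eqP.
pose h := tf \o (local_eval \o map_poly jF).
(* The kernel is trivial since nonzero polynomials have a finite order in [s]. *)
have h_inj : injective h.
  move=> x y /tf_inj /= exy; apply/eqP; rewrite -subr_eq0; apply: contraTT isT => xy0.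
  have [u uU] := local_eval_order xy0.
  rewrite rmorphB /= [local_eval _]rmorphB /= exy subrr => /esym/eqP.
  have : fpsX k ^+ (e * polymult l (x - y)) * u != 0.
    rewrite mulf_neq0 ?expf_neq0 //; last by apply: contraTneq uU => ->; rewrite unitr0.
    by apply/eqP => /fpsP /(_ 1%N) /eqP; rewrite /= oner_eq0.
  by move=> /negPf ->.
have [g gE] := fraction_lift h_inj.
exists g; split=> [f|x x0]; first exact: gE.
have [nu [de [de0 xE xV]]] := ratfun_num_den l x0.
have nu0 : nu != 0.
  apply: contraNneq de0 => nu0; have /eqP := xE.
  by rewrite nu0 rmorph0 mulf_eq0 (negPf x0) /= ratfun_of_eq0.
have [u uU uE] := local_eval_order nu0; have [v vU vE] := local_eval_order de0.
exists (u / v), (polymult l nu), (polymult l de).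
split=> //; first by rewrite unitrM uU unitrV.
have tv0 : tf v != 0 by rewrite tofrac_eq0; apply: contraTneq vU => ->; rewrite unitr0.
have := congr1 g xE; rewrite rmorphM !gE /= uE vE.
set y := g x; set s := fpsX k ^+ _; set t := fpsX k ^+ _ => yE.
apply: (mulIf tv0); rewrite -mulrA -!rmorphM yE; congr tf.
by rewrite -!mulrA mulVr ?mulr1.
Qed.

End Evaluation.

(** * Solutions with coefficients in the complete local ring *)

Lemma wronskian_map (A B : comUnitRingType) (frA : {rmorphism A -> A})
    (frB : {rmorphism B -> B}) (s : {rmorphism A -> B}) f g :
  (forall x, s (frA x) = frB (s x)) ->
  wronskian frB (map_fps s f) (map_fps s g) = map_fps s (wronskian frA f g).
Proof. by move=> sfr; rewrite /wronskian rmorphB !rmorphM /= !(map_fps_comm _ sfr). Qed.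

Lemma fps_fixed (F : finFieldType) (M : fieldType) (jF : {rmorphism F -> M})
    (fr : {rmorphism M -> M}) (c : fps M) : (forall x, fr x = x ^+ #|F|) ->
  map_fps fr c = c -> exists c0, c = map_fps jF c0.
Proof.
move=> frE cE; have /choice [c0 c0E] n : exists x, c$_n = jF x.
  by apply: frobenius_fixed; rewrite -frE -[in RHS]cE.
by exists (Fps c0); apply/fpsP => n; apply: c0E.
Qed.

Section LocalSolutions.
Variables (F : finFieldType) (k : fieldType) (jF : {rmorphism F -> k}).
Hypothesis kclosed : separably_closed k.
Local Notation q := #|F|.
Variables (frO : {rmorphism fps k -> fps k}).
Hypothesis frOE : forall x, frO x = x ^+ q.
Let q_gt1 : (1 < q)%N := finNzRing_gt1 F.

Lemma local_solve (c be ga y : fps k) : c \is a GRing.unit ->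
  exists x, c * x + be * frO x + ga * frO (frO x) = y.
Proof.
move=> cU; have c0 : c$_0 != 0 by rewrite -unitfE -fps_unitE.
have [x0 x0E] := additive_solve jF kclosed (be$_0) (ga$_0) (y$_0) c0.
by have [x _ xE] := additive_lift q_gt1 frOE cU x0E; exists x.
Qed.

(** The reduction of the additive polynomial has a nonzero root as soon as one of
    the higher coefficients survives; this root lifts and starts the solution. *)
Lemma local_solution (th be ga : fps k) : th \is a GRing.unit ->
  (be$_0 != 0) || (ga$_0 != 0) ->
  exists2 f, f \is a GRing.unit & tate_eq frO th be ga f.
Proof.
move=> thU bg; have th0 : th$_0 != 0 by rewrite -unitfE -fps_unitE.
have [x0 x00 x0E] := additive_nonzero_root jF kclosed th0 bg.
have [x xx0 xE] := additive_lift (y := 0) q_gt1 frOE thU x0E.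
have [f fE fx] := tate_eq_extend xE (fun y => local_solve be ga y thU).
by exists f; rewrite // !fps_unitE fx xx0 unitfE.
Qed.

Lemma local_artin_schreier y : exists x, frO x - x = y.
Proof.
have [|x xE] := @local_solve (-1) 1 0 y; first by rewrite unitrN unitr1.
by exists x; rewrite -xE mul0r addr0 mulN1r mul1r addrC.
Qed.

Lemma local_carlitz_solution (th : fps k) : th \is a GRing.unit ->
  exists2 W, W \is a GRing.unit & tate_eq frO th 1 0 W.
Proof. by move=> thU; apply: local_solution => //; rewrite fps_coef1 oner_eq0. Qed.

(** A unit solution together with a unit Carlitz solution as Wronskian gives a
    basis by reduction of order, so no torsion points have to be counted. *)
Lemma local_rank2_basis (th a : fps k) : th \is a GRing.unit ->
  exists f g, [/\ tate_eq frO th a (-1) f, tate_eq frO th a (-1) g &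
    wronskian frO f g \is a GRing.unit].
Proof.
move=> thU; have [|f fU fE] := @local_solution th a (-1) thU.
  by rewrite fps_coefN fps_coef1 oppr_eq0 oner_eq0 orbT.
have [W WU WE] := local_carlitz_solution thU.
have [xi [_ gE wE]] := companion_solution local_artin_schreier fU fE WE.
by exists f, (f * xi); rewrite wE.
Qed.

Variables (frk : {rmorphism k -> k}).
Hypothesis frkE : forall x, frk x = x ^+ q.

Let res_fr x : fps_res (frO x) = frk (fps_res x).
Proof. by rewrite frOE frkE rmorphXn. Qed.

(** Modulo [s] the equation of [w] degenerates to one of order one, and
    [reduced_coef_free] applies to the residues of the coefficients. *)
Lemma local_conductor_coef (th u de : fps k) w W :
  th \is a GRing.unit -> u$_0 != 0 -> de$_0 = 0 ->
  w \is a GRing.unit -> W \is a GRing.unit ->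
  tate_eq frO th u de w -> tate_eq frO th 1 0 W ->
  forall n (c : nat -> F), (exists2 i, (i < n)%N & c i != 0) ->
  \sum_(i < n) fpsC (jF (c i)) * (W / (w * map_fps frO w))$_i \is a GRing.unit.
Proof.
move=> thU u0 de0 wU WU wE WE n c [i lt_in ci]; rewrite fps_unitE unitfE.
pose W1 := map_fps (@fps_res k) W; pose w1 := map_fps (@fps_res k) w.
have W1U : W1 \is a GRing.unit by apply: rmorph_unit.
have w1U : w1 \is a GRing.unit by apply: rmorph_unit.
have w1E : tate_eq frk (fps_res th) (fps_res u) 0 w1.
  by rewrite -[X in tate_eq _ _ _ X]de0; apply: (tate_eq_map res_fr wE).
have W1E : tate_eq frk (fps_res th) 1 0 W1.
  by have := tate_eq_map res_fr WE; rewrite rmorph1 rmorph0.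
have gE := reduced_quotient_eq w1U w1E W1E.
have twE : map_fps (@fps_res k) (map_fps frO w) = map_fps frk w1.
  exact: (map_fps_comm _ res_fr).
have rE j : fps_res (W / (w * map_fps frO w))$_j = (W1 / (w1 * map_fps frk w1))$_j.
  rewrite -[LHS]/((map_fps (@fps_res k) (W / (w * map_fps frO w)))$_j).
  rewrite rmorph_div ?rmorphM /= ?twE // unitrM wU; exact: rmorph_unit.
apply/negP => /eqP c0; case/negP: ci; apply/eqP.
apply: (reduced_coef_free (fr := frk) (jF := jF) _ _ _ gE (n := n)) lt_in.
- by move=> x; rewrite frkE frobenius_const.
- by rewrite mulf_neq0 // fmorph_eq0.
- have : W1 / (w1 * map_fps frk w1) \is a GRing.unit.
    rewrite unitrM W1U unitrV unitrM w1U; exact: rmorph_unit.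
  by rewrite fps_unitE unitfE.
- rewrite -[RHS]c0 fps_coef_sum; apply: eq_bigr => j _.
  by rewrite fps_coefCM -rE.
Qed.

End LocalSolutions.

(** * Good and degenerate reduction *)

Section LocalField.
Variables (F : finFieldType) (k : fieldType) (jF : {rmorphism F -> k}).
Hypothesis kclosed : separably_closed k.
Local Notation q := #|F|.
Variables (frO : {rmorphism fps k -> fps k}) (frk : {rmorphism k -> k}).
Hypothesis frOE : forall x, frO x = x ^+ q.
Hypothesis frkE : forall x, frk x = x ^+ q.
Variables (M : fieldType) (tf : {rmorphism fps k -> M}) (fr : {rmorphism M -> M}).
Hypothesis frE : forall x, fr x = x ^+ q.
Hypothesis tf_eq0 : forall x, (tf x == 0) = (x == 0).
Hypothesis no_as_root : forall p N h eta, (1 < p)%N -> ~~ (p %| N)%N -> h \is a GRing.unit ->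
  (eta ^+ p - eta) * tf (fpsX k ^+ N) != tf h.

Let q_gt1 : (1 < q)%N := finNzRing_gt1 F.
Let jM : {rmorphism F -> M} := tf \o (@fpsC k \o jF).

Let tf_fr x : tf (frO x) = fr (tf x).
Proof. by rewrite frOE frE rmorphXn. Qed.

Lemma local_integral_basis (th a : fps k) : th \is a GRing.unit ->
  exists f g, [/\ tate_eq fr (tf th) (tf a) (-1) f, tate_eq fr (tf th) (tf a) (-1) g &
    wronskian fr f g \is a GRing.unit].
Proof.
move=> thU; have [f [g [fE gE wU]]] := local_rank2_basis jF kclosed frOE a thU.
exists (map_fps tf f), (map_fps tf g); rewrite -(rmorphN1 tf).
split; try exact: (tate_eq_map tf_fr).
rewrite (wronskian_map _ _ tf_fr); exact: rmorph_unit.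
Qed.

(** Carlitz solutions are unique up to a factor in [F_q[[t]]], and one of them is
    integral. *)
Lemma local_carlitz_integral (th : fps k) W : th \is a GRing.unit ->
  tate_eq fr (tf th) 1 0 W -> W$_0 != 0 ->
  exists W', [/\ W' \is a GRing.unit, tate_eq frO th 1 0 W' & W = map_fps tf W'].
Proof.
move=> thU WE W0; have [V VU VE] := local_carlitz_solution jF kclosed frOE thU.
have VE' : tate_eq fr (tf th) 1 0 (map_fps tf V).
  by have := tate_eq_map tf_fr VE; rewrite rmorph1 rmorph0.
have VU' : map_fps tf V \is a GRing.unit by apply: rmorph_unit.
have thU' : tf th \is a GRing.unit by apply: rmorph_unit.
have [c cE] := fps_fixed jM frE (carlitz_ratio_fixed thU' VU' VE' WE).
pose c' := map_fps (@fpsC k \o jF) c.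
have WV : W = map_fps tf (V * c').
  rewrite rmorphM /= -[W](divrK VU') cE mulrC; congr (_ * _); exact/fpsP.
have c0 : c$_0 != 0.
  apply: contraNneq W0 => c0; rewrite WV -[_$_0]/(tf (V * c')$_0) fps_coef0M.
  by rewrite -[c'$_0]/(fpsC (jF c$_0)) c0 !rmorph0 mulr0 rmorph0.
exists (V * c'); split=> //.
  rewrite unitrM VU fps_unitE; apply: rmorph_unit; rewrite unitfE //.
apply: tate_eqM => //; apply/fpsP => n /=.
rewrite frOE -rmorphXn frobenius_const //.
Qed.

(** Rescaling by [s^m] turns [th + b tau - tau^2] into the integral module
    [th + u tau - s^(m (q^2 - 1)) tau^2], whose reduction has rank 1.  The unit
    solution of the latter, multiplied by [s^m], is [w]; its scaling is what gives
    the quotient [W / (w w')] a pole of order [m (q + 1)], prime to [p]. *)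
Lemma local_degenerate_solution (th u : fps k) m b :
  th \is a GRing.unit -> u \is a GRing.unit -> (0 < m)%N -> coprime q m ->
  b * tf (fpsX k ^+ (q.-1 * m)) = tf u ->
  exists w, [/\ tate_eq fr (tf th) b (-1) w, w$_0 != 0 &
    forall W, tate_eq fr (tf th) 1 0 W -> W$_0 != 0 ->
    forall p n (c : nat -> F) (eta : M), prime p -> p \in [pchar F] ->
      (exists2 i, (i < n)%N & c i != 0) ->
      eta ^+ p - eta != \sum_(i < n) jM (c i) * (W / (w * map_fps fr w))$_i].
Proof.
move=> thU uU m_gt0 qm bE.
have qq_gt1 : (1 < q * q)%N by rewrite (leq_trans q_gt1) // leq_pmulr // ltnW.
(* [s^N] is the leading coefficient of the rescaled module up to sign. *)
pose N := (m * (q * q).-1)%N.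
have N_gt0 : (0 < N)%N by rewrite muln_gt0 m_gt0 -ltnS prednK // ltnW.
have u0 : u$_0 != 0 by rewrite -unitfE -fps_unitE.
have de0 : (- fpsX k ^+ N)$_0 = 0.
  by rewrite fps_coefN fps_coef0X /= expr0n gtn_eqF // oppr0.
have [|w1 w1U w1E] := local_solution jF kclosed frOE (be := u) (ga := - fpsX k ^+ N) thU.
  by rewrite u0.
pose la := tf (fpsX k ^+ m).
have X0 : fpsX k != 0 by apply/eqP => /fpsP /(_ 1%N) /eqP; rewrite /= oner_eq0.
have la0 : la != 0 by rewrite tf_eq0 expf_neq0.
have w1E' := tate_eq_map tf_fr w1E.
pose w := fpsC la * map_fps tf w1.
have wE : tate_eq fr (tf th) b (-1) w.
  apply: tate_eq_scale w1E'; rewrite /la !frE.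
    rewrite -bE mulrCA; congr (_ * _); rewrite -!rmorphXn -rmorphM; congr (tf _).
    rewrite -!exprM -exprD; congr (_ ^+ _).
    by rewrite mulnC -[LHS]mulnC -{1}(ltn_predK q_gt1); lia.
  rewrite rmorphN mulrN mulN1r; congr (- _); rewrite -!rmorphXn -rmorphM; congr (tf _).
  rewrite -!exprM -exprD; congr (_ ^+ _); rewrite /N -{2}[m]muln1 -mulnDr add1n prednK //.
  exact: ltnW.
have w1U' : map_fps tf w1 \is a GRing.unit by apply: rmorph_unit.
exists w; split=> // [|W WE W0 p n c eta p_pr pF cn0].
  rewrite fps_coefCM mulf_neq0 //; have := w1U'; by rewrite fps_unitE unitfE.
have [V [VU VE ->]] := local_carlitz_integral thU WE W0.
have hU := local_conductor_coef jF frOE frkE thU u0 de0 w1U VU w1E VE cn0.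
(* [p] divides [q], so it divides neither [q + 1] nor [m]. *)
have pN : ~~ (p %| m * q.+1)%N.
  have [p' [d [p'_pr p'F d_gt0 qE]]] := card_prime_power F.
  have pq : (p %| q)%N.
    by move: pF; rewrite (pcharf_eq p'F) inE => /eqP ->; rewrite qE dvdn_exp.
  rewrite Euclid_dvdM // negb_or; apply/andP; split.
    apply/negP => pm; have : (p %| gcdn q m)%N by rewrite dvdn_gcd pq.
    by rewrite (eqP qm) dvdn1 => /eqP p1; rewrite p1 in p_pr.
  by rewrite -addn1 dvdn_addr // dvdn1; apply: contraTneq p_pr => ->.
apply: contraNneq (no_as_root eta (prime_gt1 p_pr) pN hU) => ->; apply/eqP.
rewrite mulr_suml rmorph_sum /=; apply: eq_bigr => i _.
rewrite [RHS]rmorphM -mulrA; congr (_ * _).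
have twE : map_fps fr w = fpsC (la ^+ q) * map_fps tf (map_fps frO w1).
  by rewrite rmorphM /= map_fpsC frE (map_fps_comm _ tf_fr).
pose g := V / (w1 * map_fps frO w1).
have frw1U : map_fps frO w1 \is a GRing.unit by apply: rmorph_unit.
have laU : fpsC (la ^+ q.+1) \is a GRing.unit by rewrite fps_unitE unitfE expf_neq0.
have gE : map_fps tf V / (w * map_fps fr w) = fpsC (la ^+ q.+1)^-1 * map_fps tf g.
  have ww : w * map_fps fr w = fpsC (la ^+ q.+1) * map_fps tf (w1 * map_fps frO w1).
    by rewrite twE /w exprS !rmorphM /=; ring.
  have tfU : map_fps tf (w1 * map_fps frO w1) \is a GRing.unit.
    by apply: rmorph_unit; rewrite unitrM w1U.
  rewrite ww; have U2 : fpsC (la ^+ q.+1) * map_fps tf (w1 * map_fps frO w1) \is a GRing.unit.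
    by rewrite unitrM laU.
  apply: (mulIr U2); rewrite divrK // mulrACA -rmorphM mulVf ?expf_neq0 // rmorph1 mul1r.
  by rewrite -rmorphM divrK // unitrM w1U.
have gEi : (map_fps tf V / (w * map_fps fr w))$_i = (la ^+ q.+1)^-1 * tf g$_i.
  by rewrite gE fps_coefCM.
transitivity ((la ^+ q.+1)^-1 * tf g$_i * la ^+ q.+1).
  by congr (_ * _) => //; rewrite exprM rmorphXn.
by rewrite mulrAC mulVf ?mul1r // expf_neq0.
Qed.

End LocalField.

(** * The local input at the prime l *)

Lemma finField_closure (F : finFieldType) :
  exists (k : fieldType) (jF : {rmorphism F -> k}),
    forall p : {poly k}, (1 < size p)%N -> exists x, root p x.
Proof.
have [k [jF _]] := countable_algebraic_closure F.
by exists k, jF => p szp; apply/closed_rootP; rewrite gtn_eqF.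
Qed.

Lemma local_field_embedding (F : finFieldType) (k : fieldType) (jF : {rmorphism F -> k})
    (al : k) (e : nat) (l : {poly F}) : (0 < e)%N -> irreducible_poly l ->
  root (map_poly jF l) al ->
  exists (M : fieldType) (tf : {rmorphism fps k -> M}) (g : {rmorphism ratfun F -> M}),
  [/\ forall x, (tf x == 0) = (x == 0),
   forall p N h eta, (1 < p)%N -> ~~ (p %| N)%N -> h \is a GRing.unit ->
     (eta ^+ p - eta) * tf (fpsX k ^+ N) != tf h,
   forall f, g (ratfun_of f) = tf (local_eval al e (map_poly jF f)) &
   forall x, x != 0 -> exists u m n, [/\ u \is a GRing.unit,
     vadic l x = (m%:Z - n%:Z)%:E &
     g x * tf (fpsX k ^+ (e * n)) = tf (fpsX k ^+ (e * m) * u)]].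
Proof.
move=> e_gt0 l_irr lal; have [g [gE gV]] := local_embedding e_gt0 l_irr lal.
exists {fraction fps k}, (@FracField.tofrac (fps k)), g; split=> //.
  exact: tofrac_eq0.
by move=> p N h eta p_gt1; apply: no_artin_schreier_root.
Qed.

(** Everything that is needed from the prime [l], for an extension [M] of [K]: all
    solutions for the first module, one solution [w] for the second, and the
    impossibility of the Artin-Schreier equations attached to [w]. *)
Lemma local_tate_solutions (F : finFieldType) (a b : ratfun F) (l : {poly F})
    (hl : irreducible_poly l) (hltheta : ~~ (l %= 'X))
    (hla : (0 <= vadic l a)%E) (hlb : (vadic l b < 0)%E)
    (hlgcd : gcdz #|F|%:Z (fine (vadic l b)) = 1) :
  exists (M : fieldType) (g : {rmorphism ratfun F -> M}) (fr : {rmorphism M -> M}),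
  [/\ forall x, fr x = x ^+ #|F|,
   exists f1 f2, [/\ tate_eq fr (g (theta F)) (g a) (-1) f1,
     tate_eq fr (g (theta F)) (g a) (-1) f2 & wronskian fr f1 f2 \is a GRing.unit] &
   exists w, [/\ tate_eq fr (g (theta F)) (g b) (-1) w, w$_0 != 0 &
     forall W, tate_eq fr (g (theta F)) 1 0 W -> W$_0 != 0 ->
     forall p n (c : nat -> F) (eta : M), prime p -> p \in [pchar F] ->
      (exists2 i, (i < n)%N & c i != 0) ->
      eta ^+ p - eta != \sum_(i < n) g (ratfun_of (c i)%:P) * (W / (w * map_fps fr w))$_i]].
Proof.
have q_gt1 := finNzRing_gt1 F.
have [k [jF kclosed]] := finField_closure F.
have kclosed' : separably_closed k by move=> p _; apply: kclosed.
have [al lal] : exists al, root (map_poly jF l) al.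
  by apply: kclosed; rewrite size_map_poly; apply: hl.1.
have al0 : al != 0.
  apply: contraNneq hltheta => al0; rewrite al0 -(rmorph0 jF) in lal.
  have : root l 0 by rewrite -(fmorph_root jF).
  rewrite -dvdp_XsubCl subr0 => /hl.2; rewrite size_polyX => /(_ isT).
  by rewrite eqp_sym.
have e_gt0 : (0 < #|F|.-1)%N by rewrite -ltnS prednK // ltnW.
have [M [tf [g [tf_eq0 no_as_root gE gV]]]] := local_field_embedding e_gt0 hl lal.
have [frO frOE] := frobenius_morphism (@fpsC k \o jF).
have [frk frkE] := frobenius_morphism jF.
have [fr frE] := frobenius_morphism (g \o (@ratfun_of F \o @polyC F)).
have thE : g (theta F) = tf (local_theta al #|F|.-1) by rewrite gE map_polyX local_evalX.
have thU : local_theta al #|F|.-1 \is a GRing.unit.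
  by rewrite fps_unitE local_theta_res // unitfE.
have tfX n : tf (fpsX k ^+ n) != 0.
  by rewrite tf_eq0 expf_neq0 //; apply/eqP => /fpsP /(_ 1%N) /eqP; rewrite /= oner_eq0.
have [a' aE] : exists a', g a = tf a'.
  have [->|a0] := eqVneq a 0; first by exists 0; rewrite !rmorph0.
  have [u [m [n [uU va ga]]]] := gV _ a0; rewrite va lee_fin subr_ge0 lez_nat in hla.
  exists (fpsX k ^+ (#|F|.-1 * (m - n)) * u); apply: (mulIf (tfX (#|F|.-1 * n)%N)).
  by rewrite ga -rmorphM mulrAC -exprD -mulnDr subnK.
have b0 : b != 0 by apply: contraTneq hlb => ->; rewrite /vadic eqxx.
have [u [m [n [uU vb gb]]]] := gV _ b0.
rewrite vb lte_fin subr_lt0 ltz_nat in hlb.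
rewrite vb [fine _]/= in hlgcd.
have cop : coprime #|F| (n - m).
  have -> : (n - m)%N = `|m%:Z - n%:Z|%N by rewrite distnEr // ltnW.
  by apply/eqP; have := congr1 absz hlgcd.
have bE : g b * tf (fpsX k ^+ (#|F|.-1 * (n - m))) = tf u.
  apply: (mulIf (tfX (#|F|.-1 * m)%N)); rewrite -mulrA -!rmorphM -exprD -mulnDr.
  by rewrite subnK 1?ltnW // gb mulrC.
exists M, g, fr; split=> //.
  by rewrite thE aE; apply: (local_integral_basis jF kclosed' frOE tf frE).
have nm_gt0 : (0 < n - m)%N by rewrite subn_gt0.
have [w [wE w0 wP]] := local_degenerate_solution jF kclosed' frOE frkE frE tf_eq0 no_as_root
  thU uU nm_gt0 cop bE.
exists w; split=> // [|W WE W0 p d c eta p_pr pF cn0]; first by rewrite thE.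
rewrite thE in WE; have := wP W WE W0 p d c eta p_pr pF cn0.
apply: contraNneq => ->; apply/eqP; apply: eq_bigr => i _; congr (_ * _).
rewrite gE map_polyC /=; congr (tf _).
by rewrite /local_eval /= map_polyC /horner_eval hornerC.
Qed.

(** * Torsion points as coefficients of solutions *)

Section TwistedEvaluation.
Variables (F : finFieldType) (L : fieldType) (iota : {rmorphism ratfun F -> L}).
Variable fr : {rmorphism L -> L}.
Hypothesis frE : forall x, fr x = x ^+ #|F|.

Definition const_emb : {rmorphism F -> L} := iota \o (@ratfun_of F \o @polyC F).

Lemma fr_const c : fr (const_emb c) = const_emb c.
Proof. by rewrite frE frobenius_const. Qed.

Lemma iter_frE n x : iter n fr x = x ^+ (#|F| ^ n).
Proof. by elim: n => [|n IHn]; rewrite ?expr1 //= IHn frE -exprM expnSr. Qed.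

Lemma iter_fr_zmod n : zmod_morphism (iter n fr).
Proof. by move=> x y; elim: n => //= n ->; rewrite rmorphB. Qed.
Lemma iter_fr_monoid n : monoid_morphism (iter n fr).
Proof.
split=> [|x y]; first by elim: n => //= n ->; rewrite rmorph1.
by elim: n => //= n ->; rewrite rmorphM.
Qed.
HB.instance Definition _ n := GRing.isZmodMorphism.Build L L (iter n fr) (iter_fr_zmod n).
HB.instance Definition _ n := GRing.isMonoidMorphism.Build L L (iter n fr) (iter_fr_monoid n).

Lemma tw_eval_widen n (u : twisted F) x : (size (twpoly u) <= n)%N ->
  tw_eval iota u x = \sum_(i < n) iota (tw_coef u i) * iter i fr x.
Proof.
move=> le_n; rewrite -(big_mkord xpredT (fun i => iota (tw_coef u i) * iter i fr x)).
rewrite (big_cat_nat _ le_n) //= [X in _ + X]big_nat_cond [X in _ + X]big1.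
  by rewrite addr0 big_mkord; apply: eq_bigr => i _; rewrite iter_frE.
by move=> i; rewrite andbT => /andP [le_i _]; rewrite /tw_coef nth_default // rmorph0 mul0r.
Qed.

Lemma tw_evalD u v x : tw_eval iota (u + v) x = tw_eval iota u x + tw_eval iota v x.
Proof.
pose n := maxn (size (twpoly u)) (size (twpoly v)).
rewrite (@tw_eval_widen n (u + v)) ?size_polyD //.
rewrite (@tw_eval_widen n u) ?leq_maxl // (@tw_eval_widen n v) ?leq_maxr //.
by rewrite -big_split; apply: eq_bigr => i _; rewrite tw_coefD rmorphD mulrDl.
Qed.

Lemma tw_evalZ (c : F) u x : tw_eval iota (c *: u) x = const_emb c * tw_eval iota u x.
Proof.
rewrite (@tw_eval_widen (size (twpoly u)) (c *: u)) ?size_scale_leq //.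
rewrite (@tw_eval_widen (size (twpoly u)) u) // mulr_sumr.
by apply: eq_bigr => i _; rewrite tw_coefZ rmorphM mulrA.
Qed.

Lemma tw_eval0 x : tw_eval iota 0 x = 0.
Proof. by rewrite -(scale0r (0 : twisted F)) tw_evalZ rmorph0 mul0r. Qed.

Lemma tw_eval1 x : tw_eval iota 1 x = x.
Proof.
rewrite (@tw_eval_widen 1 1) ?size_poly1 // big_ord1 /=.
by rewrite (tw_coef1 F) rmorph1 mul1r.
Qed.

(** Multiplication of twisted polynomials is composition of additive polynomials. *)
Lemma tw_evalM u v x : tw_eval iota (u * v) x = tw_eval iota u (tw_eval iota v x).
Proof.
pose n := (size (twpoly u) + size (twpoly v))%N.
rewrite (@tw_eval_widen n (u * v)) ?size_poly //.
rewrite (@tw_eval_widen n u) ?leq_addr // (@tw_eval_widen n v) ?leq_addl //.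
pose T j i := iota (tw_coef u j) * (iter j fr (iota (tw_coef v i)) * iter (j + i) fr x).
transitivity (\sum_(m < n) \sum_(j < n | (j <= m)%N) T j (m - j)%N).
  apply: eq_bigr => m _; rewrite (tw_coefM u v) rmorph_sum mulr_suml.
  rewrite -(big_ord_widen n (fun j => T j (m - j)%N) (ltn_ord m)).
  apply: eq_bigr => j _; rewrite /T subnKC -1?ltnS // rmorphM -mulrA.
  by congr (_ * (_ * _)); rewrite iter_frE -rmorphXn.
rewrite (exchange_big_dep predT) //=; apply: eq_bigr => j _.
rewrite rmorph_sum mulr_sumr.
rewrite -(big_geq_mkord j n xpredT (fun m => T j (m - j)%N)).
rewrite -{1}[nat_of_ord j]add0n big_addn.
transitivity (\sum_(0 <= i < n) T j i); last first.
  rewrite big_mkord; apply: eq_bigr => i _.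
  by rewrite /T iterD rmorphM.
rewrite [RHS](big_cat_nat (leq0n _) (leq_subr j n)) //= [X in _ = _ + X]big_nat_cond.
rewrite [X in _ = _ + X]big1 ?addr0 => [|i]; last first.
  rewrite andbT => /andP [le_i _]; rewrite /T.
  have [lt_j|le_j] := ltnP j (size (twpoly u)); last first.
    by rewrite /tw_coef nth_default // rmorph0 mul0r.
  have -> : tw_coef v i = 0.
    rewrite /tw_coef nth_default //; apply: leq_trans le_i.
    move: lt_j; rewrite /n; move: (nat_of_ord j) => m lt_m.
    by rewrite addnC -addnBA ?leq_addr // ltnW.
  by rewrite rmorph0 [iter j fr 0]rmorph0 mul0r mulr0.
by apply: eq_bigr => i _; rewrite addnK.
Qed.

End TwistedEvaluation.

Section Dictionary.
Variables (F : finFieldType) (L : fieldType) (iota : {rmorphism ratfun F -> L}).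
Variable fr : {rmorphism L -> L}.
Hypothesis frE : forall x, fr x = x ^+ #|F|.
Variables (r : nat) (phi : drinfeld_module F r).
Local Notation act := (drin_act iota phi).
Local Notation cF := (const_emb iota).

Lemma drin_actD f g x : act (f + g) x = act f x + act g x.
Proof. by rewrite /drin_act rmorphD; apply: tw_evalD. Qed.

Lemma drin_actZ (c : F) f x : act (c *: f) x = cF c * act f x.
Proof. by rewrite /drin_act linearZ; apply: tw_evalZ. Qed.

Lemma drin_act0 x : act 0 x = 0.
Proof. by rewrite /drin_act rmorph0; apply: tw_eval0. Qed.

Lemma drin_act1 x : act 1 x = x.
Proof. by rewrite /drin_act rmorph1; apply: tw_eval1. Qed.

Lemma drin_actC (c : F) x : act c%:P x = cF c * x.
Proof. by rewrite -[c%:P]mulr1 mul_polyC drin_actZ drin_act1. Qed.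

Lemma drin_actM f g x : act (f * g) x = act f (act g x).
Proof. by rewrite /drin_act rmorphM; apply: tw_evalM. Qed.

Lemma drin_act_iter n x : act 'X^n x = iter n (act 'X) x.
Proof.
elim: n x => [|n IHn] x; first by rewrite expr0 drin_act1.
by rewrite exprS drin_actM IHn.
Qed.

Lemma drin_act_poly n (c : nat -> F) x :
  act (\poly_(i < n) c i) x = \sum_(i < n) cF (c i) * iter i (act 'X) x.
Proof.
rewrite poly_def; elim: n => [|n IHn]; first by rewrite !big_ord0 drin_act0.
by rewrite !big_ord_recr drin_actD IHn drin_actZ drin_act_iter.
Qed.

Variables (be ga : L).
Hypothesis actX : forall x, act 'X x = iota (theta F) * x + be * fr x + ga * fr (fr x).
Local Notation sol := (tate_eq fr (iota (theta F)) be ga).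

(** Shifted by one, since the term of index 0 of a Tate sequence is 0. *)
Definition gen_series (x : nat -> L) : fps L := Fps (fun n => x n.+1).
Definition ungen_series (f : fps L) (n : nat) : L := if n is m.+1 then f$_m else 0.

Lemma tate0 x : tate iota phi x -> x 0%N = 0.
Proof. by move=> [/(_ 0%N) + _]; rewrite /torsion /= expr0 drin_act1. Qed.

Lemma tate_sol x : tate iota phi x -> sol (gen_series x).
Proof.
move=> tx; apply/tate_eqP => n; have [_ tX] := tx.
by rewrite -[LHS]actX tX; case: n => //=; apply: tate0.
Qed.

Lemma act_ungen f n : sol f -> act 'X (ungen_series f n.+1) = ungen_series f n.
Proof. by move=> /tate_eqP fE; rewrite actX fE. Qed.

Lemma iter_act_ungen f m n : sol f -> (m <= n)%N ->
  iter m (act 'X) (ungen_series f n) = ungen_series f (n - m).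
Proof.
move=> fE; elim: m n => [|m IHm] n; first by rewrite subn0.
case: n => // n; rewrite ltnS => le_mn.
by rewrite iterSr act_ungen // IHm // subSS.
Qed.

Lemma ungen_tate f : sol f -> tate iota phi (ungen_series f).
Proof.
move=> fE; split=> k; last exact: act_ungen.
by rewrite /torsion /= drin_act_iter iter_act_ungen // subnn.
Qed.

Lemma ungenK f : gen_series (ungen_series f) = f.
Proof. exact/fpsP. Qed.

Lemma genK x : tate iota phi x -> ungen_series (gen_series x) = x.
Proof. by move=> tx; apply/funext => -[|n] //=; rewrite tate0. Qed.

(** The action of [F_q[[t]]] on the Tate module becomes multiplication, which is
    the reason for working with generating series. *)
Lemma tate_scale_gen f x : tate iota phi x ->
  gen_series (tate_scale iota phi f x) = map_fps cF f * gen_series x.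
Proof.
move=> tx; apply/fpsP => n; rewrite fps_coefM /= /tate_scale drin_act_poly.
apply: eq_bigr => i _; congr (_ * _).
rewrite -{1}(genK tx) iter_act_ungen; [|exact: tate_sol|by rewrite ltnW].
by rewrite subSn // -ltnS.
Qed.

Lemma tate_comb_gen e c : (forall i, tate iota phi (e i)) ->
  gen_series (tate_comb iota phi e c) =
    \sum_i map_fps cF (c i 0) * gen_series (e i).
Proof.
move=> te; under eq_bigr => i _ do rewrite -tate_scale_gen //.
by apply/fpsP => n; rewrite fps_coef_sum.
Qed.

Lemma tate_comb0 e c : tate_comb iota phi e c 0%N = 0.
Proof.
rewrite /tate_comb big1 // => i _; rewrite /tate_scale poly_def big_ord0.
exact: drin_act0.
Qed.

(** A torsion point is pushed down by the action of [t] and lifted up along chosen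
    preimages to a full Tate sequence. *)
Lemma torsion_sol k x : (0 < k)%N -> (forall y, exists z, act 'X z = y) ->
  torsion iota phi 'X^k x -> exists2 f, sol f & f$_k.-1 = x.
Proof.
case: k => // k _ /choice [inv invP]; rewrite /torsion /= drin_act_iter => xk.
pose f n := if (n <= k)%N then iter (k - n) (act 'X) x else iter (n - k) inv x.
exists (Fps f); last by rewrite /= /f leqnn subnn.
apply/tate_eqP => n; rewrite -actX /= /f.
case: n => [|n]; first by rewrite leq0n subn0.
have [lt_nk|le_kn] := ltnP n k.
  by rewrite (ltnW lt_nk) -(subnSK lt_nk).
rewrite subSn //= invP; move: le_kn; rewrite leq_eqVlt => /orP [/eqP <-|lt_kn].
  by rewrite leqnn subnn.
by rewrite leqNgt lt_kn.
Qed.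

Lemma sol_torsion f k : sol f -> torsion iota phi 'X^(k.+1) f$_k.
Proof. by move=> fE; have [/(_ k.+1)] := ungen_tate fE. Qed.

End Dictionary.

(** * Generation of SL_2 over a local ring *)

Lemma sum_ord2 (V : nmodType) (f : 'I_2 -> V) : \sum_i f i = f 0 + f 1.
Proof.
rewrite !big_ord_recl big_ord0 addr0; congr (f _ + f _); exact: val_inj.
Qed.

Lemma ord2P (P : 'I_2 -> Prop) : P 0 -> P 1 -> forall i, P i.
Proof.
move=> P0 P1 [[|[|//]] lt_i].
  by rewrite (_ : Ordinal lt_i = 0) //; apply: val_inj.
by rewrite (_ : Ordinal lt_i = 1) //; apply: val_inj.
Qed.

Section Matrix2.
Variable R : comUnitRingType.
Implicit Types (M N : 'M[R]_2) (u v : R).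

Definition mx2 (p q r s : R) : 'M[R]_2 :=
  \matrix_(i, j) (if i == 0 then (if j == 0 then p else q)
                  else (if j == 0 then r else s)).

Lemma mx2_eta M : M = mx2 (M 0 0) (M 0 1) (M 1 0) (M 1 1).
Proof.
by apply/matrixP; apply: ord2P => j; move: j; apply: ord2P; rewrite mxE.
Qed.

Lemma mx2M p q r s p' q' r' s' : mx2 p q r s *m mx2 p' q' r' s' =
  mx2 (p * p' + q * r') (p * q' + q * s') (r * p' + s * r') (r * q' + s * s').
Proof.
by apply/matrixP; apply: ord2P; apply: ord2P; rewrite !mxE sum_ord2 !mxE.
Qed.

Lemma det_mx2 p q r s : \det (mx2 p q r s) = p * s - q * r.
Proof.
rewrite (expand_det_row _ 0) sum_ord2 /cofactor !det_mx11 !mxE /=; ring.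
Qed.

Lemma mx2_1 : 1%:M = mx2 1 0 0 1.
Proof. by apply/matrixP; apply: ord2P; apply: ord2P; rewrite !mxE. Qed.

Lemma mx2_inj p q r s p' q' r' s' : mx2 p q r s = mx2 p' q' r' s' ->
  [/\ p = p', q = q', r = r' & s = s'].
Proof.
move=> /matrixP e; split;
  by [have := e 0 0; rewrite !mxE|have := e 0 1; rewrite !mxE|
      have := e 1 0; rewrite !mxE|have := e 1 1; rewrite !mxE].
Qed.

Definition upper_unipotent u := mx2 1 u 0 1.
Definition lower_unipotent v := mx2 1 0 v 1.

(** Conjugation by [G] moves the line fixed by the unipotents to the line spanned by
    the first column of [G]; as [G 1 0] is a unit, an upper unipotent takes it to
    the second coordinate axis. *)
Lemma lower_of_conjugate G G' v : G *m G' = 1%:M -> G 1 0 \is a GRing.unit ->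
  exists x u, lower_unipotent v =
    upper_unipotent (- x) *m (G *m upper_unipotent u *m G') *m upper_unipotent x.
Proof.
move=> GG' cU; have G'G := mulmx1C GG'.
rewrite [G]mx2_eta [G']mx2_eta /upper_unipotent /lower_unipotent !mx2M in GG' G'G *.
move: GG' G'G cU; rewrite mx2_1.
move: (G 0 0) (G 0 1) (G 1 0) (G 1 1) (G' 0 0) (G' 0 1) (G' 1 0) (G' 1 1).
move=> a b c d a' b' c' d' /mx2_inj [e1 e2 e3 e4] /mx2_inj [h1 h2 h3 h4] cU.
(* The slope of the line spanned by the first column of [G]. *)
pose x := a / c.
have xc : x * c = a by rewrite divrK.
have d'E : d' = - (c' * x).
  apply: (mulIr cU); rewrite mulNr -mulrA xc.
  by apply/eqP; rewrite -addr_eq0 addrC h3.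
have c'U : c' * (b - x * d) = 1.
  by rewrite -h4 d'E; ring.
exists x, (v * (b - x * d) / c).
set u := v * (b - x * d) / c.
have cuc : c * u * c' = v.
  by rewrite [c * u]mulrC /u divrK // -[RHS]mulr1 -c'U; ring.
have aE : a * u * c' = x * v by rewrite -xc -cuc; ring.
have GU : mx2 a b c d *m mx2 1 u 0 1 = mx2 a (a * u + b) c (c * u + d).
  by rewrite mx2M; congr mx2; ring.
rewrite GU !mx2M.
have E1 : a * a' + (a * u + b) * c' = 1 + x * v by rewrite -e1 -aE; ring.
have E2 : a * b' + (a * u + b) * d' = - (x * v * x).
  transitivity (a * b' + b * d' + a * u * d'); first by ring.
  by rewrite e2 add0r d'E mulrN mulrA aE.
have E3 : c * a' + (c * u + d) * c' = v.
  transitivity (c * a' + d * c' + c * u * c'); first by ring.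
  by rewrite e3 add0r cuc.
have E4 : c * b' + (c * u + d) * d' = 1 - v * x.
  transitivity (c * b' + d * d' + c * u * d'); first by ring.
  by rewrite e4 d'E mulrN mulrA cuc.
by rewrite E1 E2 E3 E4; congr mx2; ring.
Qed.

(** When the lower left entry [r] is a unit, [M] is a product of an upper, a lower
    and an upper unipotent.  Over a local ring one row operation makes [r] a unit. *)
Lemma SL2_generated (S : 'M[R]_2 -> Prop) :
  (forall x y : R, x + y \is a GRing.unit -> (x \is a GRing.unit) || (y \is a GRing.unit)) ->
  (forall M N, S M -> S N -> S (M *m N)) ->
  (forall u, S (upper_unipotent u)) -> (forall v, S (lower_unipotent v)) ->
  forall M, \det M = 1 -> S M.
Proof.
move=> loc SM SU SL.
have main M : \det M = 1 -> M 1 0 \is a GRing.unit -> S M.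
  rewrite [M]mx2_eta det_mx2 !mxE /=.
  move: (M 0 0) (M 0 1) (M 1 0) (M 1 1) => p q r s det1 rU.
  have -> : mx2 p q r s =
      upper_unipotent ((p - 1) / r) *m lower_unipotent r *m upper_unipotent ((s - 1) / r).
    have er : (p - 1) / r * r = p - 1 by rewrite divrK.
    have es : r * ((s - 1) / r) = s - 1 by rewrite mulrC divrK.
    (* The product of three unipotents, before [x] and [y] are chosen so that the
       diagonal entries become [p] and [s]. *)
    have prod x y : upper_unipotent x *m lower_unipotent r *m upper_unipotent y =
        mx2 (1 + x * r) ((1 + x * r) * y + x) r (r * y + 1).
      by rewrite /upper_unipotent /lower_unipotent !mx2M; congr mx2; ring.
    rewrite prod er es; congr mx2; try by ring.
    apply: (mulIr rU).
    transitivity (p * (r * ((s - 1) / r)) + (p - 1) / r * r); last by ring.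
    by rewrite er es (_ : q * r = p * s - 1); [ring|rewrite -det1; ring].
  by do 2 apply: (SM) => //.
move=> M det1; have [rU|nrU] := boolP (M 1 0 \is a GRing.unit); first exact: main.
have detM : M 0 0 * M 1 1 - M 0 1 * M 1 0 = 1 by rewrite -det_mx2 -mx2_eta.
have pU : M 0 0 \is a GRing.unit.
  have : M 0 0 * M 1 1 - M 0 1 * M 1 0 \is a GRing.unit by rewrite detM unitr1.
  move=> /loc /orP []; first by rewrite unitrM => /andP [].
  by rewrite unitrN unitrM (negPf nrU) andbF.
have -> : M = lower_unipotent (-1) *m (lower_unipotent 1 *m M).
  rewrite mulmxA /lower_unipotent mx2M.
  rewrite (_ : mx2 _ _ _ _ = 1%:M) ?mul1mx // mx2_1; congr mx2; ring.
apply: (SM) => //; apply: main.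
  by rewrite det_mulmx det1 mulr1 /lower_unipotent det_mx2 mul0r subr0 mulr1.
rewrite [M]mx2_eta /lower_unipotent mx2M mxE /= !mul1r.
have : (M 0 0 + M 1 0) - M 1 0 \is a GRing.unit by rewrite addrK.
by move=> /loc /orP []; rewrite // unitrN (negPf nrU).
Qed.

End Matrix2.

(** * The Galois action on a basis of solutions *)

Section GaloisAction.
Variables (F : finFieldType) (L : fieldType) (iota : {rmorphism ratfun F -> L}).
Hypothesis hL : separable_closure iota.
Variable fr : {rmorphism L -> L}.
Hypothesis frE : forall x, fr x = x ^+ #|F|.
Local Notation cF := (const_emb iota).
Local Notation th := (iota (theta F)).

Lemma theta_unit : th \is a GRing.unit.
Proof. by rewrite unitfE fmorph_eq0 /theta ratfun_of_eq0 polyX_eq0. Qed.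

Lemma additive_onto (be ga y : L) : exists x, th * x + be * fr x + ga * fr (fr x) = y.
Proof.
have th0 : th != 0 by rewrite -unitfE theta_unit.
have [x xE] := additive_solve cF hL.2 be ga y th0.
by exists x; rewrite !frE.
Qed.

Lemma artin_schreier_onto y : exists x, fr x - x = y.
Proof.
have [|x xE] := additive_solve cF hL.2 1 0 y (c := -1); first by rewrite oppr_eq0 oner_eq0.
by exists x; rewrite frE -xE mul0r addr0 mulN1r mul1r addrC.
Qed.

Lemma tate_solution_exists (be ga : L) : (be != 0) || (ga != 0) ->
  exists2 f, f \is a GRing.unit & tate_eq fr th be ga f.
Proof.
move=> bg; have th0 : th != 0 by rewrite -unitfE theta_unit.
have [x0 x00 x0E] := additive_nonzero_root cF hL.2 th0 bg.
have [|f fE fx] := @tate_eq_extend _ fr th be ga x0 _ (additive_onto be ga).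
  by rewrite !frE.
by exists f; rewrite // fps_unitE fx unitfE.
Qed.

Lemma rank2_basis_exists (be : L) : exists w : 'I_2 -> fps L,
  (forall i, tate_eq fr th be (-1) (w i)) /\ wronskian fr (w 0) (w 1) \is a GRing.unit.
Proof.
have [|f fU fE] := @tate_solution_exists be (-1); first by rewrite oppr_eq0 oner_eq0 orbT.
have [|W WU WE] := @tate_solution_exists 1 0; first by rewrite oner_eq0.
have [xi [_ gE wE]] := companion_solution artin_schreier_onto fU fE WE.
exists (fun i => if i == 0 then f else f * xi); split; last by rewrite /= wE.
by apply: ord2P.
Qed.

Definition over_K (s : {rmorphism L -> L}) := s \o iota =1 iota.

Section Automorphism.
Variable s : {rmorphism L -> L}.

Lemma aut_fr x : s (fr x) = fr (s x).
Proof. by rewrite !frE rmorphXn. Qed.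

Hypothesis sK : over_K s.

Lemma aut_const c : s (cF c) = cF c.
Proof. exact: sK. Qed.

Lemma aut_fps_const c : map_fps s (map_fps cF c) = map_fps cF c.
Proof. by apply/fpsP => n /=; apply: sK. Qed.

Lemma aut_sol be ga f : tate_eq fr th (iota be) (iota ga) f ->
  tate_eq fr th (iota be) (iota ga) (map_fps s f).
Proof.
by move=> /(tate_eq_map aut_fr); have e x : s (iota x) = iota x := sK x; rewrite !e.
Qed.

End Automorphism.

Lemma carlitz_multiple W f : W \is a GRing.unit -> tate_eq fr th 1 0 W ->
  tate_eq fr th 1 0 f -> exists c, f = map_fps cF c * W.
Proof.
move=> WU WE fE; have [c cE] := fps_fixed cF frE (carlitz_ratio_fixed theta_unit WU WE fE).
by exists c; rewrite -cE divrK.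
Qed.

Section Rank2.
Variables (be : ratfun F) (w : 'I_2 -> fps L).
Local Notation sol := (tate_eq fr th (iota be) (- 1)).
Hypothesis w_sol : forall i, sol (w i).
Local Notation W := (wronskian fr (w 0) (w 1)).
Hypothesis wU : W \is a GRing.unit.

Definition series_comb (c : 'I_2 -> fps F) : fps L := \sum_i map_fps cF (c i) * w i.

Lemma twist_const c : map_fps fr (map_fps cF c) = map_fps cF c.
Proof. by apply/fpsP => n; apply: fr_const. Qed.

Lemma coordinates f : sol f -> exists c, f = series_comb c.
Proof.
move=> fE; have [c [d [cE dE ->]]] := rank2_coordinates theta_unit wU (w_sol 0) (w_sol 1) fE.
have [c' ->] := fps_fixed cF frE cE; have [d' ->] := fps_fixed cF frE dE.
exists (fun i => if i == 0 then c' else d'); rewrite /series_comb sum_ord2 /=.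
by rewrite [_ * w 0]mulrC [_ * w 1]mulrC.
Qed.

Lemma wronskian_combE c d : wronskian fr (series_comb c) (series_comb d) =
  map_fps cF (c 0 * d 1 - c 1 * d 0) * W.
Proof.
rewrite /series_comb !sum_ord2 rmorphB !rmorphM /=.
rewrite -(wronskian_comb (w 0) (w 1)) ?twist_const //.
by congr wronskian; rewrite ![map_fps cF _ * _]mulrC.
Qed.

Lemma map_cF_inj : injective (map_fps cF).
Proof.
by move=> c d /fpsP e; apply/fpsP => n; apply: (fmorph_inj cF); apply: (e n).
Qed.

(** Pairing with the Wronskian isolates each coordinate. *)
Lemma series_comb_inj c d : series_comb c = series_comb d -> c =1 d.
Proof.
move=> cd; have W0 x : map_fps cF x * W = 0 -> x = 0.
  move=> /(congr1 (fun z => z / W)); rewrite mulrK // mul0r => e.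
  by apply: map_cF_inj; rewrite e rmorph0.
pose e i := (fun j : 'I_2 => (j == i)%:R : fps F).
move=> i; apply/eqP; rewrite -subr_eq0; apply/eqP.
have eq_w (v : fps L) :
  wronskian fr (series_comb c) v = wronskian fr (series_comb d) v by rewrite cd.
move: i; apply: ord2P; apply: W0.
  have := eq_w (series_comb (e 1)); rewrite !wronskian_combE /e /= !mulr1 !mulr0 !subr0 => h.
  by rewrite rmorphB mulrBl h subrr.
have := eq_w (series_comb (e 0)); rewrite !wronskian_combE /e /= !mulr1 !mulr0.
rewrite !sub0r !rmorphN !mulNr => /oppr_inj h.
by rewrite rmorphB mulrBl h subrr.
Qed.

(** The same congruence modulo [t^k], which is all that matters on [K(phi[t^k])]. *)
Definition acts_mod k (s : {rmorphism L -> L}) (M : 'M[fps F]_2) : Prop :=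
  forall j, fps_low0 k (map_fps s (w j) - series_comb (M^~ j)).

(** The columns of [M] are the coordinates of the images of the basis [w]. *)
Definition acts_by (s : {rmorphism L -> L}) (M : 'M[fps F]_2) : Prop :=
  forall j, map_fps s (w j) = series_comb (M^~ j).

Lemma acts_by_mod k s M : acts_by s M -> acts_mod k s M.
Proof. by move=> sM j; rewrite sM subrr => i _; rewrite fps_coef0. Qed.

Lemma acts_by_exists s : over_K s -> exists M, acts_by s M.
Proof.
move=> sK; have /choice [M ME] j : exists c, map_fps s (w j) = series_comb c.
  apply: coordinates; have := @aut_sol s sK be (-1) (w j); rewrite rmorphN1; exact.
exists (\matrix_(i, j) M j i) => j; rewrite ME.
by apply: eq_bigr => i _; rewrite mxE.
Qed.

Lemma series_comb_mulmx (M N : 'M[fps F]_2) j :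
  series_comb ((M *m N)^~ j) = \sum_i map_fps cF (N i j) * series_comb (M^~ i).
Proof.
rewrite /series_comb; under [RHS]eq_bigr => i _ do rewrite mulr_sumr.
rewrite exchange_big /=; apply: eq_bigr => i _; rewrite mxE rmorph_sum mulr_suml.
by apply: eq_bigr => l _; rewrite rmorphM /=; ring.
Qed.

Lemma fps_low0D k (f g : fps L) : fps_low0 k f -> fps_low0 k g -> fps_low0 k (f + g).
Proof. by move=> f0 g0 i lt_i; rewrite fps_coefD f0 // g0 // addr0. Qed.

Lemma fps_low0_Ml k (f g : fps L) : fps_low0 k g -> fps_low0 k (f * g).
Proof. by rewrite mulrC; apply: fps_low0_Mr. Qed.

Lemma fps_low0_map k (s : {rmorphism L -> L}) f : fps_low0 k f -> fps_low0 k (map_fps s f).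
Proof. by move=> f0 i lt_i /=; rewrite f0 // rmorph0. Qed.

Lemma acts_mod_comp k (s t : {rmorphism L -> L}) M N : over_K s ->
  acts_mod k s M -> acts_mod k t N -> acts_mod k (s \o t) (M *m N).
Proof.
move=> sK sM tN j.
have -> : map_fps (s \o t) (w j) - series_comb ((M *m N)^~ j) =
  map_fps s (map_fps t (w j) - series_comb (N^~ j)) +
  \sum_i map_fps cF (N i j) * (map_fps s (w i) - series_comb (M^~ i)).
  rewrite series_comb_mulmx rmorphB /= /series_comb rmorph_sum /=.
  under [X in _ = _ - X + _]eq_bigr => i _ do rewrite rmorphM /= (aut_fps_const sK).
  under [X in _ = _ + X]eq_bigr => i _ do rewrite mulrBr.
  by rewrite sumrB addrA subrK; congr (_ - _); apply/fpsP.
apply: fps_low0D; first exact: fps_low0_map.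
by rewrite sum_ord2; apply: fps_low0D; apply: fps_low0_Ml.
Qed.

Lemma acts_by_comp (s t : {rmorphism L -> L}) M N : over_K s ->
  acts_by s M -> acts_by t N -> acts_by (s \o t) (M *m N).
Proof.
move=> sK sM tN j; apply/eqP; rewrite -subr_eq0; apply/eqP/fpsP => n.
rewrite fps_coef0; apply: (@acts_mod_comp n.+1 s t M N) => //; exact: acts_by_mod.
Qed.

Lemma acts_by_inj M N s : acts_by s M -> acts_by s N -> M = N.
Proof.
move=> sM sN; apply/matrixP => i j.
by apply: (@series_comb_inj (M^~ j) (N^~ j)); rewrite -sM sN.
Qed.

Lemma acts_by_id (s : {rmorphism L -> L}) : s =1 id -> acts_by s 1%:M.
Proof.
move=> s1 j; rewrite (_ : map_fps s (w j) = w j); last by apply/fpsP => n /=; rewrite s1.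
move: j; apply: ord2P; rewrite /series_comb sum_ord2 !mxE /= ?rmorph1 ?rmorph0; ring.
Qed.

(** The Wronskian is alternating and bilinear over twist-invariant series. *)
Lemma acts_by_det s M : acts_by s M -> map_fps s W = map_fps cF (\det M) * W.
Proof.
move=> sM; rewrite -(wronskian_map _ _ (aut_fr s)) !sM wronskian_combE.
congr (map_fps cF _ * _).
by rewrite [M in RHS]mx2_eta det_mx2 [M 0 1 * _]mulrC mulrC; ring.
Qed.

End Rank2.
End GaloisAction.

(** * Unipotent automorphisms over the first torsion tower *)

Section CommonField.
Variables (F : finFieldType) (K L M E : fieldType) (iota : {rmorphism K -> L})
  (cK : {rmorphism F -> K}) (j : {rmorphism E -> L}) (eps : {rmorphism E -> M})
  (i : {rmorphism K -> E}).
Hypothesis hL : separable_closure iota.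
Hypothesis maxE : forall (mu : {poly E}) z y, irreducible_poly mu ->
  root (map_poly j mu) z -> root (map_poly eps mu) y ->
  exists2 e, j e = z & eps e = y.
Variables (frE : {rmorphism E -> E}) (frM : {rmorphism M -> M}).
Hypotheses (frEE : forall x, frE x = x ^+ #|F|) (frME : forall x, frM x = x ^+ #|F|).

(** The minimal polynomial over [E] of an element [x] of [M] divides [P], so it has
    a root in the separably closed [L]; by maximality [E] contains this root. *)
Lemma separable_root_pull (P : {poly E}) x :
  separable_poly P -> root (map_poly eps P) x -> exists e, eps e = x.
Proof.
move=> P_sep Px; have [mu [mu_irr muP mux]] := min_poly_exists (separable_poly_neq0 P_sep) Px.
have mu_sep : separable_poly mu := dvdp_separable muP P_sep.
have [z muz] := separable_has_root hL j mu_sep mu_irr.1.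
by have [e] := maxE mu_irr muz mux; exists e.
Qed.

Lemma tate_solution_pull (th be ga : K) f : th != 0 ->
  tate_eq frM (eps (i th)) (eps (i be)) (eps (i ga)) f ->
  exists2 f', map_fps eps f' = f & tate_eq frE (i th) (i be) (i ga) f'.
Proof.
move=> th0 /tate_eqP fE.
have eps_fr x : eps (frE x) = frM (eps x) by rewrite frEE frME rmorphXn.
have pull1 y x : eps (i th) * x + eps (i be) * frM x + eps (i ga) * frM (frM x) = eps y ->
    exists e, eps e = x.
  move=> xE; apply: (@separable_root_pull (additive_poly F (i th) (i be) (i ga) - y%:P)).
  - by apply: (additive_poly_separable (i \o cK)); rewrite fmorph_eq0.
  - apply/rootP; rewrite rmorphB /= map_polyC hornerD hornerN hornerC /additive_poly.
    rewrite !rmorphD /= !map_polyZ /= map_polyX !map_polyXn !hornerE exprM -!frME.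
    by rewrite xE subrr.
have /choice [f' f'E] n : exists e, eps e = f$_n.
  elim: n => [|n [y yE]]; last by apply: (pull1 y); rewrite fE.
  by apply: (pull1 0); rewrite fE rmorph0.
exists (Fps f'); first by apply/fpsP => n /=.
apply/tate_eqP => n; apply: (fmorph_inj eps).
rewrite !rmorphD !rmorphM /= !eps_fr !f'E fE; case: n => [|n]; first by rewrite rmorph0.
exact/esym/f'E.
Qed.

End CommonField.

Section ManyUnipotents.
Variables (F : finFieldType) (L : fieldType) (iota : {rmorphism ratfun F -> L}).
Hypothesis hL : separable_closure iota.
Variable fr : {rmorphism L -> L}.
Hypothesis frE : forall x, fr x = x ^+ #|F|.
Local Notation cF := (const_emb iota).
Local Notation th := (iota (theta F)).
Variables (a b : ratfun F) (l : {poly F}).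
Hypotheses (hl : irreducible_poly l) (hltheta : ~~ (l %= 'X))
  (hla : (0 <= vadic l a)%E) (hlb : (vadic l b < 0)%E)
  (hlgcd : gcdz #|F|%:Z (fine (vadic l b)) = 1).

(** The maximal subfield of [L] that embeds in the local field stands for the fixed
    field of inertia.  All solutions for the first module are combinations of two
    with coefficients in it, so they are fixed by the automorphisms over it. *)
Lemma inertia_field : exists (E : fieldType) (j : {rmorphism E -> L})
    (i : {rmorphism ratfun F -> E}) (frk : {rmorphism E -> E}) (w W : fps E),
  [/\ j \o i =1 iota, forall x, frk x = x ^+ #|F| &
   [/\ forall (s : {rmorphism L -> L}), s \o j =1 j -> forall f,
      tate_eq fr th (iota a) (-1) f -> map_fps s f = f,
   tate_eq frk (i (theta F)) (i b) (-1) w,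
   tate_eq frk (i (theta F)) 1 0 W,
   w$_0 != 0 /\ W$_0 != 0 &
   forall p n (c : nat -> F) (eta : E), prime p -> p \in [pchar F] ->
      (exists2 i, (i < n)%N & c i != 0) ->
      eta ^+ p - eta != \sum_(m < n) i (ratfun_of (c m)%:P) * (W / (w * map_fps frk w))$_m]].
Proof.
have [M [g [frM [frME [f1 [f2 [f1E f2E fU]]] [w [wE w0 wP]]]]]] :=
  local_tate_solutions hl hltheta hla hlb hlgcd.
have [E [j [eps [GE maxE]]]] := maximal_common_field (field_graph_range iota g).
have GE' x : exists2 e, j e = iota x & eps e = g x by apply: (GE (iota x, g x)); exists x.
have [x|i ji] := rmorphism_factor (j := j) (f := iota).
  by have [e ej _] := GE' x; exists e.
have ei x : eps (i x) = g x.
  have [e ej <-] := GE' x; congr (eps _); apply: (fmorph_inj j).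
  by rewrite ej; apply: ji.
have [frk frkE] := frobenius_morphism (i \o (@ratfun_of F \o @polyC F)).
have eps_fr x : eps (frk x) = frM (eps x) by rewrite frkE frME rmorphXn.
have j_fr x : j (frk x) = fr (j x) by rewrite frkE frE rmorphXn.
have th0 : theta F != 0 by rewrite /theta ratfun_of_eq0 polyX_eq0.
have pull be ga f : tate_eq frM (g (theta F)) (g be) (g ga) f ->
  exists2 f', map_fps eps f' = f & tate_eq frk (i (theta F)) (i be) (i ga) f'.
  rewrite -!ei => h.
  exact: (tate_solution_pull (@ratfun_of F \o @polyC F) hL maxE frkE frME th0 h).
have g1 : (-1 : M) = g (-1) by rewrite rmorphN1.
have i1 : i (-1) = -1 by rewrite rmorphN1.
have [f1' f1'E f1'S] : exists2 f', map_fps eps f' = f1 &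
    tate_eq frk (i (theta F)) (i a) (-1) f'.
  by rewrite -i1; apply: pull; rewrite -g1.
have [f2' f2'E f2'S] : exists2 f', map_fps eps f' = f2 &
    tate_eq frk (i (theta F)) (i a) (-1) f'.
  by rewrite -i1; apply: pull; rewrite -g1.
have [w' w'E w'S] : exists2 f', map_fps eps f' = w &
    tate_eq frk (i (theta F)) (i b) (-1) f'.
  by rewrite -i1; apply: pull; rewrite -g1.
pose W := wronskian frk f1' f2'.
have WS : tate_eq frk (i (theta F)) 1 0 W := wronskian_carlitz f1'S f2'S.
have epsW : map_fps eps W = wronskian frM f1 f2.
  by rewrite /W -(wronskian_map _ _ eps_fr) f1'E f2'E.
have W0 : W$_0 != 0.
  by move: fU; rewrite -epsW fps_unitE unitfE /= fmorph_eq0.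
have WU : W \is a GRing.unit by rewrite fps_unitE unitfE.
have jiE x : j (i x) = iota x := ji x.
exists E, j, i, frk, w', W; split=> //; split=> //.
- move=> s sj f fS.
  have jf1 : tate_eq fr th (iota a) (-1) (map_fps j f1').
    by have := tate_eq_map j_fr f1'S; rewrite !jiE rmorphN1.
  have jf2 : tate_eq fr th (iota a) (-1) (map_fps j f2').
    by have := tate_eq_map j_fr f2'S; rewrite !jiE rmorphN1.
  have jWU : wronskian fr (map_fps j f1') (map_fps j f2') \is a GRing.unit.
    by rewrite (wronskian_map _ _ j_fr); apply: rmorph_unit.
  have [c [d [cE dE ->]]] := rank2_coordinates (theta_unit iota) jWU jf1 jf2 fS.
  have [c' ->] := fps_fixed cF frE cE; have [d' ->] := fps_fixed cF frE dE.
  have sK : over_K iota s by move=> x; rewrite /= -!jiE; apply: sj.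
  have sjf h : map_fps s (map_fps j h) = map_fps j h by apply/fpsP => n; apply: sj.
  by rewrite rmorphD !rmorphM /= !sjf !(aut_fps_const sK).
- split=> //; apply: contraNneq w0 => w'0.
  by rewrite -w'E /= w'0 rmorph0.
move=> p n c eta p_pr pF cn0.
have epsWS : tate_eq frM (g (theta F)) 1 0 (map_fps eps W).
  by have := tate_eq_map eps_fr WS; rewrite !ei rmorph1 rmorph0.
have epsW0 : (map_fps eps W)$_0 != 0 by rewrite /= fmorph_eq0.
apply: contraNneq (wP _ epsWS epsW0 p n c (eps eta) p_pr pF cn0) => etaE.
rewrite -rmorphXn -rmorphB etaE rmorph_sum; apply/eqP; apply: eq_bigr => m _.
rewrite rmorphM ei; congr (_ * _).
have w'U : w' \is a GRing.unit.
  by rewrite fps_unitE unitfE; apply: contraNneq w0 => w'0; rewrite -w'E /= w'0 rmorph0.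
rewrite -w'E -(map_fps_comm _ eps_fr) -rmorphM.
rewrite -[LHS]/((map_fps eps (W / (w' * map_fps frk w')))$_m).
by rewrite rmorph_div // unitrM w'U; apply: rmorph_unit.
Qed.

(** The automorphisms over the inertia field act on [xi] by adding elements of
    [F_q[[t]]].  If the truncations of these were a proper subgroup, a trace form
    would vanish on it, and the trace of the corresponding combination of
    coefficients of [xi] would be an element of the inertia field solving a
    forbidden Artin-Schreier equation. *)
Lemma many_unipotents : exists w : 'I_2 -> fps L,
  [/\ forall i, tate_eq fr th (iota b) (-1) (w i), wronskian fr (w 0) (w 1) \is a GRing.unit &
   forall k u, exists s : {rmorphism L -> L}, [/\ over_K iota s,
     forall f, tate_eq fr th (iota a) (-1) f -> map_fps s f = f &
     acts_mod iota w k s (upper_unipotent u)]].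
Proof.
have [E [j [i [frk [w [W [ji frkE [fixK1 wS WS [w0 W0] noAS]]]]]]]] := inertia_field.
have jiE x : j (i x) = iota x := ji x.
have j_fr x : j (frk x) = fr (j x) by rewrite frkE frE rmorphXn.
have [p [d [p_pr pF d_gt0 qE]]] := card_prime_power F.
have pL : p \in [pchar L] by apply: (rmorph_pchar cF).
have pE : p \in [pchar E] by apply: (rmorph_pchar (i \o (@ratfun_of F \o @polyC F))).
pose w1 := map_fps j w; pose W1 := map_fps j W.
have w1S : tate_eq fr th (iota b) (-1) w1.
  by have := tate_eq_map j_fr wS; rewrite !jiE rmorphN1.
have W1S : tate_eq fr th 1 0 W1.
  by have := tate_eq_map j_fr WS; rewrite !jiE rmorph1 rmorph0.
have wU : w \is a GRing.unit by rewrite fps_unitE unitfE.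
have WU : W \is a GRing.unit by rewrite fps_unitE unitfE.
have w1U : w1 \is a GRing.unit by apply: rmorph_unit.
have [xi [xiE w2S wrE]] := companion_solution (artin_schreier_onto hL frE) w1U w1S W1S.
pose rE := W / (w * map_fps frk w).
have {}xiE : map_fps fr xi - xi = map_fps j rE.
  rewrite xiE /rE rmorph_div ?unitrM ?wU //; last exact: rmorph_unit.
  by rewrite rmorphM /= -(map_fps_comm _ j_fr).
exists (fun m => if m == 0 then w1 else w1 * xi); split=> [||k u].
- by apply: ord2P.
- by rewrite /= wrE; apply: rmorph_unit.
(* [s xi - xi] is invariant under the twist since [xi' - xi] is fixed by [s]. *)
have cocycle (s : {rmorphism L -> L}) : s \o j =1 j ->
    exists v, map_fps s xi = xi + map_fps cF v.
  move=> sj; have [|v vE] := fps_fixed cF frE (c := map_fps s xi - xi).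
    have sr : map_fps s (map_fps j rE) = map_fps j rE by apply/fpsP => n; apply: sj.
    have e : map_fps s (map_fps fr xi) = map_fps fr (map_fps s xi).
      by apply: map_fps_comm => x; apply: aut_fr.
    have xe : map_fps fr xi = xi + map_fps j rE by rewrite -xiE addrC subrK.
    by rewrite rmorphB /= -e xe rmorphD /= sr opprD addrACA subrr addr0.
  by exists v; rewrite -vE addrC subrK.
have sKP (s : {rmorphism L -> L}) : s \o j =1 j -> over_K iota s.
  by move=> sj x; rewrite /= -jiE; apply: sj.
pose good (v : 'rV[F]_k) := `[< exists2 s : {rmorphism L -> L}, s \o j =1 j &
   forall m : 'I_k, s xi$_m = xi$_m + cF (v 0 m) >].
pose V := finset.finset good.
have VT v : v \in V.
  apply: contrapT => /negP vV.
  have V0 : 0 \in V.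
    rewrite finset.in_set; apply/asboolP; exists idfun => // m.
    by rewrite mxE rmorph0 addr0.
  have VD : {in V &, forall v v', v + v' \in V}.
    move=> v1 v2; rewrite !finset.in_set => /asboolP [s1 s1j s1P] /asboolP [s2 s2j s2P].
    apply/asboolP; exists (s1 \o s2) => [x|m] /=.
      by have /= -> := s2j x; apply: s1j.
    rewrite s2P rmorphD s1P (aut_const (sKP _ s1j)) -addrA -rmorphD.
    by rewrite mxE.
  have [|c c0 cV] := trace_dual pF qE V0 VD; first by exists v.
  pose S := \sum_m cF (c 0 m) * xi$_m.
  have /(fixed_by_auts hL ji) [eta etaE] : forall s : {rmorphism L -> L}, s \o j =1 j ->
      s (frob_trace p d S) = frob_trace p d S.
    move=> s sj; have [y yE] := cocycle s sj.
    have /cV : (\row_m y$_m : 'rV[F]_k) \in V.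
      rewrite finset.in_set; apply/asboolP; exists s => // m; rewrite mxE.
      by rewrite -[LHS]/((map_fps s xi)$_m) yE.
    move=> tr0; rewrite -frob_trace_map.
    have -> : s S = S + cF (\sum_m c 0 m * (\row_m y$_m : 'rV[F]_k) 0 m).
      rewrite /S !rmorph_sum -big_split; apply: eq_bigr => m _.
      rewrite rmorphM [s (cF _)](aut_const (sKP _ sj)).
      rewrite -[s xi$_m]/((map_fps s xi)$_m) yE fps_coefD mulrDr.
      by rewrite mxE rmorphM.
    by rewrite (frob_traceD d pL) frob_trace_map tr0 rmorph0 addr0.
  (* [c] as a sequence, extended by 0. *)
  pose c' m := if insub m is Some m' then c 0 (m' : 'I_k) else 0.
  have c'E (m : 'I_k) : c' m = c 0 m by rewrite /c' valK.
  have cn0 : exists2 m, (m < k)%N & c' m != 0.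
    have [m cm] : exists m, c 0 m != 0.
      apply: contrapT => nc; case/negP: c0; apply/eqP/rowP => m; rewrite mxE.
      by apply/eqP; apply: contra_notT nc => cm; exists m.
    by exists m; rewrite ?c'E.
  case/negP: (noAS p k c' eta p_pr pF cn0); apply/eqP; apply: (fmorph_inj j).
  rewrite rmorphB rmorphXn etaE (frob_trace_pow d pL) -qE -frE /S !rmorph_sum -sumrB.
  apply: eq_bigr => m _; rewrite !rmorphM /= jiE c'E fr_const // -mulrBr.
  congr (_ * _); exact: (congr1 (fun z => z$_m) xiE).
have := VT (\row_m u$_m); rewrite finset.in_set => /asboolP [s sj sP].
exists s; split; [exact: sKP|exact: fixK1|].
have sw1 : map_fps s w1 = w1 by apply/fpsP => n; apply: sj.
have [y yE] := cocycle s sj.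
have yu m : (m < k)%N -> y$_m = u$_m.
  move=> lt_m; have := sP (Ordinal lt_m); rewrite mxE -[s _]/((map_fps s xi)$_m) yE.
  by move=> /addrI; apply: fmorph_inj.
apply: ord2P; rewrite /series_comb sum_ord2 /= /upper_unipotent !mxE /=.
  by rewrite sw1 rmorph1 rmorph0 mul1r mul0r addr0 subrr => m _; rewrite fps_coef0.
rewrite rmorphM /= sw1 yE rmorph1 mul1r.
have -> : w1 * (xi + map_fps cF y) - (map_fps cF u * w1 + w1 * xi) = w1 * map_fps cF (y - u).
  by rewrite [map_fps cF (y - u)]rmorphB; ring.
apply: fps_low0_Ml => m lt_m /=; rewrite yu // subrr; exact: rmorph0.
Qed.

End ManyUnipotents.

(** * Torsion towers as subfields *)

Section SubfieldSets.
Variable L : fieldType.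
Implicit Types (S E A : set L).

(** Membership without the boolean coercions of [divring_closed]. *)
Lemma is_subfieldP S : is_subfield S <->
  [/\ S 1, forall x y, S x -> S y -> S (x - y) & forall x y, S x -> S y -> S (x / y)].
Proof.
split=> [[S1 SB Sd]|[S1 SB Sd]].
  split=> [|x y Sx Sy|x y Sx Sy]; first by have := S1; rewrite inE.
    by have := SB x y; rewrite !inE; apply.
  by have := Sd x y; rewrite !inE; apply.
by split=> [|x y|x y]; rewrite !inE //; [apply: SB|apply: Sd].
Qed.

Section Closure.
Variable S : set L.
Hypothesis hS : is_subfield S.
Lemma subfield1 : S 1. Proof. by have [] := (is_subfieldP S).1 hS. Qed.
Lemma subfieldB x y : S x -> S y -> S (x - y).
Proof. by have [_ h _] := (is_subfieldP S).1 hS; apply: h. Qed.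
Lemma subfield_div x y : S x -> S y -> S (x / y).
Proof. by have [_ _ h] := (is_subfieldP S).1 hS; apply: h. Qed.
Lemma subfield0 : S 0.
Proof. by rewrite -(subrr 1); apply: subfieldB; apply: subfield1. Qed.
Lemma subfieldD x y : S x -> S y -> S (x + y).
Proof.
move=> Sx Sy; rewrite -[y]opprK -[- y]sub0r; apply: subfieldB => //.
by apply: subfieldB => //; apply: subfield0.
Qed.
Lemma subfieldM x y : S x -> S y -> S (x * y).
Proof.
move=> Sx Sy; rewrite -[y]invrK -[y^-1]div1r; apply: subfield_div => //.
by apply: subfield_div => //; apply: subfield1.
Qed.
Lemma subfield_sum I (r : seq I) (P : pred I) (f : I -> L) :
  (forall i, P i -> S (f i)) -> S (\sum_(i <- r | P i) f i).
Proof. by move=> Sf; elim/big_ind: _ => //; [apply: subfield0|apply: subfieldD]. Qed.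
Lemma subfieldX x n : S x -> S (x ^+ n).
Proof.
move=> Sx; elim: n => [|n IHn]; first by rewrite expr0; apply: subfield1.
by rewrite exprS; apply: subfieldM.
Qed.
End Closure.

Lemma adjoin_subfield E A : is_subfield (adjoin E A).
Proof.
apply/is_subfieldP; split=> [S [hS _]|x y Sx Sy S [hS EAS]|x y Sx Sy S [hS EAS]].
- exact: subfield1.
- by apply: (subfieldB hS); [apply: Sx|apply: Sy].
- by apply: (subfield_div hS); [apply: Sx|apply: Sy].
Qed.

Lemma sub_adjoin_base E A : E `<=` adjoin E A.
Proof. by move=> x Ex S [_]; apply; left. Qed.
Lemma sub_adjoin_gen E A : A `<=` adjoin E A.
Proof. by move=> x Ax S [_]; apply; right. Qed.
Lemma adjoin_min E A S : is_subfield S -> E `<=` S -> A `<=` S -> adjoin E A `<=` S.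
Proof. by move=> hS ES AS x; apply; split=> // y []; [apply: ES|apply: AS]. Qed.

Lemma equalizer_subfield (s t : {rmorphism L -> L}) : is_subfield [set x | s x = t x].
Proof.
apply/is_subfieldP; split=> [|x y /= sx sy|x y /= sx sy]; first by rewrite /= !rmorph1.
  by rewrite !rmorphB sx sy.
by rewrite !fmorph_div sx sy.
Qed.

Lemma preimage_subfield (s : {rmorphism L -> L}) S : is_subfield S ->
  is_subfield [set x | S (s x)].
Proof.
move=> hS; apply/is_subfieldP; split=> [|x y /= sx sy|x y /= sx sy].
- by rewrite /= rmorph1; apply: subfield1.
- by rewrite rmorphB; apply: subfieldB.
- by rewrite fmorph_div; apply: subfield_div.
Qed.
End SubfieldSets.

Section Tower.
Variables (F : finFieldType) (L : fieldType) (iota : {rmorphism ratfun F -> L}).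
Variable fr : {rmorphism L -> L}.
Hypothesis frE : forall x, fr x = x ^+ #|F|.
Variables (r : nat) (phi : drinfeld_module F r) (be ga : ratfun F).
Local Notation act := (drin_act iota phi).
Hypothesis actX : forall x,
  act 'X x = iota (theta F) * x + iota be * fr x + iota ga * fr (fr x).
Hypothesis act_onto : forall y, exists x, act 'X x = y.
Local Notation sol := (tate_eq fr (iota (theta F)) (iota be) (iota ga)).
Local Notation tower := (torsion_tower iota phi).
Local Notation tfield k := (torsion_field iota phi 'X^k).

Lemma torsion_coef k x : torsion iota phi 'X^(k.+1) x -> exists2 f, sol f & f$_k = x.
Proof. exact: (torsion_sol frE actX (ltn0Sn k) act_onto). Qed.

Lemma torsion_mono k m : (k <= m)%N -> torsion iota phi 'X^k `<=` torsion iota phi 'X^m.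
Proof.
move=> le_km x; rewrite /torsion /= !(drin_act_iter iota frE phi) -(subnK le_km) iterD => ->.
elim: (m - k)%N => //= n ->; rewrite actX !rmorph0 !mulr0 !addr0 //.
Qed.

Lemma tfield_mono k m : (k <= m)%N -> tfield k `<=` tfield m.
Proof.
move=> le_km; apply: adjoin_min; first exact: adjoin_subfield.
  exact: sub_adjoin_base.
by move=> x /(torsion_mono le_km); apply: sub_adjoin_gen.
Qed.

Lemma tfield_tower k : tfield k `<=` tower.
Proof.
by move=> x xk; exists k.+1 => //; apply: tfield_mono xk.
Qed.

Lemma tower_tfield x : tower x -> exists k, tfield k x.
Proof. by move=> [k _ xk]; exists k. Qed.

Lemma tower_subfield : is_subfield tower.
Proof.
have two x y : tower x -> tower y -> exists k, tfield k x /\ tfield k y.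
  move=> /tower_tfield [k xk] /tower_tfield [m ym]; exists (maxn k m).
  by split; [apply: tfield_mono xk|apply: tfield_mono ym]; rewrite ?leq_maxl ?leq_maxr.
apply/is_subfieldP; split=> [|x y /two xy /xy [k [xk yk]]|x y /two xy /xy [k [xk yk]]].
- by apply: (@tfield_tower 0); apply: (subfield1 (adjoin_subfield _ _)).
- by apply: (@tfield_tower k); apply: (subfieldB (adjoin_subfield _ _)).
- by apply: (@tfield_tower k); apply: (subfield_div (adjoin_subfield _ _)).
Qed.

Lemma tower_base : range iota `<=` tower.
Proof. by move=> x Kx; apply: (@tfield_tower 0); apply: sub_adjoin_base. Qed.

Lemma sol_tfield f n : sol f -> tfield n.+1 f$_n.
Proof. by move=> fE; apply: sub_adjoin_gen; apply: (sol_torsion frE actX). Qed.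

Lemma sol_tower f n : sol f -> tower f$_n.
Proof. by move=> /sol_tfield h; apply: tfield_tower (h n). Qed.

Lemma tower_min S : is_subfield S -> range iota `<=` S ->
  (forall f n, sol f -> S f$_n) -> tower `<=` S.
Proof.
move=> hS KS solS x [[//|k] _]; apply: adjoin_min => // y /torsion_coef [f fE <-].
exact: solS.
Qed.

(** The torsion field is generated by coefficients of solutions. *)
Lemma tfield_agree (s t : {rmorphism L -> L}) k : over_K iota s -> over_K iota t ->
  (forall f n, sol f -> (n < k)%N -> s f$_n = t f$_n) ->
  forall x, tfield k x -> s x = t x.
Proof.
move=> sK tK st; apply: adjoin_min; first exact: equalizer_subfield.
  by move=> _ [x _ <-] /=; have /= -> := sK x; have /= -> := tK x.
case: k st => [_ x|k st x].
  by rewrite /torsion /= expr0 (drin_act1 iota frE phi) => ->; rewrite /= !rmorph0.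
by move=> /torsion_coef [f fE <-] /=; apply: st.
Qed.

Lemma tfield_stable (s : {rmorphism L -> L}) k : over_K iota s ->
  forall x, tfield k x -> tfield k (s x).
Proof.
move=> sK; apply: adjoin_min; first exact/preimage_subfield/adjoin_subfield.
  by move=> _ [x _ <-] /=; have /= -> := sK x; apply: sub_adjoin_base; exists x.
case: k => [x|k x].
  rewrite /torsion /= expr0 (drin_act1 iota frE phi) => -> /=; rewrite rmorph0.
  exact: (subfield0 (adjoin_subfield _ _)).
move=> /torsion_coef [f fE <-] /=; apply: sub_adjoin_gen.
exact: (sol_torsion frE actX k (aut_sol frE sK fE)).
Qed.

Lemma tower_fixed (s : {rmorphism L -> L}) : over_K iota s ->
  (forall f, sol f -> map_fps s f = f) -> forall x, tower x -> s x = x.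
Proof.
move=> sK sf; apply: tower_min; first exact: (equalizer_subfield s idfun).
  by move=> _ [x _ <-] /=; apply: sK.
by move=> f n fE /=; rewrite -[in RHS](sf f fE).
Qed.
End Tower.

Section ActionOfT.
Variables (F : finFieldType) (L : fieldType) (iota : {rmorphism ratfun F -> L}).
Variable fr : {rmorphism L -> L}.
Hypothesis frE : forall x, fr x = x ^+ #|F|.

Lemma tw_eval_const c x : tw_eval iota (twC c) x = iota c * x.
Proof.
by rewrite (tw_eval_widen iota frE (n := 1)) ?size_polyC_leq1 // big_ord1 tw_coefC.
Qed.

Lemma tw_eval_tau x : tw_eval iota (tau F) x = fr x.
Proof.
rewrite (tw_eval_widen iota frE (n := 2)) ?size_polyX // !big_ord_recl big_ord0 /=.
by rewrite !tw_coef_tau /= rmorph0 rmorph1 mul0r mul1r add0r addr0.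
Qed.

Lemma drinfeld2_act (phi : drinfeld_module F 2) a x :
  phi 'X = twC (theta F) + twC a * tau F - tau F ^+ 2 ->
  drin_act iota phi 'X x = iota (theta F) * x + iota a * fr x + iota (-1) * fr (fr x).
Proof.
move=> phiE; rewrite /drin_act phiE expr2 -scaleN1r.
have E (u v w v' : twisted F) : tw_eval iota (u + v * w + (-1) *: (w * v')) x =
    tw_eval iota u x + tw_eval iota v (tw_eval iota w x) +
    const_emb iota (-1) * tw_eval iota w (tw_eval iota v' x).
  rewrite (tw_evalD iota frE (u + v * w)) (tw_evalD iota frE u) (tw_evalZ iota frE).
  by rewrite (tw_evalM iota frE v w) (tw_evalM iota frE w v').
rewrite E !tw_eval_const !tw_eval_tau; congr (_ + _ * _).
by rewrite rmorphN1 rmorphN1.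
Qed.

Lemma carlitz_act x :
  drin_act iota (carlitz F) 'X x = iota (theta F) * x + iota 1 * fr x + iota 0 * fr (fr x).
Proof.
rewrite /drin_act /= carlitz_mapX (tw_evalD iota frE) tw_eval_const tw_eval_tau.
by rewrite rmorph0 rmorph1 mul0r addr0 mul1r.
Qed.

End ActionOfT.

Lemma drinfeld2_lead (F : finFieldType) (phi : drinfeld_module F 2) a :
  phi 'X = twC (theta F) + twC a * tau F - tau F ^+ 2 ->
  lead_coef (twpoly (phi 'X)) = -1.
Proof.
move=> phiE; rewrite lead_coefE drinfeld_rank /= -[LHS]/(tw_coef (phi 'X) 2) phiE.
have coefN (u : twisted F) n : tw_coef (- u) n = - tw_coef u n := coefN (twpoly u) n.
have tau0 : tw_coef (tau F) 0 = 0 := tw_coef_tau F 0.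
have tau1 : tw_coef (tau F) 1 = 1 := tw_coef_tau F 1.
have tau2 : tw_coef (tau F) 2 = 0 := tw_coef_tau F 2.
have C1 c : tw_coef (twC c : twisted F) 1 = 0 := tw_coefC c 1.
have C2 c : tw_coef (twC c : twisted F) 2 = 0 := tw_coefC c 2.
have mul2 (u v : twisted F) : tw_coef (u * v) 2 = tw_coef u 0 * frob 0 (tw_coef v 2) +
    (tw_coef u 1 * frob 1 (tw_coef v 1) + tw_coef u 2 * frob 2 (tw_coef v 0)).
  by rewrite [LHS](tw_coefM u v 2) !big_ord_recl big_ord0 addr0.
have add2 (u v : twisted F) : tw_coef (u + v) 2 = tw_coef u 2 + tw_coef v 2 := tw_coefD u v 2.
rewrite expr2 add2 coefN add2 C2 (mul2 (twC a)) (mul2 (tau F)) C1 C2 tau0 tau1 tau2.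
by rewrite frob1 frob0r !(mulr0, mul0r, mulr1, addr0, add0r).
Qed.

(** * Density in SL_2 *)

Section GlobalArgument.
Variables (F : finFieldType) (L : fieldType) (iota : {rmorphism ratfun F -> L}).
Hypothesis hL : separable_closure iota.
Variable fr : {rmorphism L -> L}.
Hypothesis frE : forall x, fr x = x ^+ #|F|.
Local Notation cF := (const_emb iota).
Local Notation th := (iota (theta F)).
Local Notation sol c := (tate_eq fr th (iota c) (-1)).
Local Notation KC := (torsion_tower iota (carlitz F)).

(** Elements of [galois_group] are only meaningful on [B]; this replaces them by
    automorphisms of [L]. *)
Lemma galois_group_extends (E B : set L) s :
  range iota `<=` E -> range iota `<=` B -> is_subfield B -> galois_group E B s ->
  exists2 t : {rmorphism L -> L}, over_K iota t & forall x, B x -> t x = s x.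
Proof.
move=> KE KB hB [_ sD sM sE].
have [EB [j jB]] := subfield_as_type hB.
have Bj x : B (j x) by rewrite -jB; exists x.
have inB x : j x \in B by rewrite in_setE.
have [|||f fE] := @rmorphism_of_morphs EB L (fun x => s (j x)).
- move=> x y; rewrite -[in RHS](subrK y x) [j (_ - _ + _)]rmorphD sD // addrK //.
- by move=> x y; rewrite rmorphM sM.
- rewrite rmorph1 -(rmorph1 iota) sE // in_setE; apply: KE; by exists 1.
have [x|i ji] := rmorphism_factor (j := j) (f := iota).
  have : B (iota x) by apply: KB; exists x.
  by rewrite -jB => -[e _ ex]; exists e.
have [t tE] := extend_aut hL f ji.
have tB x : B x -> t x = s x.
  by rewrite -jB => -[e _ <-]; have /= -> := tE e; rewrite fE.
exists t => // x /=; rewrite tB; last by apply: KB; exists x.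
by apply: sE; rewrite in_setE; apply: KE; exists x.
Qed.

Lemma carlitz_onto y : exists x, drin_act iota (carlitz F) 'X x = y.
Proof.
have [x xE] := additive_onto hL frE (iota 1) (iota 0) y.
by exists x; rewrite (carlitz_act iota frE).
Qed.

Lemma sol_iota c f : sol c f <-> tate_eq fr th (iota c) (iota (-1)) f.
Proof. by rewrite rmorphN1. Qed.

Lemma carlitz_iota f : tate_eq fr th 1 0 f <-> tate_eq fr th (iota 1) (iota 0) f.
Proof. by rewrite rmorph1 rmorph0. Qed.

Lemma carlitz_coef f n : tate_eq fr th 1 0 f -> KC f$_n.
Proof. by move=> /carlitz_iota /(sol_tower frE (carlitz_act iota frE)). Qed.

Lemma map_series_comb w d (s : {rmorphism L -> L}) : over_K iota s ->
  map_fps s (series_comb iota w d) = \sum_i map_fps cF (d i) * map_fps s (w i).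
Proof.
move=> sK; rewrite /series_comb rmorph_sum /=; apply: eq_bigr => i _.
by rewrite rmorphM /= (aut_fps_const sK).
Qed.

Section OneModule.
Variables (phi : drinfeld_module F 2) (c : ratfun F).
Hypothesis phiE : phi 'X = twC (theta F) + twC c * tau F - tau F ^+ 2.
Local Notation K := (torsion_tower iota phi).
Local Notation tfield k := (torsion_field iota phi 'X^k).

Let actX x := drinfeld2_act iota frE x phiE.

Lemma rank2_onto y : exists x, drin_act iota phi 'X x = y.
Proof.
have [x xE] := additive_onto hL frE (iota c) (iota (-1)) y.
by exists x; rewrite actX.
Qed.

Lemma rank2_tower_subfield : is_subfield K.
Proof. exact: (tower_subfield frE actX). Qed.

Lemma rank2_tower_base : range iota `<=` K.
Proof. exact: (tower_base frE actX). Qed.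

Lemma rank2_coef f n : sol c f -> K f$_n.
Proof. by move=> /sol_iota /(sol_tower frE actX). Qed.

Lemma const_tower x : K (cF x).
Proof. by apply: rank2_tower_base; exists (ratfun_of x%:P). Qed.

Lemma fps_tower_mul f g n : (forall m, K f$_m) -> (forall m, K g$_m) -> K (f * g)$_n.
Proof.
move=> Kf Kg; rewrite fps_coefM; apply: (subfield_sum rank2_tower_subfield) => i _.
exact: (subfieldM rank2_tower_subfield).
Qed.

(** The Wronskian of a basis is a Carlitz solution with coefficients in the tower,
    and all Carlitz solutions are multiples of it. *)
Lemma carlitz_sub_tower : KC `<=` K.
Proof.
have [w [wS wU]] := rank2_basis_exists hL frE (iota c).
apply: (tower_min frE (carlitz_act iota frE) carlitz_onto
  rank2_tower_subfield rank2_tower_base).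
move=> f n /carlitz_iota fE.
have [d ->] := carlitz_multiple frE wU (wronskian_carlitz (wS 0) (wS 1)) fE.
apply: fps_tower_mul => m; first exact: const_tower.
have Kw i k : K (w i)$_k by apply: rank2_coef.
have Ktw i k : K (map_fps fr (w i))$_k.
  by rewrite /= frE; apply: (subfieldX rank2_tower_subfield).
rewrite /wronskian fps_coefB; apply: (subfieldB rank2_tower_subfield); exact: fps_tower_mul.
Qed.

Lemma rank2_stable (s : {rmorphism L -> L}) k : over_K iota s ->
  forall x, tfield k x -> tfield k (s x).
Proof. exact: (tfield_stable frE actX rank2_onto). Qed.

Lemma rank2_fixed (s : {rmorphism L -> L}) : over_K iota s ->
  (forall f, sol c f -> map_fps s f = f) -> forall x, K x -> s x = x.
Proof.
move=> sK sf; apply: (tower_fixed frE actX rank2_onto sK) => f /sol_iota; exact: sf.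
Qed.

Lemma rank2_agree w (s t : {rmorphism L -> L}) k M :
  (forall i, sol c (w i)) -> wronskian fr (w 0) (w 1) \is a GRing.unit ->
  over_K iota s -> over_K iota t ->
  acts_mod iota w k s M -> acts_mod iota w k t M -> forall x, tfield k x -> s x = t x.
Proof.
move=> wS wU sK tK sM tM; apply: (tfield_agree frE actX rank2_onto sK tK).
move=> f n /sol_iota /(coordinates frE wS wU) [d ->] lt_nk.
rewrite -[s _]/((map_fps s (series_comb iota w d))$_n).
rewrite -[t _]/((map_fps t (series_comb iota w d))$_n).
rewrite (map_series_comb w d sK) (map_series_comb w d tK) !fps_coef_sum; apply: eq_bigr => i _.
apply/eqP; rewrite -subr_eq0 -fps_coefB -mulrBr; apply/eqP.
suff : fps_low0 k (map_fps s (w i) - map_fps t (w i)).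
  by move=> /(@fps_low0_Ml _ k (map_fps cF (d i))); apply.
have -> : map_fps s (w i) - map_fps t (w i) =
  (map_fps s (w i) - series_comb iota w (M^~ i)) -
  (map_fps t (w i) - series_comb iota w (M^~ i)).
  by rewrite opprB addrA subrK.
by move=> m lt_m; rewrite fps_coefB sM // tM // subrr.
Qed.

Lemma acts_by_det1 w (s : {rmorphism L -> L}) M :
  (forall i, sol c (w i)) -> wronskian fr (w 0) (w 1) \is a GRing.unit ->
  (forall x, KC x -> s x = x) -> acts_by iota w s M -> \det M = 1.
Proof.
move=> wS wU sC sM; have W1 := wronskian_carlitz (wS 0) (wS 1).
have sW : map_fps s (wronskian fr (w 0) (w 1)) = wronskian fr (w 0) (w 1).
  by apply/fpsP => n; apply: sC; apply: carlitz_coef.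
apply: (@map_cF_inj _ _ iota); rewrite rmorph1; apply: (mulIr wU).
by rewrite -(acts_by_det frE sM) sW mul1r.
Qed.

End OneModule.

Section TwoModules.
Variables (phi1 phi2 : drinfeld_module F 2) (a b : ratfun F).
Hypothesis phi1E : phi1 'X = twC (theta F) + twC a * tau F - tau F ^+ 2.
Hypothesis phi2E : phi2 'X = twC (theta F) + twC b * tau F - tau F ^+ 2.
Local Notation K1 := (torsion_tower iota phi1).
Local Notation K2 := (torsion_tower iota phi2).
Local Notation tfield2 k := (torsion_field iota phi2 'X^k).

Definition fixes_solutions (s : {rmorphism L -> L}) := forall f, sol a f -> map_fps s f = f.

Variable w : 'I_2 -> fps L.
Hypothesis wS : forall i, sol b (w i).
Hypothesis wU : wronskian fr (w 0) (w 1) \is a GRing.unit.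
Hypothesis unipotents : forall k u, exists s : {rmorphism L -> L},
  [/\ over_K iota s, fixes_solutions s & acts_mod iota w k s (upper_unipotent u)].

(** The set of matrices realized modulo [t^k] by automorphisms fixing the first
    tower is closed under products and, that tower being normal over [K], under
    conjugation by the matrix [G] of [g]. *)
Lemma SL2_dense k (g : {rmorphism L -> L}) G : over_K iota g -> acts_by iota w g G ->
  G 1 0 \is a GRing.unit -> forall M, \det M = 1 ->
  exists s : {rmorphism L -> L}, [/\ over_K iota s, fixes_solutions s & acts_mod iota w k s M].
Proof.
move=> gK gG G10U.
have [g' [gg' g'g]] := aut_inv hL gK.
have g'K : over_K iota g' by move=> x; rewrite /= -[in LHS](gK x) /= gg'.
have [G' g'G'] := acts_by_exists frE wS wU g'K.
have GG' : G *m G' = 1%:M.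
  apply: (acts_by_inj frE wU (acts_by_comp gK gG g'G')).
  by apply: acts_by_id => x /=; rewrite g'g.
apply: SL2_generated.
- move=> x y; rewrite !fps_unitE !unitfE fps_coefD.
  by apply: contraNT; rewrite negb_or !negbK => /andP [/eqP -> /eqP ->]; rewrite addr0.
- move=> M N [s [sK sf sM]] [t [tK tf tN]].
  exists (s \o t); split; last exact: acts_mod_comp.
    by move=> x /=; have /= -> := tK x; apply: sK.
  move=> f fE; rewrite -[RHS](sf f fE) -[in RHS](tf f fE); exact/fpsP.
- move=> u; exact: unipotents.
move=> v; have [x [u ->]] := lower_of_conjugate v GG' G10U.
have [s1 [s1K s1f s1M]] := unipotents k (- x).
have [s2 [s2K s2f s2M]] := unipotents k u.
have [s3 [s3K s3f s3M]] := unipotents k x.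
have gs2K : over_K iota (g \o s2) by move=> z /=; have /= -> := s2K z; apply: gK.
have gs2gK : over_K iota ((g \o s2) \o g').
  by move=> z /=; have /= -> := g'K z; apply: gs2K.
have s1gK : over_K iota (s1 \o ((g \o s2) \o g')).
  by move=> z /=; have /= -> := gs2gK z; apply: s1K.
exists ((s1 \o ((g \o s2) \o g')) \o s3); split.
- by move=> z /=; have /= -> := s3K z; apply: s1gK.
- move=> f fE.
  have g'f : sol a (map_fps g' f).
    by apply/sol_iota; apply: (aut_sol frE g'K); apply/sol_iota.
  have e1 : map_fps s2 (map_fps g' f) = map_fps g' f := s2f _ g'f.
  have e2 : map_fps g (map_fps g' f) = f by apply/fpsP => n /=; rewrite g'g.
  transitivity (map_fps s1 (map_fps g (map_fps s2 (map_fps g' (map_fps s3 f))))).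
    exact/fpsP.
  by rewrite (s3f f fE) e1 e2 s1f.
- have gU := acts_mod_comp gK (acts_by_mod (k := k) gG) s2M.
  have gUg' := acts_mod_comp gs2K gU (acts_by_mod (k := k) g'G').
  exact: (acts_mod_comp s1gK (acts_mod_comp s1K s1M gUg') s3M).
Qed.

End TwoModules.
End GlobalArgument.

(** * Linear disjointness *)

Section TateImage.
Variables (F : finFieldType) (L : fieldType) (iota : {rmorphism ratfun F -> L}).
Hypothesis hL : separable_closure iota.
Variable fr : {rmorphism L -> L}.
Hypothesis frE : forall x, fr x = x ^+ #|F|.
Local Notation cF := (const_emb iota).
Local Notation th := (iota (theta F)).
Local Notation sol c := (tate_eq fr th (iota c) (-1)).
Local Notation KC := (torsion_tower iota (carlitz F)).
Variables (phi1 phi2 : drinfeld_module F 2) (a b : ratfun F).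
Hypothesis phi1E : phi1 'X = twC (theta F) + twC a * tau F - tau F ^+ 2.
Hypothesis phi2E : phi2 'X = twC (theta F) + twC b * tau F - tau F ^+ 2.
Local Notation K1 := (torsion_tower iota phi1).
Local Notation K2 := (torsion_tower iota phi2).
Local Notation tfield2 k := (torsion_field iota phi2 'X^k).
Let act2 x := drinfeld2_act iota frE x phi2E.

(** One of the two elementary unipotents moves the line of a given vector. *)
Lemma matrix_moving_vector (c : 'cV[F]_2) : c != 0 ->
  exists2 M : 'M[F]_2, \det M = 1 & forall d : F, M *m c <> d *: c.
Proof.
move=> c0; have mulE (p q r s : F) : mx2 p q r s *m c =
    \col_i (if i == 0 then p * c 0 0 + q * c 1 0 else r * c 0 0 + s * c 1 0).
  by apply/colP; apply: ord2P; rewrite !mxE sum_ord2 !mxE.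
have [c1|c1] := eqVneq (c 1 0) 0.
  exists (lower_unipotent 1); first by rewrite det_mx2 mul0r subr0 mulr1.
  move=> d /colP e; have := e 1.
  rewrite /lower_unipotent mulE !mxE /= c1 mulr0 mulr0 addr0 mul1r => c00.
  by case/negP: c0; apply/eqP/colP; apply: ord2P; rewrite mxE.
exists (upper_unipotent 1); first by rewrite det_mx2 mulr0 subr0 mulr1.
move=> d /colP e; have := e 1; have := e 0.
rewrite /upper_unipotent mulE !mxE /= !mul1r mul0r add0r.
move=> e0 e1; have d1 : d = 1 by apply: (mulIf c1); rewrite mul1r -e1.
by move: e0; rewrite d1 mul1r -[RHS]addr0 => /addrI /eqP; rewrite (negPf c1).
Qed.

Lemma torsion_combE u c : torsion_comb iota phi2 u c = \sum_i cF (c i 0) * u i.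
Proof. by apply: eq_bigr => i _; rewrite (drin_actC iota frE). Qed.

(** This is where the size of the Galois group of [K(phi_2[t])] enters: an element
    of [SL_2(F_q)] that moves the line of the first torsion point of [w] is realized
    by an automorphism. *)
Lemma moving_automorphism (w : 'I_2 -> fps L) :
  (forall i, sol b (w i)) -> wronskian fr (w 0) (w 1) \is a GRing.unit ->
  (exists2 u : 'I_2 -> L, torsion_basis iota phi2 u &
       SL F 2 `<=` torsion_image iota phi2 u
           (galois_group (range iota) (torsion_field iota phi2 'X))) ->
  exists g G, [/\ over_K iota g, acts_by iota w g G & G 1 0 \is a GRing.unit].
Proof.
move=> wS wU [u [uT uB] SLsub].
have w0T : torsion iota phi2 'X (w 0)$_0.
  by apply: (sol_torsion frE act2 0); apply/sol_iota.
have w00 : (w 0)$_0 != 0.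
  apply: contraTneq wU => w0; rewrite fps_unitE unitfE /wronskian fps_coefB !fps_coef0M /=.
  by rewrite w0 rmorph0 !mul0r subrr eqxx.
have [c [cE cU]] := uB _ w0T.
have c0 : c != 0.
  apply: contraNneq w00 => c0; rewrite cE torsion_combE c0 big1 // => i _.
  by rewrite mxE rmorph0 mul0r.
have [M M1 Mc] := matrix_moving_vector c0.
have [s sG sM] := SLsub M M1.
have [t tK ts] := galois_group_extends hL (fun _ h => h) (@sub_adjoin_base _ _ _)
   (adjoin_subfield _ _) sG.
have [G tG] := acts_by_exists frE wS wU tK.
exists t, G; split=> //; rewrite fps_unitE unitfE; apply/eqP => G10.
have t_u i : t (u i) = torsion_comb iota phi2 u (col i M).
  by rewrite ts; [apply: sM|apply: sub_adjoin_gen].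
have tw_w : t (w 0)$_0 = cF (G 0 0)$_0 * (w 0)$_0.
  rewrite -[LHS]/((map_fps t (w 0))$_0) tG /series_comb sum_ord2 fps_coefD !fps_coef0M /= G10.
  by rewrite rmorph0 mul0r addr0.
have Mce : t (w 0)$_0 = torsion_comb iota phi2 u (M *m c).
  rewrite cE !torsion_combE rmorph_sum.
  under eq_bigr => i _ do rewrite rmorphM (aut_const tK) t_u torsion_combE mulr_sumr.
  rewrite exchange_big; apply: eq_bigr => i _; rewrite mxE rmorph_sum mulr_suml.
  by apply: eq_bigr => m _; rewrite mxE rmorphM mulrCA mulrA.
have dce : t (w 0)$_0 = torsion_comb iota phi2 u ((G 0 0)$_0 *: c).
  rewrite tw_w {1}cE !torsion_combE mulr_sumr; apply: eq_bigr => i _.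
  by rewrite mxE rmorphM mulrA.
have tT : torsion iota phi2 'X (t (w 0)$_0).
  have := sol_torsion frE act2 0 (aut_sol frE tK ((sol_iota iota fr b (w 0)).1 (wS 0))); exact.
have [c' [_ c'U]] := uB _ tT.
by apply: (Mc (G 0 0)$_0); rewrite -(c'U _ Mce) -(c'U _ dce).
Qed.

Section Dense.
Variable w : 'I_2 -> fps L.
Hypothesis wS : forall i, sol b (w i).
Hypothesis wU : wronskian fr (w 0) (w 1) \is a GRing.unit.
Hypothesis dense : forall k M, \det M = 1 ->
  exists s : {rmorphism L -> L},
    [/\ over_K iota s, fixes_solutions iota fr a s & acts_mod iota w k s M].

(** Density does not depend on the basis of the Tate module. *)
Lemma change_of_basis (w' : 'I_2 -> fps L) : (forall i, sol b (w' i)) ->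
  wronskian fr (w' 0) (w' 1) \is a GRing.unit ->
  forall k M, \det M = 1 ->
  exists s : {rmorphism L -> L},
    [/\ over_K iota s, fixes_solutions iota fr a s & acts_mod iota w' k s M].
Proof.
move=> w'S w'U k M M1.
have /choice [p pE] j := coordinates frE wS wU (w'S j).
have /choice [q qE] j := coordinates frE w'S w'U (wS j).
pose P := \matrix_(i, j) p j i; pose Q := \matrix_(i, j) q j i.
have PE j : w' j = series_comb iota w (P^~ j).
  by rewrite pE; apply: eq_bigr => i _; rewrite mxE.
have QE j : w j = series_comb iota w' (Q^~ j).
  by rewrite qE; apply: eq_bigr => i _; rewrite mxE.
have PQ : P *m Q = 1%:M.
  apply/matrixP => i j.
  apply: (series_comb_inj frE wU (c := (P *m Q)^~ j) (d := (1%:M : 'M_2)^~ j)).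
  rewrite series_comb_mulmx; transitivity (w j).
    by rewrite [RHS]QE; apply: eq_bigr => m _; congr (_ * _); apply/esym/PE.
  by have := acts_by_id iota w (s := idfun) (fun _ => erefl) j => <-; apply/fpsP.
have QP := mulmx1C PQ.
have N1 : \det (P *m M *m Q) = 1.
  by rewrite !det_mulmx M1 mulr1 -det_mulmx PQ det1.
have [s [sK sf sN]] := dense k N1.
exists s; split=> // j.
have -> : map_fps s (w' j) - series_comb iota w' (M^~ j) =
  \sum_i map_fps cF (P i j) * (map_fps s (w i) - series_comb iota w ((P *m M *m Q)^~ i)).
  under [RHS]eq_bigr => i _ do rewrite mulrBr.
  rewrite sumrB -(map_series_comb w _ sK) -PE; congr (_ - _).
  rewrite -(series_comb_mulmx iota w (P *m M *m Q) P j) -mulmxA QP mulmx1 series_comb_mulmx.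
  by apply: eq_bigr => i _; congr (_ * _); apply: PE.
by rewrite sum_ord2; apply: fps_low0D; apply: fps_low0_Ml.
Qed.

(** An automorphism over [K_C] has determinant 1, so on the torsion field containing
    [x] it coincides with an automorphism that fixes the first tower. *)
Lemma invariant_in_KC x : K2 x ->
  (forall s : {rmorphism L -> L}, over_K iota s -> fixes_solutions iota fr a s ->
     s x = x) -> KC x.
Proof.
move=> [k _ xk] x_inv.
have KCsub := tower_subfield frE (carlitz_act iota frE).
have [E [j jE]] := subfield_as_type KCsub.
have KCj e : KC (j e) by rewrite -jE; exists e.
have [y|i ji] := rmorphism_factor (j := j) (f := iota).
  have : KC (iota y) by apply: (tower_base frE (carlitz_act iota frE)); exists y.
  by rewrite -jE => -[e _ ey]; exists e.
rewrite -jE; have [|e ex] := @fixed_by_auts _ _ _ hL E j i x ji; last by exists e.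
move=> s sj; have sK : over_K iota s.
  by move=> y; rewrite /= -[iota y](ji y); apply: sj.
have sC y : KC y -> s y = y by rewrite -jE => -[e _ <-]; apply: sj.
have [N sN] := acts_by_exists frE wS wU sK.
have N1 := acts_by_det1 frE wS wU sC sN.
have [t [tK tf tN]] := dense k N1.
have sN' := acts_by_mod (k := k) sN.
by rewrite (rank2_agree hL frE phi2E wS wU sK tK sN' tN xk) x_inv.
Qed.

Lemma fixes_K1 (s : {rmorphism L -> L}) : over_K iota s -> fixes_solutions iota fr a s ->
  forall x, K1 x -> s x = x.
Proof. exact: (rank2_fixed hL frE phi1E). Qed.

Lemma towers_meet : K1 `&` K2 = KC.
Proof.
apply/seteqP; split=> [x [x1 x2]|x xC].
  by apply: invariant_in_KC => // s sK sf; apply: fixes_K1.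
split; [exact: (carlitz_sub_tower hL frE phi1E)|exact: (carlitz_sub_tower hL frE phi2E)].
Qed.

(** In a shortest relation over [K_2], normalized so that one coefficient is 1, the
    automorphisms fixing [K_1] must fix the other coefficients. *)
Lemma towers_linearly_disjoint : linearly_disjoint KC K1 K2.
Proof.
split; [exact: (carlitz_sub_tower hL frE phi1E)|exact: (carlitz_sub_tower hL frE phi2E)|].
have hK2 : is_subfield K2 := rank2_tower_subfield iota frE phi2E.
move=> n x x1 free_x; pose supp (c : 'I_n -> L) := #|[pred i | c i != 0]|.
have main m (c : 'I_n -> L) : (supp c <= m)%N -> (forall i, K2 (c i)) ->
    \sum_(i < n) c i * x i = 0 -> forall i, c i = 0.
  elim: m c => [|m IHm] c.
    rewrite leqn0 => /eqP /card0_eq c0 _ _ i; apply/eqP.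
    by have := c0 i; rewrite !inE => /negbFE.
  move=> supp_c c2 cx; apply: contrapT => nc0.
  have [i0 ci0] : exists i, c i != 0.
    by apply: contrapT => nc; apply: nc0 => i; apply/eqP; apply: contra_notT nc => ci; exists i.
  (* Normalization: the coefficient of index [i0] becomes 1. *)
  pose d i := c i / c i0.
  have d2 i : K2 (d i) by apply: (subfield_div hK2).
  have dx : \sum_(i < n) d i * x i = 0.
    transitivity ((c i0)^-1 * \sum_(i < n) c i * x i); last by rewrite cx mulr0.
    by rewrite mulr_sumr; apply: eq_bigr => i _; rewrite /d; ring.
  have d_inv (s : {rmorphism L -> L}) : over_K iota s -> fixes_solutions iota fr a s ->
      forall i, s (d i) = d i.
    move=> sK sf i; apply/eqP; rewrite -subr_eq0; apply/eqP.
    move: i; apply: (IHm (fun i => s (d i) - d i)).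
    - rewrite -ltnS; apply: leq_trans supp_c; apply: proper_card.
      apply/fintype.properP; split.
        apply/fintype.subsetP => i; rewrite !inE /d; apply: contraNN => /eqP ->.
        by rewrite mul0r rmorph0 subrr.
      exists i0; rewrite !inE //.
      by rewrite /d divff // rmorph1 subrr eqxx.
    - move=> i; apply: (subfieldB hK2) => //; have [k k0 dk] := d2 i.
      exists k => //; exact: (rank2_stable hL frE phi2E sK dk).
    - under eq_bigr => i _ do rewrite mulrBl.
      rewrite sumrB dx subr0; transitivity (s (\sum_(i < n) d i * x i)).
        by rewrite rmorph_sum; apply: eq_bigr => i _; rewrite rmorphM (fixes_K1 sK sf (x1 i)).
      by rewrite dx rmorph0.
  have dC i : KC (d i) by apply: invariant_in_KC => // s sK sf; apply: d_inv.
  have /eqP := free_x d dC dx i0.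
  by rewrite /d divff // oner_eq0.
move=> c c2 cx; exact: (main _ c (leqnn _) c2 cx).
Qed.

End Dense.
End TateImage.

(** * The image of the Tate representation *)

Section Gluing.
Variables (F : finFieldType) (L : fieldType) (iota : {rmorphism ratfun F -> L}).
Hypothesis hL : separable_closure iota.
Variable fr : {rmorphism L -> L}.
Hypothesis frE : forall x, fr x = x ^+ #|F|.
Local Notation cF := (const_emb iota).
Local Notation th := (iota (theta F)).
Local Notation sol c := (tate_eq fr th (iota c) (-1)).
Local Notation KC := (torsion_tower iota (carlitz F)).
Variables (phi1 phi2 : drinfeld_module F 2) (a b : ratfun F).
Hypothesis phi1E : phi1 'X = twC (theta F) + twC a * tau F - tau F ^+ 2.
Hypothesis phi2E : phi2 'X = twC (theta F) + twC b * tau F - tau F ^+ 2.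
Local Notation K1 := (torsion_tower iota phi1).
Local Notation K2 := (torsion_tower iota phi2).
Local Notation tfield2 k := (torsion_field iota phi2 'X^k).
Let act2 x := drinfeld2_act iota frE x phi2E.

Lemma tfield2_mono k m : (k <= m)%N -> tfield2 k `<=` tfield2 m.
Proof. exact: (tfield_mono frE act2). Qed.

Lemma acts_mod_mono w k m (s : {rmorphism L -> L}) M : (k <= m)%N ->
  acts_mod iota w m s M -> acts_mod iota w k s M.
Proof. by move=> le_km sM j i lt_i; apply: sM; apply: leq_trans le_km. Qed.

(** Automorphisms with congruent matrices modulo [t^k] agree on [K(phi[t^k])], and
    [K_2] is the union of these fields. *)
Lemma glue_automorphisms w M : (forall i, sol b (w i)) ->
  wronskian fr (w 0) (w 1) \is a GRing.unit ->
  (forall k, exists s : {rmorphism L -> L},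
     [/\ over_K iota s, fixes_solutions iota fr a s & acts_mod iota w k s M]) ->
  exists2 s, galois_group KC K2 s & forall j n, s (w j)$_n = (series_comb iota w (M^~ j))$_n.
Proof.
move=> wS wU /choice [s sP].
have sK k : over_K iota (s k) by case: (sP k).
have sM k : acts_mod iota w k (s k) M by case: (sP k).
have agree k m x : (k <= m)%N -> tfield2 k x -> s m x = s k x.
  move=> le_km; apply: (rank2_agree hL frE phi2E wS wU (sK m) (sK k) _ (sM k)).
  exact: acts_mod_mono (sM m).
have /choice [lev levP] x : exists k, K2 x -> tfield2 k x.
  by have [/tower_tfield [k xk]|nx] := pselect (K2 x); [exists k|exists 0].
pose t x := s (lev x) x.
have tE k x : tfield2 k x -> t x = s k x.
  move=> xk; have x2 : K2 x := tfield_tower frE act2 xk.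
  have xl := levP x x2; rewrite /t.
  have [le_kl|/ltnW le_lk] := leqP k (lev x); first exact: agree.
  by rewrite (agree _ _ _ le_lk xl).
have two x y : K2 x -> K2 y -> exists k, tfield2 k x /\ tfield2 k y.
  move=> x2 y2; exists (maxn (lev x) (lev y)).
  by split; [apply: tfield2_mono (levP x x2)|apply: tfield2_mono (levP y y2)];
    rewrite ?leq_maxl ?leq_maxr.
have tK2 x : K2 x -> K2 (t x).
  move=> x2; have xk := levP x x2; rewrite (tE _ _ xk).
  exact: (tfield_tower frE act2 (rank2_stable hL frE phi2E (sK _) xk)).
exists t; last first.
  move=> j n; have wk := sol_tfield frE act2 (n := n) ((sol_iota iota fr b (w j)).1 (wS j)).
  rewrite (tE _ _ wk); apply/eqP; rewrite -subr_eq0 -[s _ _]/((map_fps (s n.+1) (w j))$_n).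
  by rewrite -fps_coefB; apply/eqP; apply: sM.
split.
- split=> [x x2|x y|y y2].
  + exact: tK2.
  + rewrite !inE => x2 y2; have [k [xk yk]] := two x y x2 y2.
    by rewrite (tE _ _ xk) (tE _ _ yk); apply: fmorph_inj.
  + have yk := levP y y2; set k := lev y in yk.
    have [s' [ss' s's]] := aut_inv hL (sK k).
    have s'K : over_K iota s' by move=> x; rewrite /= -[in LHS](sK k x) /= ss'.
    have xk := rank2_stable hL frE phi2E s'K yk.
    exists (s' y); first exact: (tfield_tower frE act2 xk).
    by rewrite (tE _ _ xk) s's.
- move=> x y; rewrite !inE => x2 y2; have [k [xk yk]] := two x y x2 y2.
  rewrite (tE _ _ xk) (tE _ _ yk) (tE k) ?rmorphD //.
  exact: (subfieldD (adjoin_subfield _ _)).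
- move=> x y; rewrite !inE => x2 y2; have [k [xk yk]] := two x y x2 y2.
  rewrite (tE _ _ xk) (tE _ _ yk) (tE k) ?rmorphM //.
  exact: (subfieldM (adjoin_subfield _ _)).
- move=> x; rewrite inE => xC; rewrite /t; case: (sP (lev x)) => kK kf _.
  apply: (fixes_K1 hL frE phi1E kK kf); exact: (carlitz_sub_tower hL frE phi1E).
Qed.

(** A basis with unit Wronskian exists; expressed in the given basis, its Wronskian
    is a determinant times that of the given one. *)
Lemma tate_basis_wronskian e : tate_basis iota phi2 e ->
  (forall i, sol b (gen_series (e i))) /\
  wronskian fr (gen_series (e 0)) (gen_series (e 1)) \is a GRing.unit.
Proof.
move=> [eT eB]; have eS i : sol b (gen_series (e i)).
  by apply/sol_iota; apply: (tate_sol frE act2).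
split=> //; have [w [wS wU]] := rank2_basis_exists hL frE (iota b).
have /choice [c cE] i : exists c, w i = series_comb iota (fun i => gen_series (e i)) c.
  have [c [cE _]] := eB _ (ungen_tate frE act2 ((sol_iota iota fr b (w i)).1 (wS i))).
  by exists (fun i => c i 0); rewrite -[w i]ungenK cE (tate_comb_gen frE act2).
move: wU; rewrite !cE (wronskian_combE iota frE (fun i => gen_series (e i))).
by rewrite unitrM => /andP [].
Qed.

Lemma tate_image_SL w : (forall i, sol b (w i)) ->
  wronskian fr (w 0) (w 1) \is a GRing.unit ->
  (forall k M, \det M = 1 -> exists s : {rmorphism L -> L},
     [/\ over_K iota s, fixes_solutions iota fr a s & acts_mod iota w k s M]) ->
  forall e, tate_basis iota phi2 e ->
    tate_image iota phi2 e (galois_group KC K2) = SL (fps F) 2.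
Proof.
move=> wS wU dense e eB; have [eS eU] := tate_basis_wronskian eB.
pose v i := gen_series (e i).
have eT := eB.1.
have combE (M : 'M[fps F]_2) j :
    gen_series (tate_comb iota phi2 e (col j M)) = series_comb iota v (M^~ j).
  by rewrite (tate_comb_gen frE act2) //; apply: eq_bigr => i _; rewrite mxE.
have hK2 := rank2_tower_subfield iota frE phi2E.
have KC2 := carlitz_sub_tower hL frE phi2E.
apply/seteqP; split=> M.
  move=> [s sG sM]; rewrite /SL /=.
  have [t tK ts] := galois_group_extends hL (tower_base frE (carlitz_act iota frE))
    (rank2_tower_base frE phi2E) hK2 sG.
  apply: (@acts_by_det1 _ _ iota fr frE b v t M eS eU) => [x xC|j].
    by rewrite ts; [case: sG => _ _ _; apply; rewrite inE|apply: KC2].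
  rewrite -combE -sM; apply/fpsP => n /=; apply: ts.
  exact: (rank2_coef frE phi2E n (eS j)).
move=> M1; have denseM k := change_of_basis frE wS wU dense eS eU k M1.
have [s sG sw] := glue_automorphisms eS eU denseM.
exists s => // j; apply/funext => -[|n] /=.
  rewrite (tate_comb0 iota frE) (tate0 frE (eT j)).
  have [_ sD _ _] := sG; have K20 : 0 \in K2 by rewrite inE; apply: subfield0.
  by have := sD 0 0 K20 K20; rewrite addr0 => /esym/eqP; rewrite -subr_eq0 addrK => /eqP.
by rewrite -[LHS]/(s (v j)$_n) sw -combE.
Qed.

End Gluing.

Theorem theorem6p6 (F : finFieldType) (Ksep : fieldType)
    (iota : {rmorphism ratfun F -> Ksep}) (hKsep : separable_closure iota)
    (a b : ratfun F) (phi1 phi2 : drinfeld_module F 2)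
    (hphi1 : phi1 'X = twC (theta F) + twC a * tau F - tau F ^+ 2)
    (hphi2 : phi2 'X = twC (theta F) + twC b * tau F - tau F ^+ 2)
    (l : {poly F}) (hl : irreducible_poly l) (hltheta : ~~ (l %= 'X))
    (hla : (0 <= vadic l a)%E) (hlb : (vadic l b < 0)%E)
    (hlgcd : gcdz #|F|%:Z (fine (vadic l b)) = 1)
    (hSL : exists2 u : 'I_2 -> Ksep, torsion_basis iota phi2 u &
       SL F 2 `<=`
         torsion_image iota phi2 u
           (galois_group (range iota) (torsion_field iota phi2 'X))) :
  let K1 := torsion_tower iota phi1 in
  let K2 := torsion_tower iota phi2 in
  let KC := torsion_tower iota (carlitz F) in
  [/\ forall e : 'I_2 -> nat -> Ksep, tate_basis iota phi2 e ->
        tate_image iota phi2 e (galois_group KC K2) = SL (fps F) 2,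
      linearly_disjoint KC K1 K2,
      lead_coef (twpoly (phi1 'X)) = (-1) ^+ (2 - 1),
      lead_coef (twpoly (phi2 'X)) = (-1) ^+ (2 - 1) &
      K1 `&` K2 = KC].
Proof.
have [fr frE] := frobenius_morphism (const_emb iota).
have [w [wS wU unipotents]] := many_unipotents hKsep frE hl hltheta hla hlb hlgcd.
have [g [G [gK gG GU]]] := moving_automorphism hKsep frE hphi2 wS wU hSL.
have dense k M : \det M = 1 -> exists s : {rmorphism Ksep -> Ksep},
    [/\ over_K iota s, fixes_solutions iota fr a s & acts_mod iota w k s M].
  exact: (SL2_dense hKsep frE wS wU unipotents k gK gG GU).
split.
- exact: (tate_image_SL hKsep frE hphi1 hphi2 wS wU dense).
- exact: (towers_linearly_disjoint hKsep frE hphi1 hphi2 wS wU dense).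
- by rewrite (drinfeld2_lead hphi1).
- by rewrite (drinfeld2_lead hphi2).
- exact: (towers_meet hKsep frE hphi1 hphi2 wS wU dense).
Qed.
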